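(* Let $N\geq 1$ and let $\dot{\phi}:\mathbb{N}\to\mathbb{C}$ be a bounded function. Then $\dot{\phi}$ defines a radial Schur multiplier on every product $X_1\times\cdots\times X_N$ of $N$ hyperbolic graphs $X_1,\dots,X_N$ with bounded degree if and only if the generalised Hankel matrix $$H=\left(\tbinom{N+i-1}{N-1}^{\frac12}\tbinom{N+j-1}{N-1}^{\frac12}\,\mathfrak{d}_1^N\dot{\phi}(i+j)\right)_{i,j\in\mathbb{N}}$$ is an element of $S_1(\ell_2(\mathbb{N}))$. Moreover, in that case, $\dot{\phi}(n)$ converges to some limit $c\in\mathbb{C}$ as $n\to\infty$, and for all hyperbolic graphs $X_1,\dots,X_N$ with bounded degree there exists $C>0$ depending only on $X_1,\dots,X_N$ such that the Schur multiplier $\phi$ defined by $\dot{\phi}$ on $X_1\times\cdots\times X_N$ satisfies $$\|\phi\|_{cb}\leq C\|H\|_{S_1}+|c|.$$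
   Context: $\mathbb{N}=\{0,1,2,\dots\}$. For a nonempty set $X$, a function $\phi:X\times X\to\mathbb{C}$ is a Schur multiplier on $X$ if the map $M_\phi:(T_{x,y})_{x,y\in X}\mapsto(\phi(x,y)T_{x,y})_{x,y\in X}$ defines a bounded operator on $\mathcal{B}(\ell_2(X))$, where $T_{x,y}=\langle T\delta_y,\delta_x\rangle$; one writes $\|\phi\|_{cb}=\|M_\phi\|$. A connected graph is identified with its vertex set and carries its combinatorial (shortest path) distance $d$; on a product of graphs the combinatorial distance is $d(x,y)=\sum_{i=1}^N d(x_i,y_i)$. Hyperbolic means (connected and) hyperbolic in the sense of Gromov; bounded degree means the vertex degrees are uniformly bounded. A function $\dot{\phi}:\mathbb{N}\to\mathbb{C}$ defines a radial Schur multiplier on $X$ if $\phi(x,y)=\dot{\phi}(d(x,y))$ is a Schur multiplier on $X$. Discrete derivative: $\mathfrak{d}_1\dot{\phi}(n)=\dot{\phi}(n)-\dot{\phi}(n+1)$, and $\mathfrak{d}_1^{m+1}\dot{\phi}=\mathfrak{d}_1(\mathfrak{d}_1^m\dot{\phi})$. $S_1(\ell_2(\mathbb{N}))$ is the space of trace class operators on $\ell_2(\mathbb{N})$ with trace norm $\|\cdot\|_{S_1}$; an infinite matrix belongs to it if it is the matrix, in the canonical basis, of a trace class operator. *)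

(* Defs.v *)
From HB Require Import structures.
From mathcomp Require Import all_boot all_order all_algebra.
From mathcomp Require Import complex ring.
From mathcomp Require Import all_classical all_reals all_analysis.

Set Implicit Arguments.
Unset Strict Implicit.
Unset Printing Implicit Defensive.
Import Order.TTheory GRing.Theory Num.Theory.
Import numFieldNormedType.Exports.

Local Open Scope classical_set_scope.
Local Open Scope ring_scope.
Local Open Scope complex_scope.

(* R[i] is canonically an R-module; the copy R[i]^o carries the
   R[i]-module structure wanted on the complex Hilbert space l2(X). *)
(* [Normc.normc z : R] is the real-valued modulus of [z : R[i]]. *)

Section SquareSummable.
Variables (R : realType) (X : choiceType).
Implicit Types f g : X -> R[i]^o.

Definition sqnorm f : \bar R :=
  (\esum_(x in [set: X]) (Normc.normc (f x) ^+ 2)%:E)%E.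

Definition sq_summable : {pred X -> R[i]^o} := fun f => `[< (sqnorm f < +oo)%E >].

Lemma sqnorm_scaleD (c : R[i]) f g :
  (sqnorm (c *: f + g)%R <=
   (2 * Normc.normc c ^+ 2)%:E * sqnorm f + 2%:E * sqnorm g)%E.
Proof.
have n0 z : 0 <= Normc.normc z :> R by case: z => a b; exact: sqrtr_ge0.
have esumZ (k : R) (a : X -> R) : 0 <= k -> (forall x, 0 <= a x) ->
    (\esum_(x in [set: X]) (k * a x)%:E <=
     k%:E * \esum_(x in [set: X]) (a x)%:E)%E.
  move=> k0 a0; apply: ub_ereal_sup => _ [F [finF _] <-].
  rewrite (eq_fsbigr (fun x => k%:E * (a x)%:E)%E); last first.
    by move=> x _; rewrite EFinM.
  rewrite -ge0_mule_fsumr; last by move=> x; rewrite lee_fin.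
  by apply: lee_wpmul2l; [rewrite lee_fin | apply: ereal_sup_ubound; exists F].
have k0 : 0 <= 2 * Normc.normc c ^+ 2 by rewrite mulr_ge0 ?sqr_ge0.
apply: (@le_trans _ _ (\esum_(x in [set: X])
   ((2 * Normc.normc c ^+ 2 * Normc.normc (f x) ^+ 2)%:E
    + (2 * Normc.normc (g x) ^+ 2)%:E))%E).
  apply: le_esum => x _; rewrite -EFinD lee_fin.
  have : Normc.normc (c * f x + g x) <= Normc.normc c * Normc.normc (f x)
      + Normc.normc (g x) by rewrite -Normc.normcM; exact: le_normcD.
  rewrite -[(c *: f + g) x]/(c * f x + g x).
  set p := Normc.normc (_ + _); set q := Normc.normc (g x).
  set r := Normc.normc c; set s := Normc.normc (f x) => h.
  apply: (@le_trans _ _ ((r * s + q) ^+ 2)).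
    by rewrite lerXn2r ?nnegrE ?addr_ge0 ?mulr_ge0 ?n0.
  rewrite -subr_ge0 (_ : _ - _ = (r * s - q) ^+ 2) ?sqr_ge0 //.
  by ring.
rewrite esumD; first 1 last.
- by move=> x _; rewrite lee_fin mulr_ge0 ?sqr_ge0.
- by move=> x _; rewrite lee_fin mulr_ge0 ?sqr_ge0.
by apply: leeD; apply: esumZ => // x; rewrite sqr_ge0.
Qed.

Lemma sq_summable_submod : submod_closed sq_summable.
Proof.
split.
  apply/asboolP; rewrite /sqnorm esum1 // => x _.
  by rewrite [(0 : X -> R[i]^o) x]/= Normc.normc0 expr0n.
move=> c f g /asboolP hf /asboolP hg; apply/asboolP.
apply: le_lt_trans (sqnorm_scaleD c f g) _.
have f0 : (0 <= sqnorm f)%E by apply: esum_ge0 => x _; rewrite lee_fin sqr_ge0.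
have g0 : (0 <= sqnorm g)%E by apply: esum_ge0 => x _; rewrite lee_fin sqr_ge0.
have/fineK <- : sqnorm f \is a fin_num by rewrite ge0_fin_numE.
have/fineK <- : sqnorm g \is a fin_num by rewrite ge0_fin_numE.
by rewrite -!EFinM -EFinD ltry.
Qed.

HB.instance Definition _ :=
  GRing.isSubmodClosed.Build R[i] (X -> R[i]^o) sq_summable sq_summable_submod.

Record l2 := L2 { l2_fun :> X -> R[i]^o; l2P : l2_fun \in sq_summable }.

HB.instance Definition _ := [isSub for l2_fun].
HB.instance Definition _ := [Choice of l2 by <:].
HB.instance Definition _ := [SubChoice_isSubLmodule of l2 by <:].

Lemma delta_sq_summable (y : X) :
  (fun x : X => (x == y)%:R : R[i]^o) \in sq_summable.
Proof.
apply/asboolP; rewrite /sqnorm.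
rewrite (_ : [set: X] = [set y] `|` ~` [set y]); last by rewrite setUv.
rewrite (esumID [set y]); last by move=> x _; rewrite lee_fin sqr_ge0.
rewrite setUK esum_set1 ?lee_fin ?sqr_ge0 // esum1 ?adde0 ?ltry // => x [_].
by move=> /= /eqP/negPf ->; rewrite Normc.normc0 expr0n.
Qed.

Definition delta (y : X) : l2 := L2 (delta_sq_summable y).

(* Unconditional sums over X, meaningful for absolutely summable families. *)
Definition rsum (a : X -> R) : R :=
  fine (\esum_(x in [set: X]) (Num.max (a x) 0)%:E)%E
  - fine (\esum_(x in [set: X]) (Num.max (- a x) 0)%:E)%E.

Definition csum (f : X -> R[i]) : R[i] :=
  rsum (fun x => complex.Re (f x)) +i* rsum (fun x => complex.Im (f x)).

Implicit Types u v : l2.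

Definition inner u v : R[i] := csum (fun x => (u x : R[i]) * (v x : R[i])^*).

Definition l2norm u : R := Num.sqrt (fine (sqnorm u)).

Record bounded_operator := BoundedOperator {
  op_fun :> {linear l2 -> l2};
  op_bounded : exists K : R, forall u, l2norm (op_fun u) <= K * l2norm u }.

HB.instance Definition _ := gen_eqMixin bounded_operator.
HB.instance Definition _ := gen_choiceMixin bounded_operator.

Implicit Types S T P : bounded_operator.

Definition opnorm T : R := sup [set l2norm (T u) | u in [set u | l2norm u <= 1]].

Definition mxcoef T (x y : X) : R[i] := inner (T (delta y)) (delta x).

Definition has_matrix T (A : X -> X -> R[i]) : Prop :=
  forall x y, mxcoef T x y = A x y.

Definition adjoint T S : Prop := forall u v, inner (T u) v = inner u (S v).

(* The order of R[i] makes this say that <Pu, u> is real and nonnegative. *)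
Definition positive_op P : Prop := forall u, 0 <= inner (P u) u.

(* P = (T^* T)^(1/2) *)
Definition is_absop T P : Prop :=
  positive_op P /\ exists2 S, adjoint T S & forall u, P (P u) = S (T u).

(* Every bounded operator has exactly one absolute value, so the default [T]
   is never used. *)
Definition absop T : bounded_operator := xget T [set P | is_absop T P].

(* The trace norm Tr |T|, possibly infinite. *)
Definition trace_norm T : \bar R :=
  (\esum_(x in [set: X]) (complex.Re (mxcoef (absop T) x x))%:E)%E.

Definition trace_class T : Prop := (trace_norm T < +oo)%E.

Definition schur_product (phi : X -> X -> R[i]) T : X -> X -> R[i] :=
  fun x y => phi x y * mxcoef T x y.

Definition schur_multiplier (phi : X -> X -> R[i]) : Prop :=
  exists M : bounded_operator -> bounded_operator,
    (forall T, has_matrix (M T) (schur_product phi T)) /\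
    exists K : R, forall T, opnorm (M T) <= K * opnorm T.

(* The norm of M_phi: an operator is determined by its matrix, so S below
   is M_phi(T). *)
Definition cb_norm (phi : X -> X -> R[i]) : \bar R :=
  ereal_sup [set (opnorm S)%:E | S in
    [set S | exists2 T, opnorm T <= 1 & has_matrix S (schur_product phi T)]].

End SquareSummable.

Record connected_graph := ConnectedGraph {
  vertex :> choiceType;
  edge : rel vertex;
  edge_sym : symmetric edge;
  edge_irr : irreflexive edge;
  vertex_inhabited : inhabited vertex;
  edge_connected : forall x y, exists2 p, path edge x p & last x p = y }.

Section Graphs.
Variable X : connected_graph.

Definition walk_length (x y : X) : pred nat := fun n =>
  `[< exists p, [/\ path (@edge X) x p, last x p = y & size p = n] >].

Lemma walk_length_ex (x y : X) : exists n, walk_length x y n.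
Proof.
have [p xp yp] := edge_connected x y.
by exists (size p); apply/asboolP; exists p.
Qed.

Definition gdist (x y : X) : nat := ex_minn (walk_length_ex x y).

Definition gromov_product (R : realType) (x y w : X) : R :=
  ((gdist x w)%:R + (gdist y w)%:R - (gdist x y)%:R) / 2.

Definition hyperbolic (R : realType) : Prop :=
  exists delta : R, forall x y z w : X,
    Num.min (gromov_product R x y w) (gromov_product R y z w) - delta
    <= gromov_product R x z w.

Definition bounded_degree : Prop :=
  exists D : nat, forall x : X, ([set y | edge x y] #<= `I_D)%card.

End Graphs.

Definition product_vertex (N : nat) (X : 'I_N -> connected_graph) : choiceType :=
  {dffun forall i : 'I_N, X i}.

Definition product_dist (N : nat) (X : 'I_N -> connected_graph)
    (x y : product_vertex X) : nat :=
  (\sum_(i < N) gdist (x i) (y i))%N.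

Definition radial_symbol (R : realType) (phi : nat -> R[i]) (N : nat)
    (X : 'I_N -> connected_graph) (x y : product_vertex X) : R[i] :=
  phi (product_dist x y).

Definition hyperbolic_family (R : realType) (N : nat)
    (X : 'I_N -> connected_graph) : Prop :=
  forall i, hyperbolic (X i) R /\ bounded_degree (X i).

Definition discrete_derivative (R : realType) (phi : nat -> R[i]) : nat -> R[i] :=
  fun n => phi n - phi n.+1.

Definition gen_hankel (R : realType) (N : nat) (phi : nat -> R[i])
    (i j : nat) : R[i] :=
  (Num.sqrt ('C(N + i - 1, N - 1)%:R : R))%:C
  * (Num.sqrt ('C(N + j - 1, N - 1)%:R : R))%:C
  * iter N (@discrete_derivative R) phi (i + j)%N.

(* Main.v *)
(* Put h = d_1^N phi.  The number of N-tuples of naturals with sum i is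
   binom(N+i-1, N-1), so by trace duality H is of trace class if and only if
   sum_(a,b) gamma(a,b) h(|a| + |b|) is bounded over all finite kernels gamma
   of norm at most 1 indexed by multi-indices; the operator norm of a kernel is
   expressed throughout by a bound on its bilinear form.

   If H is of trace class, then sum_j binom(N+j-1, N-1) |h j| is finite, so phi
   has a limit c and phi(d) - c is the sum of h(n_1 + ... + n_N) over all n_i
   not smaller than d_i.  On a hyperbolic graph [d(x,y) <= n] is a sum over
   k + l = n of scalar products <alpha_k(x), beta_l(y)> of vectors satisfying
   the Schur test uniformly (Ozawa), and taking products over the coordinates
   writes the Schur product with phi - c as a pairing with H.

   Conversely it is enough to test products of one graph, a tree of triangles
   whose vertices are words.  It carries two orthogonal families of vectors
   a_(kappa,i), b_(kappa,j) such that the kernel sum_kappa a_(kappa,i) b_(kappa,j),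
   multiplied entrywise by X^d and paired with the vectors 2^(-|word|) on a
   shell of thickness K and on a ball, gives K (1 - X) X^(i+j) / 4, while those
   vectors have squared norm at most 4 K.  Substituting phi(n) for X^n in the
   N-fold product recovers sum gamma(a,b) h(|a| + |b|). *)

From HB Require Import structures.
Require Import Defs.
From mathcomp Require Import all_boot all_order all_algebra.
From mathcomp Require Import complex ring lra zify.
From mathcomp Require Import finmap.
From mathcomp Require Import all_classical all_reals all_analysis.

Set Implicit Arguments.
Unset Strict Implicit.
Unset Printing Implicit Defensive.
Import Order.TTheory GRing.Theory Num.Theory.
Import numFieldNormedType.Exports.
Local Open Scope classical_set_scope.
Local Open Scope complex_scope.
Local Open Scope ring_scope.

(** Triangles are there for parity. A tree is bipartite, so (-1)^n is a radial Schur multiplier of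
    norm 1 on trees and on their products, although its matrix [H] is unbounded: opposite signs on
    two siblings at distance 2 only produce the factor 1 - X^2. Two siblings in one triangle are at
    distance 1, and opposite signs on them produce 1 - X. The test vectors cannot be square-summable
    on the whole tree, because the weight 2^(-|word|) has norm 1 on every sphere. Cutting at radii
    proportional to K makes the pairing and the squared norms grow like the same power of K, so
    their ratio 16^N is independent of K. The shell sits well inside the ball, so that the cut
    discards whole branches and creates no boundary terms. In both directions the link with [H] is
    the linear functional sending X^n to phi(n): multiplication by (1 - X)^N on polynomials is dual
    to the N-th discrete derivative. All estimates are made on finite sections, with constants
    independent of the section. *)

Notation nc := Normc.normc.

(** * Square-summable functions and bounded operators *)

Lemma eq_leW d (T : porderType d) (x y : T) : x = y -> (x <= y)%O.
Proof. by move->. Qed.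

Section Modulus.
Variable R : realType.
Implicit Types z w : R[i].

Lemma nc_ge0 z : 0 <= nc z.
Proof. by case: z => a b; exact: sqrtr_ge0. Qed.

Lemma nc_sqr z : nc z ^+ 2 = complex.Re z ^+ 2 + complex.Im z ^+ 2.
Proof. by case: z => a b /=; rewrite sqr_sqrtr // addr_ge0 ?sqr_ge0. Qed.

Lemma cjE z : z^* = conjc z. Proof. by []. Qed.
Lemma cjR (x : R) : (x%:C)^* = x%:C. Proof. exact: conjc_real. Qed.

Lemma ncJ z : nc z^* = nc z.
Proof. by rewrite cjE; case: z => a b /=; rewrite sqrrN. Qed.

Lemma nc_real (x : R) : nc x%:C = `|x|.
Proof. by rewrite /= expr0n addr0 sqrtr_sqr. Qed.

Lemma nc_nat n : nc (n%:R : R[i]) = n%:R.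
Proof. by rewrite -[n%:R](rmorph_nat (real_complex R)) nc_real normr_nat. Qed.

Lemma mulcJ z : z * z^* = (nc z ^+ 2)%:C.
Proof. by rewrite cjE nc_sqr; case: z => a b; apply/eqP; rewrite eq_complex /=; apply/andP; split; apply/eqP; ring. Qed.

Lemma nc_Re z : `|complex.Re z| <= nc z.
Proof.
by rewrite -ler_sqr ?nnegrE ?nc_ge0 // real_normK ?num_real // nc_sqr lerDl sqr_ge0.
Qed.

Lemma Re_le_nc z : complex.Re z <= nc z.
Proof. exact: le_trans (ler_norm _) (nc_Re z). Qed.

Lemma nc_Im z : `|complex.Im z| <= nc z.
Proof.
by rewrite -ler_sqr ?nnegrE ?nc_ge0 // real_normK ?num_real // nc_sqr lerDr sqr_ge0.
Qed.

Lemma nc_leReIm z : nc z <= `|complex.Re z| + `|complex.Im z|.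
Proof.
rewrite -ler_sqr ?nnegrE ?nc_ge0 ?addr_ge0 // nc_sqr sqrrD !real_normK ?num_real //.
by rewrite -addrA (addrC (_ *+ 2)) addrA lerDl mulrn_wge0 ?mulr_ge0.
Qed.

Lemma nc_eq0 z : (nc z == 0) = (z == 0).
Proof. by apply/eqP/eqP => [/Normc.eq0_normc //|->]; rewrite Normc.normc0. Qed.

Lemma nc_sum (I : Type) (r : seq I) (P : pred I) (F : I -> R[i]) :
  nc (\sum_(i <- r | P i) F i) <= \sum_(i <- r | P i) nc (F i).
Proof.
elim/big_rec2: _ => [|i y z _ h]; first by rewrite Normc.normc0.
by apply: le_trans (le_normcD _ _) _; rewrite lerD2l.
Qed.

Lemma nc_distC z w : nc (z - w) = nc (w - z).
Proof. by rewrite -normcN opprB. Qed.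

Lemma cReD z w : complex.Re (z + w) = complex.Re z + complex.Re w.
Proof. by case: z w => a b []. Qed.
Lemma cImD z w : complex.Im (z + w) = complex.Im z + complex.Im w.
Proof. by case: z w => a b []. Qed.
Lemma cReN z : complex.Re (- z) = - complex.Re z.
Proof. by case: z. Qed.
Lemma cImN z : complex.Im (- z) = - complex.Im z.
Proof. by case: z. Qed.
Lemma cReM z w : complex.Re (z * w) =
  complex.Re z * complex.Re w - complex.Im z * complex.Im w.
Proof. by case: z w => a b []. Qed.
Lemma cImM z w : complex.Im (z * w) =
  complex.Re z * complex.Im w + complex.Im z * complex.Re w.
Proof. by case: z w => a b []. Qed.

Lemma cRe_sum (I : Type) (r : seq I) (P : pred I) (F : I -> R[i]) :
  complex.Re (\sum_(i <- r | P i) F i) = \sum_(i <- r | P i) complex.Re (F i).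
Proof. exact: (big_morph _ cReD). Qed.
Lemma cIm_sum (I : Type) (r : seq I) (P : pred I) (F : I -> R[i]) :
  complex.Im (\sum_(i <- r | P i) F i) = \sum_(i <- r | P i) complex.Im (F i).
Proof. exact: (big_morph _ cImD). Qed.

Lemma cJD z w : (z + w)^* = z^* + w^*. Proof. exact: rmorphD. Qed.
Lemma cJM z w : (z * w)^* = z^* * w^*. Proof. exact: rmorphM. Qed.
Lemma cJN z : (- z)^* = - z^*. Proof. exact: rmorphN. Qed.

Lemma cReC (x : R) : complex.Re x%:C = x. Proof. by []. Qed.
Lemma cImC (x : R) : complex.Im x%:C = 0. Proof. by []. Qed.
Lemma cReJ z : complex.Re z^* = complex.Re z. Proof. by rewrite cjE; case: z. Qed.
Lemma cImJ z : complex.Im z^* = - complex.Im z. Proof. by rewrite cjE; case: z. Qed.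
Lemma cRe_lin z w (p r : R) :
  complex.Re (z - p%:C + r%:C * w) = complex.Re z - p + r * complex.Re w.
Proof. by rewrite !cReD cReN cReM cReC cImC mul0r subr0. Qed.
Lemma cReZ w (r : R) : complex.Re (r%:C * w) = r * complex.Re w.
Proof. by rewrite cReM cReC cImC mul0r subr0. Qed.
Lemma cReDC z (r : R) : complex.Re (z + r%:C) = complex.Re z + r.
Proof. by rewrite cReD. Qed.
Lemma cIm_i z w (r s : R[i]) : complex.Im r = 0 -> complex.Im s = 0 ->
  complex.Im ('i%C * ('i%C^* * r + z) + ('i%C^* * w + s)) = complex.Re z - complex.Re w.
Proof. by rewrite !cjE; case: z w r s => a b [c d] [e f] [g h] /= -> ->; ring. Qed.
Lemma cIm_sum4 z w (r s : R[i]) : complex.Im r = 0 -> complex.Im s = 0 ->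
  complex.Im (r + z + (w + s)) = complex.Im z + complex.Im w.
Proof. by case: z w r s => a b [c d] [e f] [g h] /= -> ->; ring. Qed.
Lemma rCM (a b : R) : (a * b)%:C = a%:C * b%:C. Proof. exact: rmorphM. Qed.
Lemma rC_sum (I : Type) (r : seq I) (P : pred I) (F : I -> R) :
  (\sum_(i <- r | P i) F i)%:C = \sum_(i <- r | P i) (F i)%:C.
Proof. exact: rmorph_sum. Qed.

Lemma complex_ext z w :
  complex.Re z = complex.Re w -> complex.Im z = complex.Im w -> z = w.
Proof. by case: z w => a b [c d] /= -> ->. Qed.

Lemma nc_sqrD z w : nc (z + w) ^+ 2 <= 2 * nc z ^+ 2 + 2 * nc w ^+ 2.
Proof.
rewrite !nc_sqr cReD cImD.
set a := complex.Re z; set b := complex.Im z; set c := complex.Re w; set d := complex.Im w.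
have h1 := sqr_ge0 (a - c); have h2 := sqr_ge0 (b - d).
by rewrite -subr_ge0; apply: le_trans (addr_ge0 h1 h2) _; apply: eq_leW; ring.
Qed.

End Modulus.

(** * Unconditional real sums *)

Section RealSums.
Variables (R : realType) (X : choiceType).
Implicit Types a b p q : X -> R.

Definition rsummable a := (\esum_(x in [set: X]) (`|a x|)%:E < +oo)%E.

Lemma esum_geF a (F : {fset X}) : (forall x, 0 <= a x) ->
  ((\sum_(x <- F) a x)%:E <= \esum_(x in [set: X]) (a x)%:E)%E.
Proof.
move=> a0; apply: esum_ge; exists [set` F]; first by split.
by rewrite fsbig_finite //= set_fsetK sumEFin.
Qed.

Lemma esum_leF a (M : \bar R) :
  (forall F : {fset X}, ((\sum_(x <- F) a x)%:E <= M)%E) ->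
  (\esum_(x in [set: X]) (a x)%:E <= M)%E.
Proof.
move=> h; apply: ge_ereal_sup => _ [F [finF _] <-].
by rewrite fsbig_finite //= sumEFin; exact: h.
Qed.

Lemma rsummable_le a b : (forall x, `|a x| <= b x) -> rsummable b -> rsummable a.
Proof.
move=> ab; apply: le_lt_trans; apply: le_esum => x _; rewrite lee_fin.
by apply: le_trans (ab x) _; rewrite ler_norm.
Qed.

Lemma rsummableD a b : rsummable a -> rsummable b -> rsummable (fun x => a x + b x).
Proof.
move=> ha hb; apply: (@le_lt_trans _ _ (\esum_(x in [set: X])
  ((`|a x|)%:E + (`|b x|)%:E))%E).
  by apply: le_esum => x _; rewrite -EFinD lee_fin ler_normD.
by rewrite esumD ?lte_add_pinfty // => x _; rewrite lee_fin.
Qed.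

Lemma rsummableZ k a : rsummable a -> rsummable (fun x => k * a x).
Proof.
move=> ha; have /fineK hf : (\esum_(x in [set: X]) (`|a x|)%:E \is a fin_num)%E.
  by rewrite ge0_fin_numE // esum_ge0 // => x _; rewrite lee_fin.
apply: (@le_lt_trans _ _ (`|k| * fine (\esum_(x in [set: X]) (`|a x|)%:E))%:E); last by rewrite ltry.
apply: esum_leF => F; rewrite lee_fin.
under eq_bigr do rewrite normrM.
rewrite -mulr_sumr ler_wpM2l //.
by rewrite -lee_fin hf esum_geF.
Qed.

Lemma rsummableN a : rsummable a -> rsummable (fun x => - a x).
Proof. by move=> h; apply: (rsummable_le (b := fun x => `|a x|)) => [x|]; rewrite ?normrN // /rsummable; under eq_esum do rewrite normr_id. Qed.

Lemma esum_fin a : rsummable a -> (forall x, 0 <= a x) ->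
  (fine (\esum_(x in [set: X]) (a x)%:E))%:E = (\esum_(x in [set: X]) (a x)%:E)%E.
Proof.
move=> ha a0; apply: fineK; rewrite ge0_fin_numE ?esum_ge0 // => [|x _]; last by rewrite lee_fin.
by move: ha; rewrite /rsummable; under eq_esum do rewrite ger0_norm //.
Qed.

Definition pos a x := Num.max (a x) 0.
Definition neg a x := Num.max (- a x) 0.

Lemma posneg a x : a x = pos a x - neg a x.
Proof. by rewrite /pos /neg; case: (leP (a x) 0) => h; [rewrite max_l|rewrite max_r]; lra. Qed.
Lemma pos_ge0 a x : 0 <= pos a x. Proof. by rewrite le_max lexx orbT. Qed.
Lemma neg_ge0 a x : 0 <= neg a x. Proof. by rewrite le_max lexx orbT. Qed.
Lemma pos_le a x : pos a x <= `|a x|.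
Proof. by rewrite ge_max normr_ge0 ler_norm. Qed.
Lemma neg_le a x : neg a x <= `|a x|.
Proof. by rewrite ge_max normr_ge0 -normrN ler_norm. Qed.
Lemma rsummable_norm a : rsummable a -> rsummable (fun x => `|a x|).
Proof. by rewrite /rsummable; under [X in (_ -> X < _)%E]eq_esum do rewrite normr_id. Qed.
Lemma rsummable_pos a : rsummable a -> rsummable (pos a).
Proof.
move/rsummable_norm; apply: rsummable_le => x.
by rewrite ger0_norm ?pos_ge0 ?pos_le.
Qed.
Lemma rsummable_neg a : rsummable a -> rsummable (neg a).
Proof.
move/rsummable_norm; apply: rsummable_le => x.
by rewrite ger0_norm ?neg_ge0 ?neg_le.
Qed.

(** Positive and negative parts are not additive, so linearity of [rsum] needs the freedom to
    compute it from any decomposition into nonnegative summable functions. *)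
Lemma rsum_diff a p q : rsummable p -> rsummable q ->
  (forall x, 0 <= p x) -> (forall x, 0 <= q x) -> (forall x, a x = p x - q x) ->
  rsum a = fine (\esum_(x in [set: X]) (p x)%:E) - fine (\esum_(x in [set: X]) (q x)%:E).
Proof.
move=> sp sq p0 q0 apq.
have sa : rsummable a.
  apply: (rsummable_le (b := fun x => p x + q x)); last exact: rsummableD.
  by move=> x; rewrite apq; apply: le_trans (ler_normB _ _) _; rewrite !ger0_norm.
rewrite /rsum -/(pos a) -/(neg a).
apply/eqP; rewrite subr_eq addrAC eq_sym subr_eq; apply/eqP/EFin_inj.
rewrite !EFinD (esum_fin (rsummable_pos sa) (pos_ge0 a)) (esum_fin (rsummable_neg sa) (neg_ge0 a)).
rewrite !esum_fin // -!esumD; try by move=> x _; rewrite lee_fin ?pos_ge0 ?neg_ge0.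
apply: eq_esum => x _; rewrite -!EFinD; congr EFin.
by have := posneg a x; rewrite apq; lra.
Qed.

Lemma rsumD a b : rsummable a -> rsummable b ->
  rsum (fun x => a x + b x) = rsum a + rsum b.
Proof.
move=> ha hb; rewrite (@rsum_diff _ (fun x => pos a x + pos b x) (fun x => neg a x + neg b x)).
- rewrite /rsum -/(pos a) -/(neg a) -/(pos b) -/(neg b).
  under eq_esum do rewrite EFinD.
  under [X in _ - fine X]eq_esum do rewrite EFinD.
  rewrite !esumD; try by move=> x _; rewrite lee_fin ?pos_ge0 ?neg_ge0.
  rewrite -(esum_fin (rsummable_pos ha) (pos_ge0 a)) -(esum_fin (rsummable_pos hb) (pos_ge0 b)).
  rewrite -(esum_fin (rsummable_neg ha) (neg_ge0 a)) -(esum_fin (rsummable_neg hb) (neg_ge0 b)).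
  rewrite -!EFinD /=.
  by rewrite opprD addrACA.
- exact: rsummableD (rsummable_pos ha) (rsummable_pos hb).
- exact: rsummableD (rsummable_neg ha) (rsummable_neg hb).
- by move=> x; rewrite addr_ge0 ?pos_ge0.
- by move=> x; rewrite addr_ge0 ?neg_ge0.
- by move=> x; rewrite (posneg a) (posneg b); ring.
Qed.

Lemma rsumN a : rsum (fun x => - a x) = - rsum a.
Proof. by rewrite /rsum opprB; congr (_ - fine _); apply: eq_esum => x _; rewrite opprK. Qed.

Lemma eq_rsum a b : (forall x, a x = b x) -> rsum a = rsum b.
Proof. by move=> h; congr rsum; apply/funext. Qed.

Lemma rsum_ge0E a : (forall x, 0 <= a x) -> rsum a = fine (\esum_(x in [set: X]) (a x)%:E).
Proof.
move=> a0; rewrite /rsum [X in _ - fine X]esum1; last by move=> x _; rewrite max_r // oppr_le0.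
by rewrite subr0; congr fine; apply: eq_esum => x _; rewrite max_l.
Qed.

Lemma esumZ k a : 0 <= k -> rsummable a -> (forall x, 0 <= a x) ->
  fine (\esum_(x in [set: X]) (k * a x)%:E) = k * fine (\esum_(x in [set: X]) (a x)%:E).
Proof.
move=> k0 ha a0.
have le1 c b : 0 <= c -> rsummable b -> (forall x, 0 <= b x) ->
    fine (\esum_(x in [set: X]) (c * b x)%:E) <= c * fine (\esum_(x in [set: X]) (b x)%:E).
  move=> c0 hb b0; rewrite -lee_fin esum_fin; last 2 first.
  - exact: rsummableZ.
  - by move=> x; rewrite mulr_ge0.
  by apply: esum_leF => F; rewrite -mulr_sumr lee_fin ler_wpM2l // -lee_fin esum_fin // esum_geF.
have [->|kn0] := eqVneq k 0.
  by rewrite mul0r esum1 // => x _; rewrite mul0r.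
apply/eqP; rewrite eq_le le1 //= -ler_pdivlMl ?lt_def ?kn0 //.
apply: le_trans (le1 k^-1 (fun x => k * a x) _ _ _); rewrite ?invr_ge0 //.
- by apply: eq_leW; congr fine; apply: eq_esum => x _; rewrite mulKf.
- exact: rsummableZ.
- by move=> x; rewrite mulr_ge0.
Qed.

Lemma rsumZ k a : rsummable a -> rsum (fun x => k * a x) = k * rsum a.
Proof.
move=> ha; wlog k0 : k / 0 <= k => [hw|].
  have [/hw //|k0] := leP 0 k.
  have := hw (- k) (ltW _); rewrite oppr_gt0 => /(_ k0) h.
  apply: oppr_inj; rewrite -rsumN -mulNr -h; apply: eq_rsum => x; by rewrite mulNr.
rewrite (@rsum_diff _ (fun x => k * pos a x) (fun x => k * neg a x)).
- rewrite (esumZ k0 (rsummable_pos ha) (pos_ge0 a)) (esumZ k0 (rsummable_neg ha) (neg_ge0 a)).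
  by rewrite -mulrBr.
- exact/rsummableZ/rsummable_pos.
- exact/rsummableZ/rsummable_neg.
- by move=> x; rewrite mulr_ge0 ?pos_ge0.
- by move=> x; rewrite mulr_ge0 ?neg_ge0.
- by move=> x; rewrite -mulrBr -posneg.
Qed.

Lemma esum_point (y : X) (k : R) : 0 <= k ->
  (\esum_(x in [set: X]) (k *+ (x == y))%:E = k%:E)%E.
Proof.
move=> k0; rewrite (_ : [set: X] = [set y] `|` ~` [set y]); last by rewrite setUv.
rewrite (esumID [set y]); last by move=> x _; rewrite lee_fin mulrn_wge0.
rewrite setUK esum_set1 ?lee_fin ?eqxx // esum1 ?adde0 // => x [_].
by move=> /= /eqP/negPf ->.
Qed.

Lemma rsum_point (y : X) (k : R) : rsum (fun x => k *+ (x == y)) = k.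
Proof.
rewrite (@rsum_diff _ (fun x => (Num.max k 0) *+ (x == y)) (fun x => (Num.max (- k) 0) *+ (x == y))).
- rewrite !esum_point ?le_max ?lexx ?orbT //=.
  by case: (leP k 0) => h; [rewrite max_l|rewrite max_r]; lra.
- by rewrite /rsummable; under eq_esum do rewrite ger0_norm ?mulrn_wge0 ?le_max ?lexx ?orbT //; rewrite esum_point ?ltry ?le_max ?lexx ?orbT.
- by rewrite /rsummable; under eq_esum do rewrite ger0_norm ?mulrn_wge0 ?le_max ?lexx ?orbT //; rewrite esum_point ?ltry ?le_max ?lexx ?orbT.
- by move=> x; rewrite mulrn_wge0 ?le_max ?lexx ?orbT.
- by move=> x; rewrite mulrn_wge0 ?le_max ?lexx ?orbT.
- move=> x; rewrite -mulrnBl; congr (_ *+ _).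
  by case: (leP k 0) => h; [rewrite max_l|rewrite max_r]; lra.
Qed.

End RealSums.

(** * The Hilbert space l2(X) *)

Section L2.
Variables (R : realType) (X : choiceType).
Notation C := R[i].
Notation V := (l2 R X).
Implicit Types (u v w : V) (f g : X -> C).

Definition csummable f := rsummable (fun x => nc (f x)).

Lemma csummable_Re f : csummable f -> rsummable (fun x => complex.Re (f x)).
Proof. by apply: rsummable_le => x; exact: nc_Re. Qed.
Lemma csummable_Im f : csummable f -> rsummable (fun x => complex.Im (f x)).
Proof. by apply: rsummable_le => x; exact: nc_Im. Qed.

Lemma csumD f g : csummable f -> csummable g ->
  csum (fun x => f x + g x) = csum f + csum g.
Proof.
move=> hf hg; apply: complex_ext; rewrite ?cReD ?cImD /csum /=.
  rewrite -(rsumD (csummable_Re hf) (csummable_Re hg)); apply: eq_rsum => x; exact: cReD.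
rewrite -(rsumD (csummable_Im hf) (csummable_Im hg)); apply: eq_rsum => x; exact: cImD.
Qed.

Lemma csumZ (k : C) f : csummable f -> csum (fun x => k * f x) = k * csum f.
Proof.
move=> hf; have h1 := csummable_Re hf; have h2 := csummable_Im hf.
apply: complex_ext.
  rewrite cReM [complex.Re (csum _)]/= [complex.Re (csum f)]/= [complex.Im (csum f)]/=.
  rewrite -(rsumZ _ h1) -(rsumZ _ h2) -rsumN -rsumD; last by apply/rsummableN/rsummableZ.
    by apply: eq_rsum => x; exact: cReM.
  exact: rsummableZ.
rewrite cImM [complex.Im (csum _)]/= [complex.Re (csum f)]/= [complex.Im (csum f)]/=.
rewrite -(rsumZ _ h1) -(rsumZ _ h2) -rsumD; try exact: rsummableZ.
by apply: eq_rsum => x; exact: cImM.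
Qed.

Lemma csumJ f : csum (fun x => (f x)^*) = (csum f)^*.
Proof.
apply: complex_ext; rewrite cjE /csum /=; first by apply: eq_rsum => x; rewrite cjE; case: (f x).
by rewrite -rsumN; apply: eq_rsum => x; rewrite cjE; case: (f x).
Qed.

Lemma eq_csum f g : (forall x, f x = g x) -> csum f = csum g.
Proof. by move=> h; congr csum; apply/funext. Qed.

Lemma csum_point (y : X) (k : C) : csum (fun x => k *+ (x == y)) = k.
Proof.
apply: complex_ext; rewrite /csum /=.
  by rewrite -[RHS](rsum_point y); apply: eq_rsum => x; case: (x == y).
by rewrite -[RHS](rsum_point y); apply: eq_rsum => x; case: (x == y).
Qed.

Definition N2 u : R := fine (sqnorm u).

Lemma sqnorm_fin u : (N2 u)%:E = sqnorm u.
Proof.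
apply: fineK; rewrite ge0_fin_numE; last by apply: esum_ge0 => x _; rewrite lee_fin sqr_ge0.
by case: u => f /= /asboolP.
Qed.

Lemma N2_ge0 u : 0 <= N2 u.
Proof. by rewrite -lee_fin sqnorm_fin; apply: esum_ge0 => x _; rewrite lee_fin sqr_ge0. Qed.

Lemma N2_geF u (F : {fset X}) : \sum_(x <- F) nc (u x) ^+ 2 <= N2 u.
Proof. by rewrite -lee_fin sqnorm_fin; apply: (@esum_geF _ _ (fun x => nc (u x) ^+ 2)) => x; exact: sqr_ge0. Qed.

Lemma N2_leF u M : (forall F : {fset X}, \sum_(x <- F) nc (u x) ^+ 2 <= M) -> N2 u <= M.
Proof. by move=> h; rewrite -lee_fin sqnorm_fin; apply: (@esum_leF _ _ (fun x => nc (u x) ^+ 2)) => F; rewrite lee_fin. Qed.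

Lemma N2_ge1 u x : nc (u x) ^+ 2 <= N2 u.
Proof. by have := N2_geF u [fset x]%fset; rewrite big_seq_fset1. Qed.

Lemma mk_l2 f M : (forall F : {fset X}, \sum_(x <- F) nc (f x) ^+ 2 <= M) ->
  exists2 u : V, (forall x, u x = f x) & N2 u <= M.
Proof.
move=> h; have hf : (f : X -> R[i]^o) \in @sq_summable R X.
  apply/asboolP; apply: (@le_lt_trans _ _ M%:E); last exact: ltry.
  by apply: (@esum_leF _ _ (fun x => nc (f x) ^+ 2)) => F; rewrite lee_fin.
by exists (L2 hf) => //; apply: N2_leF.
Qed.

Lemma l2norm_sqr u : l2norm u ^+ 2 = N2 u.
Proof. by rewrite sqr_sqrtr // N2_ge0. Qed.

Lemma l2norm_ge0 u : 0 <= l2norm u. Proof. exact: sqrtr_ge0. Qed.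

Lemma l2_ext u v : (forall x, u x = v x) -> u = v.
Proof. by move=> h; apply: val_inj; apply/funext. Qed.

Lemma l2D u v x : (u + v) x = u x + v x. Proof. by []. Qed.
Lemma l2N u x : (- u) x = - u x. Proof. by []. Qed.
Lemma l2B u v x : (u - v) x = u x - v x. Proof. by []. Qed.
Lemma l2Z (k : C) u x : (k *: u) x = k * u x. Proof. by []. Qed.
Lemma l2_sum (I : Type) (r : seq I) (P : pred I) (F : I -> V) x :
  (\sum_(i <- r | P i) F i) x = \sum_(i <- r | P i) F i x.
Proof. by elim/big_rec2: _ => // i y z _ <-. Qed.

Lemma N2_eq0 u : N2 u = 0 -> u = 0.
Proof.
move=> h; apply: l2_ext => x; have := N2_ge1 u x; rewrite h => h1.
by apply/eqP; rewrite -nc_eq0 -sqrf_eq0 eq_le h1 sqr_ge0.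
Qed.

Lemma nc_sqr_summable u : rsummable (fun x => nc (u x) ^+ 2).
Proof.
rewrite /rsummable; under eq_esum do rewrite ger0_norm ?sqr_ge0 //.
by rewrite -/(sqnorm u) -sqnorm_fin ltry.
Qed.

Lemma inner_summable u v : csummable (fun x => u x * (v x)^*).
Proof.
apply: (rsummable_le (b := fun x => nc (u x) ^+ 2 + nc (v x) ^+ 2)); last exact: (rsummableD (nc_sqr_summable u) (nc_sqr_summable v)).
move=> x; rewrite ger0_norm ?nc_ge0 // Normc.normcM ncJ.
have := sqr_ge0 (nc (u x) - nc (v x)); have := nc_ge0 (u x); have := nc_ge0 (v x).
by nra.
Qed.

Lemma innerDl u v w : inner (u + v) w = inner u w + inner v w.
Proof.
rewrite /inner -(csumD (inner_summable u w) (inner_summable v w)).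
by apply: eq_csum => x; rewrite -mulrDl.
Qed.

Lemma innerZl (k : C) u w : inner (k *: u) w = k * inner u w.
Proof.
rewrite /inner -(csumZ _ (inner_summable u w)).
by apply: eq_csum => x; rewrite mulrA.
Qed.

Lemma innerC u v : inner v u = (inner u v)^*.
Proof. rewrite /inner -csumJ; apply: eq_csum => x; by rewrite cJM conjCK mulrC. Qed.

Lemma innerDr u v w : inner u (v + w) = inner u v + inner u w.
Proof. by rewrite innerC innerDl cJD -!innerC. Qed.
Lemma innerZr (k : C) u w : inner u (k *: w) = k^* * inner u w.
Proof. by rewrite innerC innerZl cJM -innerC. Qed.
Lemma innerNl u w : inner (- u) w = - inner u w.
Proof. by rewrite -scaleN1r innerZl mulN1r. Qed.
Lemma innerNr u w : inner u (- w) = - inner u w.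
Proof. by rewrite innerC innerNl cJN -innerC. Qed.
Lemma innerBl u v w : inner (u - v) w = inner u w - inner v w.
Proof. by rewrite innerDl innerNl. Qed.
Lemma innerBr u v w : inner u (v - w) = inner u v - inner u w.
Proof. by rewrite innerDr innerNr. Qed.
Lemma inner0l w : inner 0 w = 0.
Proof. by rewrite -(scale0r w) innerZl mul0r. Qed.
Lemma inner0r w : inner w 0 = 0.
Proof. by rewrite innerC inner0l conjC0. Qed.
Lemma inner_suml (I : Type) (r : seq I) (P : pred I) (F : I -> V) w :
  inner (\sum_(i <- r | P i) F i) w = \sum_(i <- r | P i) inner (F i) w.
Proof. by elim/big_rec2: _ => [|i y z _ <-]; rewrite ?inner0l ?innerDl. Qed.
Lemma inner_sumr (I : Type) (r : seq I) (P : pred I) (F : I -> V) w :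
  inner w (\sum_(i <- r | P i) F i) = \sum_(i <- r | P i) inner w (F i).
Proof. by elim/big_rec2: _ => [|i y z _ <-]; rewrite ?inner0r ?innerDr. Qed.

Lemma inner_self u : inner u u = (N2 u)%:C.
Proof.
apply: complex_ext; rewrite /inner /csum /=.
  rewrite /N2 /sqnorm -rsum_ge0E => [|x]; last exact: sqr_ge0.
  by apply: eq_rsum => x; rewrite mulcJ.
rewrite (eq_rsum (b := fun x => 0)) => [|x]; last by rewrite mulcJ.
by rewrite rsum_ge0E // esum1.
Qed.

Lemma inner_delta u x : inner u (delta R x) = u x.
Proof.
rewrite /inner -[RHS](csum_point x); apply: eq_csum => y /=.
by case: eqP => [->|_]; rewrite ?conjC1 ?conjC0 ?mulr1 ?mulr0.
Qed.

Lemma delta_inner u x : inner (delta R x) u = (u x)^*.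
Proof. by rewrite innerC inner_delta. Qed.

Lemma N2_delta x : N2 (delta R x) = 1.
Proof.
apply: (@complexI R); rewrite -inner_self inner_delta /=; by rewrite eqxx.
Qed.

Lemma N2D u v : N2 (u + v) = N2 u + N2 v + 2 * complex.Re (inner u v).
Proof.
have := inner_self (u + v); rewrite innerDl !innerDr !inner_self (innerC u v).
by move/(congr1 (@complex.Re R)); rewrite !cReD /=; case: (inner u v) => a b /= <-; ring.
Qed.

Lemma N2Z (k : C) u : N2 (k *: u) = nc k ^+ 2 * N2 u.
Proof.
have := inner_self (k *: u); rewrite innerZl innerZr inner_self mulrA mulcJ.
by rewrite -rmorphM => /(@complexI R) ->.
Qed.

Lemma N2N u : N2 (- u) = N2 u.
Proof. by rewrite -scaleN1r N2Z normcN Normc.normc1 expr1n mul1r. Qed.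

Lemma N2B u v : N2 (u - v) = N2 u + N2 v - 2 * complex.Re (inner u v).
Proof. by rewrite N2D N2N innerNr cReN mulrN. Qed.

Lemma N20 : N2 0 = 0.
Proof. by apply: (@complexI R); rewrite -inner_self inner0l. Qed.

Lemma cauchy_schwarz u v : nc (inner u v) ^+ 2 <= N2 u * N2 v.
Proof.
have [v0|vn0] := eqVneq (N2 v) 0.
  by rewrite (N2_eq0 v0) inner0r Normc.normc0 expr0n N20 mulr0.
have v0 : 0 < N2 v by rewrite lt_def vn0 N2_ge0.
set c := inner u v.
set k := (N2 v)^-1.
have e1 : inner u ((k%:C * c) *: v) = (k * nc c ^+ 2)%:C.
  by rewrite innerZr cJM cjR -mulrA (mulrC c^*) mulcJ -rmorphM.
have e2 : nc (k%:C * c) = k * nc c.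
  by rewrite Normc.normcM nc_real gtr0_norm ?invr_gt0.
have := N2_ge0 (u - (k%:C * c) *: v); rewrite N2B N2Z e1 e2.
have -> : N2 u + (k * nc c) ^+ 2 * N2 v - 2 * complex.Re (k * nc c ^+ 2)%:C =
    N2 u - nc c ^+ 2 / N2 v.
  rewrite (_ : complex.Re _ = k * nc c ^+ 2) // /k; move: (nc c) => t; by field.
by rewrite subr_ge0 ler_pdivrMr.
Qed.

Lemma cauchy_schwarz_norm u v : nc (inner u v) <= l2norm u * l2norm v.
Proof.
rewrite -ler_sqr ?nnegrE ?nc_ge0 ?mulr_ge0 ?l2norm_ge0 //.
by rewrite exprMn !l2norm_sqr cauchy_schwarz.
Qed.

Lemma l2normD u v : l2norm (u + v) <= l2norm u + l2norm v.
Proof.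
have h : complex.Re (inner u v) <= l2norm u * l2norm v.
  by apply: le_trans (cauchy_schwarz_norm u v); exact: Re_le_nc.
rewrite -ler_sqr ?nnegrE ?addr_ge0 ?l2norm_ge0 // sqrrD !l2norm_sqr N2D -mulr_natl.
by move: h; move: (l2norm u * l2norm v) => t; lra.
Qed.

Lemma l2normZ (k : C) u : l2norm (k *: u) = nc k * l2norm u.
Proof.
apply/eqP; rewrite -(@eqrXn2 _ 2) ?mulr_ge0 ?l2norm_ge0 ?nc_ge0 //.
by rewrite exprMn !l2norm_sqr N2Z.
Qed.

Definition fvec (F : {fset X}) f : V := \sum_(x <- F) f x *: delta R x.

Lemma fvecE F f x : fvec F f x = f x *+ (x \in F).
Proof.
rewrite /fvec l2_sum; under eq_bigr do rewrite l2Z.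
have [xF|xF] := boolP (x \in F).
  rewrite (bigD1_seq x) ?fset_uniq //= eqxx mulr1 big1 ?addr0 // => y /negPf yx.
  by rewrite eq_sym yx mulr0.
rewrite big_seq big1 // => y yF /=; case: eqP => [xy|_]; last by rewrite mulr0.
by rewrite xy yF in xF.
Qed.

Lemma inner_fvec F f v : inner (fvec F f) v = \sum_(x <- F) f x * (v x)^*.
Proof. by rewrite inner_suml; apply: eq_bigr => x _; rewrite innerZl delta_inner. Qed.

Lemma N2_fvec F f : N2 (fvec F f) = \sum_(x <- F) nc (f x) ^+ 2.
Proof.
apply: (@complexI R); rewrite -inner_self inner_fvec rC_sum.
by apply: eq_big_seq => x xF; rewrite fvecE xF; exact: mulcJ.
Qed.

Lemma N2_fvec_rest F u : N2 (u - fvec F u) = N2 u - \sum_(x <- F) nc (u x) ^+ 2.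
Proof.
rewrite N2B N2_fvec innerC inner_fvec.
have -> : \sum_(x <- F) u x * (u x)^* = (\sum_(x <- F) nc (u x) ^+ 2)%:C.
  by rewrite rmorph_sum; apply: eq_bigr => x _; exact: mulcJ.
by rewrite cjR /=; ring.
Qed.

(** Allowing every larger [G] lets the finite set be replaced later by an initial segment of the
    naturals. *)
Lemma fvec_approx u (e : R) : 0 < e ->
  exists F : {fset X}, forall G : {fset X}, (F `<=` G)%fset -> N2 (u - fvec G u) <= e.
Proof.
move=> e0; have hu := sqnorm_fin u.
have fu : sqnorm u \is a fin_num by rewrite -hu.
have [_ [A [finA _] <-]] := ub_ereal_sup_adherent e0 fu.
rewrite -/(esum _ _) -/(sqnorm u) -hu -EFinB fsbig_finite //= sumEFin lte_fin => h.
exists (fset_set A) => G AG; rewrite N2_fvec_rest lerBlDr -lerBlDl.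
apply: le_trans (ltW h) _.
rewrite (big_fsetID _ (mem (fset_set A)) G) /= (_ : [fset x in G | x \in fset_set A]%fset = fset_set A).
  by rewrite lerDl sumr_ge0 // => x _; exact: sqr_ge0.
apply/fsetP => x; rewrite !inE /=; apply/andP/idP => [[]//|xA]; split => //; exact: (fsubsetP AG).
Qed.

End L2.

(** * Bounded linear maps and completeness *)

Section RawOps.
Variables (R : realType) (X : choiceType).
Notation C := R[i].
Notation V := (l2 R X).
Implicit Types (u v w : V) (f g : V -> V).

(** Square roots, resolvents and adjoints arise as pointwise limits or by choice, hence as plain
    maps; [mk_op] packs them into operators once linearity and a bound are known. *)
Definition is_linear f := forall (a : C) u v, f (a *: u + v) = a *: f u + f v.
Definition bounded_by f (K : R) := forall u, l2norm (f u) <= K * l2norm u.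
Definition selfadj f := forall u v, inner (f u) v = inner u (f v).
Definition psd f := forall u, 0 <= complex.Re (inner (f u) u).

Lemma linD f : is_linear f -> forall u v, f (u + v) = f u + f v.
Proof. by move=> hf u v; have := hf 1 u v; rewrite !scale1r. Qed.
Lemma lin0 f : is_linear f -> f 0 = 0.
Proof. by move=> hf; have := hf 1 0 0; rewrite !scale1r addr0 => /(congr1 (fun z => z - f 0)); rewrite subrr addrK => <-. Qed.
Lemma linZ f : is_linear f -> forall (a : C) u, f (a *: u) = a *: f u.
Proof. by move=> hf a u; have := hf a u 0; rewrite !addr0 lin0 // addr0. Qed.
Lemma linN f : is_linear f -> forall u, f (- u) = - f u.
Proof. by move=> hf u; rewrite -scaleN1r linZ // scaleN1r. Qed.
Lemma linB f : is_linear f -> forall u v, f (u - v) = f u - f v.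
Proof. by move=> hf u v; rewrite linD // linN. Qed.
Lemma lin_sum f (I : Type) (r : seq I) (P : pred I) (F : I -> V) : is_linear f ->
  f (\sum_(i <- r | P i) F i) = \sum_(i <- r | P i) f (F i).
Proof. by move=> hf; elim/big_rec2: _ => [|i y z _ <-]; rewrite ?lin0 ?linD. Qed.

Lemma lin_op (T : bounded_operator R X) : is_linear T.
Proof. by move=> a u v; rewrite linearP. Qed.

Lemma mk_op f K : is_linear f -> bounded_by f K -> exists T : bounded_operator R X, forall u, T u = f u.
Proof.
move=> hf hK.
pose L := GRing.isLinear.Build C V V *:%R f hf.
pose F : {linear V -> V} := HB.pack f L.
have hb : exists K : R, forall u, l2norm (F u) <= K * l2norm u by exists K.
by exists (BoundedOperator hb).
Qed.

Lemma sqr_leP (a b : R) : 0 <= a -> 0 <= b -> (a <= b) = (a ^+ 2 <= b ^+ 2).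
Proof. by move=> a0 b0; rewrite ler_sqr ?nnegrE. Qed.

Lemma bounded_byP f K : 0 <= K -> bounded_by f K <-> forall u, N2 (f u) <= K ^+ 2 * N2 u.
Proof.
move=> K0; split => h u; have := h u; rewrite -!l2norm_sqr -exprMn -sqr_leP ?mulr_ge0 ?l2norm_ge0 //.
Qed.

Lemma l2norm0 : l2norm (0 : V) = 0.
Proof. by apply/eqP; rewrite -sqrf_eq0 l2norm_sqr N20. Qed.

Lemma l2norm_eq0 u : l2norm u = 0 -> u = 0.
Proof. by move=> h; apply: N2_eq0; rewrite -l2norm_sqr h expr0n. Qed.

Lemma l2normN u : l2norm (- u) = l2norm u.
Proof. by rewrite -scaleN1r l2normZ normcN Normc.normc1 mul1r. Qed.

Lemma l2normB u v : l2norm (u - v) <= l2norm u + l2norm v.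
Proof. by rewrite -(l2normN v) l2normD. Qed.

Lemma l2norm_coord u x : nc (u x) <= l2norm u.
Proof. by rewrite sqr_leP ?nc_ge0 ?l2norm_ge0 // l2norm_sqr N2_ge1. Qed.

Lemma sup_ge (E : set R) x : has_sup E -> E x -> x <= sup E.
Proof. by move=> hE; apply: (sup_upper_bound hE). Qed.

Lemma opnorm_has (T : bounded_operator R X) :
  has_sup [set l2norm (T u) | u in [set u | l2norm u <= 1]].
Proof.
split; first by exists (l2norm (T 0)); exists 0 => //=; rewrite l2norm0 ler01.
have [K hK] := op_bounded T.
exists (Num.max K 0) => _ [u /= hu <-]; apply: le_trans (hK u) _.
apply: (@le_trans _ _ (Num.max K 0 * l2norm u)).
  by rewrite ler_wpM2r ?l2norm_ge0 // le_max lexx.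
by rewrite ler_piMr // le_max lexx orbT.
Qed.

Lemma opnorm_ge0 (T : bounded_operator R X) : 0 <= opnorm T.
Proof.
apply: (le_trans (l2norm_ge0 (T 0))); apply: (sup_ge (opnorm_has T)).
by exists 0 => //=; rewrite l2norm0 ler01.
Qed.

Lemma opnormP (T : bounded_operator R X) : bounded_by T (opnorm T).
Proof.
move=> u; have [u0|un0] := eqVneq (l2norm u) 0.
  by rewrite (l2norm_eq0 u0) linear0 l2norm0 mulr0.
have u0 : 0 < l2norm u by rewrite lt_def un0 l2norm_ge0.
rewrite -ler_pdivrMr //.
apply: (sup_ge (opnorm_has T)).
exists ((l2norm u)^-1%:C *: u) => /=.
  by rewrite l2normZ nc_real gtr0_norm ?invr_gt0 // mulVf.
by rewrite linearZ l2normZ nc_real gtr0_norm ?invr_gt0 // mulrC.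
Qed.

Lemma opnorm_le (T : bounded_operator R X) K : 0 <= K -> bounded_by T K -> opnorm T <= K.
Proof.
move=> K0 hK; apply: ge_sup; first by case: (opnorm_has T).
by move=> _ [u /= hu <-]; apply: le_trans (hK u) _; rewrite ler_piMr.
Qed.

(** Since [c * y] dominates the increments of [a], the sequence [a n + c * y n] is nondecreasing and
    bounded, so the limit is a difference of two suprema and comes with an explicit rate. *)
Lemma mono_limit (a y : nat -> R) (c B : R) : 0 <= c ->
  (forall n, y n <= y n.+1) -> (forall n, y n <= B) ->
  (forall n, `|a n.+1 - a n| <= c * (y n.+1 - y n)) ->
  exists l, forall n, `|l - a n| <= c * (sup (range y) - y n).
Proof.
move=> c0 ymon yB ha.
have hsy : has_sup (range y).
  by split; [exists (y 0%N); exists 0%N|exists B => _ [n _ <-]].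
have yle n : y n <= sup (range y) by apply: (sup_ge hsy); exists n.
have ymono n m : (n <= m)%N -> y n <= y m.
  by move=> /subnK <-; elim: (m - n)%N => // k ih; apply: le_trans ih _; rewrite addSn.
have dist n m : (n <= m)%N -> `|a m - a n| <= c * (y m - y n).
  move=> /subnK <-; elim: (m - n)%N => [|k ih]; first by rewrite add0n !subrr normr0 mulr0.
  rewrite addSn (_ : a _ - a n = (a (k + n).+1 - a (k + n)%N) + (a (k + n)%N - a n)); last by ring.
  apply: le_trans (ler_normD _ _) _; apply: le_trans (lerD (ha _) ih) _.
  by rewrite -mulrDr; apply: eq_leW; ring.
pose b n := a n + c * y n.
have bmono n m : (n <= m)%N -> b n <= b m.
  move=> nm; have := dist _ _ nm; rewrite ler_norml /b => /andP[h1 _]; by move: h1; rewrite mulrBr; lra.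
have bup n m : (n <= m)%N -> b m <= b n + 2 * c * (sup (range y) - y n).
  move=> nm; have := dist _ _ nm; rewrite ler_norml /b => /andP[_ h1].
  have h2 : c * y m <= c * sup (range y) by rewrite ler_wpM2l.
  by move: h1; rewrite mulrBr; lra.
have hsb : has_sup (range b).
  split; first by exists (b 0%N); exists 0%N.
  by exists (b 0%N + 2 * c * (sup (range y) - y 0%N)) => _ [n _ <-]; exact: bup.
exists (sup (range b) - c * sup (range y)) => n.
have h1 : b n <= sup (range b) by apply: (sup_ge hsb); exists n.
have h2 : sup (range b) <= b n + 2 * c * (sup (range y) - y n).
  apply: ge_sup; first by case: hsb.
  move=> _ [m _ <-]; have [nm|mn] := leqP n m; first exact: bup.
  apply: le_trans (bmono _ _ (ltnW mn)) _; rewrite lerDl !mulr_ge0 // subr_ge0 //.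
by rewrite ler_norml; move: h1 h2; rewrite /b; move: (sup _) (sup _) => s t h1 h2; apply/andP; split; lra.
Qed.

Lemma sup_adh (y : nat -> R) (B e : R) : (forall n, y n <= y n.+1) -> (forall n, y n <= B) ->
  0 < e -> exists n, forall m, (n <= m)%N -> 0 <= sup (range y) - y m <= e.
Proof.
move=> ymon yB e0.
have hsy : has_sup (range y).
  by split; [exists (y 0%N); exists 0%N|exists B => _ [n _ <-]].
have yle n : y n <= sup (range y) by apply: (sup_ge hsy); exists n.
have ymono n m : (n <= m)%N -> y n <= y m.
  by move=> /subnK <-; elim: (m - n)%N => // k ih; apply: le_trans ih _; rewrite addSn.
have [_ [n _ <-] hn] := sup_adherent e0 hsy.
by exists n => m nm; have := ymono _ _ nm; have := yle m; lra.
Qed.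

(** The limit is taken coordinatewise, and the error is controlled on each finite set of coordinates
    before passing to the norm. The square of the factor 2 in the conclusion absorbs the 2 of
    [nc_sqrD]. *)
Lemma l2_complete (u_ : nat -> V) (y : nat -> R) (c B : R) : 0 <= c ->
  (forall n, y n <= y n.+1) -> (forall n, y n <= B) ->
  (forall n, l2norm (u_ n.+1 - u_ n) <= c * (y n.+1 - y n)) ->
  exists u, forall n, l2norm (u - u_ n) <= 2 * (c * (sup (range y) - y n)).
Proof.
move=> c0 ymon yB hu.
have crd x n : nc (u_ n.+1 x - u_ n x) <= c * (y n.+1 - y n).
  by apply: le_trans (hu n); rewrite -l2B l2norm_coord.
have hr x : exists l, forall n, `|l - complex.Re (u_ n x)| <= c * (sup (range y) - y n).
  apply: (mono_limit c0 ymon yB) => n; apply: le_trans (crd x n).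
  by rewrite -cReN -cReD nc_Re.
have hi x : exists l, forall n, `|l - complex.Im (u_ n x)| <= c * (sup (range y) - y n).
  apply: (mono_limit c0 ymon yB) => n; apply: le_trans (crd x n).
  by rewrite -cImN -cImD nc_Im.
have [lr hlr] := choice hr; have [li hli] := choice hi.
pose l x : C := lr x +i* li x.
set Y := sup (range y) in hlr hli *.
have hl x n : nc (l x - u_ n x) <= 2 * (c * (Y - y n)).
  apply: le_trans (nc_leReIm _) _; rewrite cReD cImD cReN cImN /=.
  by have := hlr x n; have := hli x n; lra.
have hYy n : 0 <= Y - y n.
  rewrite subr_ge0; apply: (sup_ge _); last by exists n.
  by split; [exists (y 0%N); exists 0%N|exists B => _ [k _ <-]].
have dist n m : (n <= m)%N -> l2norm (u_ m - u_ n) <= c * (y m - y n).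
  move=> /subnK <-; elim: (m - n)%N => [|k ih]; first by rewrite add0n !subrr l2norm0 mulr0.
  rewrite addSn (_ : u_ _ - u_ n = (u_ (k + n).+1 - u_ (k + n)%N) + (u_ (k + n)%N - u_ n)); last by rewrite addrA subrK.
  apply: le_trans (l2normD _ _) _; apply: le_trans (lerD (hu _) ih) _.
  by rewrite -mulrDr; apply: eq_leW; ring.
have key n (F : {fset X}) : \sum_(x <- F) nc (l x - u_ n x) ^+ 2 <= 2 * (c * (Y - y n)) ^+ 2.
  apply/ler_addgt0Pr => e e0.
  pose s : R := \sum_(x <- F) 1.
  have s0 : 0 <= s by rewrite sumr_ge0.
  (* Here s is the cardinality of [F], and 8 is the 2 of [nc_sqrD] times the square of the 2 in
     [hl]. The index m may depend on [F], because the distance from [u_ n] to [u_ m] is bounded in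
     norm, uniformly in [F]. *)
  pose k := 8 * c ^+ 2 * s.
  have k0 : 0 <= k by rewrite !mulr_ge0 ?sqr_ge0.
  have e1 : 0 < Num.min 1 (e / (k + 1)) by rewrite lt_min ltr01 divr_gt0 //; lra.
  have [n0 hn0] := sup_adh ymon yB e1.
  pose m := maxn n n0; have nm : (n <= m)%N by rewrite leq_maxl.
  have := hn0 m (leq_maxr _ _); rewrite -/Y le_min => /andP[t0 /andP[t1 t2]].
  set t := Y - y m in t0 t1 t2.
  have h1 : \sum_(x <- F) nc (u_ m x - u_ n x) ^+ 2 <= (c * (Y - y n)) ^+ 2.
    apply: le_trans (N2_geF (u_ m - u_ n) F) _; rewrite -l2norm_sqr -sqr_leP ?l2norm_ge0 ?mulr_ge0 //.
    by apply: le_trans (dist _ _ nm) _; rewrite ler_wpM2l // lerD2r -subr_ge0; have := hYy m.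
  have h2 : \sum_(x <- F) nc (l x - u_ m x) ^+ 2 <= (2 * (c * t)) ^+ 2 * s.
    rewrite mulr_sumr; apply: ler_sum => x _; rewrite mulr1 -sqr_leP ?nc_ge0 ?mulr_ge0 //; exact: hl.
  have h3 : k * t <= e.
    have : t * (k + 1) <= e by rewrite -ler_pdivlMr //; lra.
    by move=> ?; nra.
  have h4 : k * t ^+ 2 <= e.
    by apply: le_trans h3; rewrite ler_wpM2l // expr2 ler_piMl.
  apply: (@le_trans _ _ (2 * (\sum_(x <- F) nc (u_ m x - u_ n x) ^+ 2) + 2 * (\sum_(x <- F) nc (l x - u_ m x) ^+ 2))).
    rewrite !mulr_sumr -big_split; apply: ler_sum => x _ /=.
    rewrite (_ : l x - u_ n x = (u_ m x - u_ n x) + (l x - u_ m x)); last by ring.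
    exact: nc_sqrD.
  apply: (@le_trans _ _ (2 * (c * (Y - y n)) ^+ 2 + 2 * ((2 * (c * t)) ^+ 2 * s))).
    by apply: lerD; rewrite ler_wpM2l.
  rewrite lerD2l; apply: le_trans h4; apply: eq_leW; rewrite /k; ring.
have [u hu0 _] : exists2 u : V, (forall x, u x = l x) & N2 u <= 2 * (2 * (c * (Y - y 0%N)) ^+ 2) + 2 * N2 (u_ 0%N).
  apply: mk_l2 => F.
  apply: (@le_trans _ _ (2 * (\sum_(x <- F) nc (l x - u_ 0%N x) ^+ 2) + 2 * (\sum_(x <- F) nc (u_ 0%N x) ^+ 2))).
    rewrite !mulr_sumr -big_split; apply: ler_sum => x _ /=.
    by have := nc_sqrD (l x - u_ 0%N x) (u_ 0%N x); rewrite subrK.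
  by apply: lerD; rewrite ler_wpM2l ?N2_geF.
exists u => n; rewrite sqr_leP ?l2norm_ge0 ?mulr_ge0 // l2norm_sqr exprMn.
apply: (@le_trans _ _ (2 * (c * (Y - y n)) ^+ 2)).
  by apply: N2_leF => F; apply: le_trans (key n F); under eq_bigr do rewrite l2B hu0.
by rewrite ler_wpM2r ?sqr_ge0 // expr2; lra.
Qed.

End RawOps.

(** * Bilinear forms and operators *)

Section OpTheory.
Variables (R : realType) (X : choiceType).
Notation C := R[i].
Notation V := (l2 R X).
Implicit Types (u v w : V) (f g : V -> V).

Lemma l2norm_small u (M : R) : (forall e : R, 0 < e -> l2norm u <= e * M) -> u = 0.
Proof.
move=> h; apply: l2norm_eq0; apply/eqP; rewrite eq_le l2norm_ge0 andbT.
apply/ler_addgt0Pr => e e0; rewrite add0r.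
have M0 : 0 <= M by have := h 1 ltr01; have := l2norm_ge0 u; lra.
have e1 : 0 < e / (M + 1) by rewrite divr_gt0 //; lra.
apply: le_trans (h _ e1) _; rewrite mulrAC ler_pdivrMr; last lra.
by rewrite mulrDr mulr1 lerDl ltW.
Qed.

Lemma op_limit (Y : nat -> V -> V) (y : nat -> R) (B : R) :
  (forall n, is_linear (Y n)) -> (forall n, y n <= y n.+1) -> (forall n, y n <= B) ->
  (forall n, bounded_by (fun u => Y n.+1 u - Y n u) (y n.+1 - y n)) ->
  exists2 L, is_linear L & forall e : R, 0 < e -> exists n, forall m, (n <= m)%N ->
    bounded_by (fun u => L u - Y m u) e.
Proof.
move=> Ylin ymon yB Yb.
have hex u : exists w, forall n, l2norm (w - Y n u) <= 2 * (l2norm u * (sup (range y) - y n)).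
  apply: (l2_complete (u_ := fun n => Y n u) (l2norm_ge0 u) ymon yB) => n.
  by rewrite mulrC; exact: Yb.
have [L hL] := choice hex.
have lim (e : R) : 0 < e -> exists n, forall m, (n <= m)%N -> bounded_by (fun u => L u - Y m u) e.
  move=> e0; have e2 : 0 < e / 2 by rewrite divr_gt0.
  have [n hn] := sup_adh ymon yB e2; exists n => m nm u.
  apply: le_trans (hL u m) _.
  have /andP[h1 h2] := hn m nm; have := ler_wpM2l (l2norm_ge0 u) h2; lra.
exists L => // a u v.
apply/eqP; rewrite -subr_eq0; apply/eqP.
apply: (@l2norm_small _ (l2norm (a *: u + v) + nc a * l2norm u + l2norm v)) => e e0.
have [n /(_ n (leqnn n)) hn] := lim e e0.
rewrite (_ : _ - _ = (L (a *: u + v) - Y n (a *: u + v)) - (a *: (L u - Y n u) + (L v - Y n v))); last first.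
  rewrite Ylin scalerBr; set A := L _; set B1 := a *: L u; set B2 := a *: Y n u.
  apply: l2_ext => x; rewrite !(l2B, l2D, l2N); ring.
apply: le_trans (l2normB _ _) _; apply: le_trans (lerD (hn _) (l2normD _ _)) _.
rewrite l2normZ !mulrDr -addrA; apply: lerD => //; apply: lerD; last exact: hn.
by rewrite mulrCA ler_wpM2l ?nc_ge0 //; exact: hn.
Qed.

(** Finitely supported vectors are dense. In the applications [D] is the difference of two
    functionals that have to be shown equal. *)
Lemma inner_dense_eq0 (D : V -> C) (M : R) :
  (forall u v, D (u + v) = D u + D v) -> (forall (a : C) u, D (a *: u) = a * D u) ->
  (forall u, nc (D u) ^+ 2 <= M * N2 u) -> (forall x, D (delta R x) = 0) ->
  forall u, D u = 0.
Proof.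
move=> DD DZ DM D0 u; apply/eqP; rewrite -nc_eq0 -sqrf_eq0 eq_le sqr_ge0 andbT.
apply/ler_addgt0Pr => e e0; rewrite add0r.
have e1 : 0 < e / (`|M| + 1) by rewrite divr_gt0 // ltr_wpDl.
have [F /(_ F (fsubset_refl _)) hF] := fvec_approx u e1.
have Dt : D (fvec F u) = 0.
  rewrite /fvec; elim/big_rec: _ => [|x w _ IH]; first by rewrite -(scale0r u) DZ mul0r.
  by rewrite DD DZ D0 IH mulr0 addr0.
have -> : D u = D (u - fvec F u).
  by rewrite DD -scaleN1r DZ Dt mulr0 addr0.
apply: le_trans (DM _) _.
apply: (@le_trans _ _ ((`|M| + 1) * N2 (u - fvec F u))).
  rewrite ler_wpM2r ?N2_ge0 //; have := ler_norm M; lra.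
by rewrite mulrC -ler_pdivlMr // ltr_wpDl.
Qed.

(** The coordinates of [g v] are forced by the values at [delta]. Pairing v with the image of their
    truncation w gives s^2 <= |v|^2 K^2 s for the truncated squared norm s, hence square-summability
    and the bound at once. *)
Lemma adjoint_ex f K : 0 <= K -> is_linear f -> bounded_by f K ->
  exists g, [/\ is_linear g, bounded_by g K & forall u v, inner (f u) v = inner u (g v)].
Proof.
move=> K0 fl fb; have fN := proj1 (bounded_byP f K0) fb.
have ex v : exists w, (forall x, w x = inner v (f (delta R x))) /\ N2 w <= K ^+ 2 * N2 v.
  have [F|w h1 h2] := @mk_l2 R X (fun x => inner v (f (delta R x))) (K ^+ 2 * N2 v); last by exists w.
  set c := fun x => inner v (f (delta R x)).
  set s := \sum_(x <- F) nc (c x) ^+ 2.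
  pose w := fvec F c.
  have Nw : N2 w = s by rewrite N2_fvec.
  have h : inner v (f w) = s%:C.
    rewrite /w /fvec lin_sum // inner_sumr rC_sum; apply: eq_bigr => x _.
    by rewrite linZ // innerZr -/(c x) mulrC mulcJ.
  have s0 : 0 <= s by rewrite sumr_ge0 // => x _; exact: sqr_ge0.
  have := cauchy_schwarz v (f w); rewrite h nc_real ger0_norm // => h1.
  have h2 : s ^+ 2 <= N2 v * (K ^+ 2 * s).
    by apply: le_trans h1 _; rewrite ler_wpM2l ?N2_ge0 // -Nw.
  have [->|sn0] := eqVneq s 0; first by rewrite mulr_ge0 ?sqr_ge0 ?N2_ge0.
  have sp : 0 < s by rewrite lt_def sn0.
  rewrite -(ler_pM2r sp) -expr2; apply: le_trans h2 _.
  by apply: eq_leW; ring.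
have [g hg] := choice ex.
have gx v x : g v x = inner v (f (delta R x)) by case: (hg v).
have gN v : N2 (g v) <= K ^+ 2 * N2 v by case: (hg v).
exists g; split.
- by move=> a u v; apply: l2_ext => x; rewrite l2D l2Z !gx innerDl innerZl.
- exact/bounded_byP.
move=> u v; apply/eqP; rewrite -subr_eq0; apply/eqP; move: u.
apply: (@inner_dense_eq0 _ (4 * (K ^+ 2 * N2 v))) => [u w|a u|u|x].
- by rewrite linD // !innerDl; ring.
- by rewrite linZ // !innerZl; ring.
- apply: le_trans (nc_sqrD _ _) _; rewrite normcN.
  have h1 := cauchy_schwarz (f u) v; have h2 := cauchy_schwarz u (g v).
  have h3 := ler_wpM2r (N2_ge0 v) (fN u); have h4 := ler_wpM2l (N2_ge0 u) (gN v).
  by have := le_trans h1 h3; have := le_trans h2 h4; lra.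
- by rewrite delta_inner gx -innerC subrr.
Qed.

(* |<A f, g>| <= K |f| |g| in its arithmetic-geometric mean form, which is
   equivalent by homogeneity and involves no square root. *)
Definition form_bound (Y Z : choiceType) (A : Y -> Z -> C) (K : R) :=
  forall (F : {fset Y}) (G : {fset Z}) (f : Z -> C) (g : Y -> C),
  2 * nc (\sum_(x <- F) \sum_(y <- G) A x y * f y * g x) <=
  K * (\sum_(y <- G) nc (f y) ^+ 2 + \sum_(x <- F) nc (g x) ^+ 2).

(** Testing the form at s times the conjugate of the column sums and optimizing over s recovers the
    operator inequality from its arithmetic-geometric form; the best value is s = 1/K. *)
Lemma form_bound_col (Y Z : choiceType) (A : Y -> Z -> C) (K : R) : 0 <= K -> form_bound A K ->
  forall (F : {fset Y}) (G : {fset Z}) (g : Y -> C),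
  \sum_(y <- G) nc (\sum_(x <- F) A x y * g x) ^+ 2 <= K ^+ 2 * \sum_(x <- F) nc (g x) ^+ 2.
Proof.
move=> K0 hA F G g; set W := fun y => \sum_(x <- F) A x y * g x.
set S := \sum_(y <- G) _; set Gm := \sum_(x <- F) _.
have S0 : 0 <= S by rewrite sumr_ge0 // => x _; exact: sqr_ge0.
have key (s : R) : 0 < s -> 2 * (s * S) <= K * (s ^+ 2 * S + Gm).
  move=> s0; have := hA F G (fun y => s%:C * (W y)^*) g.
  rewrite exchange_big /=.
  under eq_bigr => y _ do under eq_bigr => x _ do rewrite mulrAC.
  under eq_bigr => y _ do rewrite -mulr_suml -/(W y) mulrCA mulcJ -rCM.
  rewrite -rC_sum nc_real -mulr_sumr -/S ger0_norm ?mulr_ge0 ?(ltW s0) //.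
  have -> // : \sum_(y <- G) nc (s%:C * (W y)^*) ^+ 2 = s ^+ 2 * S.
  rewrite mulr_sumr; apply: eq_bigr => y _.
  by rewrite Normc.normcM ncJ nc_real exprMn gtr0_norm.
have [K00|Kn] := eqVneq K 0.
  by have := key 1 ltr01; rewrite K00 !mul0r expr0n mul0r; lra.
have Kp : 0 < K by rewrite lt_def Kn.
have := key K^-1; rewrite invr_gt0 => /(_ Kp) h.
have := ler_wpM2r (ltW Kp) h.
rewrite (_ : 2 * (K^-1 * S) * K = 2 * S); last by field.
rewrite (_ : _ * _ * K = S + K ^+ 2 * Gm); last by field.
lra.
Qed.

(** Each row of [A] is square-summable by [form_bound_col] on a singleton, so the operator can be
    defined by inner products with the conjugated rows; its norm is tested against finite
    combinations of these. *)
Lemma op_of_form (A : X -> X -> C) K : 0 <= K -> form_bound A K ->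
  exists T : bounded_operator R X, has_matrix T A /\ bounded_by T K.
Proof.
move=> K0 hA; have colb := form_bound_col K0 hA.
have exr x : exists2 r : V, (forall y, r y = (A x y)^*) & N2 r <= K ^+ 2.
  apply: mk_l2 => G; have := colb [fset x]%fset G (fun=> 1).
  rewrite !big_seq_fset1 Normc.normc1 expr1n mulr1; apply: le_trans.
  apply: eq_leW; apply: eq_bigr => y _.
  by rewrite big_seq_fset1 mulr1 ncJ.
have exr' x : exists w : V, forall y, w y = (A x y)^* by case: (exr x) => w; exists w.
have [r hr] := choice exr'.
have ext u : exists w, (forall x, w x = inner u (r x)) /\ N2 w <= K ^+ 2 * N2 u.
  have [F|w h1 h2] := @mk_l2 R X (fun x => inner u (r x)) (K ^+ 2 * N2 u); last by exists w.
  set c := fun x => inner u (r x); set s := \sum_(x <- F) nc (c x) ^+ 2.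
  pose w := \sum_(x <- F) c x *: r x.
  have Nw : N2 w <= K ^+ 2 * s.
    apply: N2_leF => G; have := colb F G (fun x => (c x)^*).
    have -> : \sum_(x <- F) nc (c x)^* ^+ 2 = s by apply: eq_bigr => x _; rewrite ncJ.
    apply: le_trans; apply: eq_leW; apply: eq_bigr => y _.
    rewrite -ncJ /w l2_sum; congr (nc _ ^+ 2); rewrite (big_morph _ (@cJD R) (conjC0 _)).
    by apply: eq_bigr => x _; rewrite l2Z hr cJM conjCK mulrC.
  have h : inner u w = s%:C.
    rewrite /w inner_sumr rC_sum; apply: eq_bigr => x _.
    by rewrite innerZr -/(c x) mulrC mulcJ.
  have s0 : 0 <= s by rewrite sumr_ge0 // => x _; exact: sqr_ge0.
  have := cauchy_schwarz u w; rewrite h nc_real ger0_norm // => h1.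
  have h2 : s ^+ 2 <= N2 u * (K ^+ 2 * s).
    by apply: le_trans h1 _; rewrite ler_wpM2l ?N2_ge0.
  have [->|sn0] := eqVneq s 0; first by rewrite mulr_ge0 ?sqr_ge0 ?N2_ge0.
  have sp : 0 < s by rewrite lt_def sn0.
  rewrite -(ler_pM2r sp) -expr2; apply: le_trans h2 _.
  by apply: eq_leW; ring.
have [t ht] := choice ext.
have tx u x : t u x = inner u (r x) by case: (ht u).
have tl : is_linear t by move=> a u v; apply: l2_ext => x; rewrite l2D l2Z !tx innerDl innerZl.
have tb : bounded_by t K by apply/bounded_byP => // u; case: (ht u).
have [T hT] := mk_op tl tb; exists T; split; last by move=> u; rewrite hT.
by move=> x y; rewrite /mxcoef inner_delta hT tx delta_inner hr conjCK.
Qed.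

Lemma form_inner (T : bounded_operator R X) (F G : {fset X}) (f g : X -> C) :
  \sum_(x <- F) \sum_(y <- G) mxcoef T x y * f y * g x =
  inner (T (fvec G f)) (fvec F (fun x => (g x)^*)).
Proof.
rewrite /fvec inner_sumr; apply: eq_bigr => x _.
rewrite innerZr conjCK linear_sum inner_suml -mulr_suml mulrC; congr (_ * _).
by apply: eq_bigr => y _; rewrite linearZ innerZl mulrC.
Qed.

Lemma form_of_op (T : bounded_operator R X) K : 0 <= K -> bounded_by T K ->
  form_bound (mxcoef T) K.
Proof.
move=> K0 hT F G f g; rewrite form_inner.
set u := fvec _ _; set v := fvec _ _.
have -> : \sum_(y <- G) nc (f y) ^+ 2 = l2norm u ^+ 2 by rewrite l2norm_sqr N2_fvec.
have -> : \sum_(x <- F) nc (g x) ^+ 2 = l2norm v ^+ 2.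
  by rewrite l2norm_sqr N2_fvec; apply: eq_bigr => x _; rewrite ncJ.
have h1 := cauchy_schwarz_norm (T u) v.
have h2 := ler_wpM2r (l2norm_ge0 v) (hT u).
have h3 := le_trans h1 h2.
have h4 := mulr_ge0 K0 (sqr_ge0 (l2norm u - l2norm v)).
move: h3 h4; rewrite sqrrB; move: (l2norm u) (l2norm v) => a b h3 h4.
move: h4; rewrite !mulrDr mulrN -mulr_natl => h4; lra.
Qed.

(** A matrix determines its bounded operator, so [T] is the operator that [op_of_form] builds. *)
Lemma opnorm_form (T : bounded_operator R X) A K : 0 <= K -> has_matrix T A ->
  form_bound A K -> opnorm T <= K.
Proof.
move=> K0 hT hA; have [S [hS Sb]] := op_of_form K0 hA.
suff h u : T u = S u by apply: opnorm_le => // u; rewrite h.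
apply: l2_ext => x; rewrite -!inner_delta.
apply/eqP; rewrite -subr_eq0; apply/eqP; move: u.
apply: (@inner_dense_eq0 _ (2 * opnorm T ^+ 2 + 2 * K ^+ 2)) => [u v|a u|u|y].
- by rewrite !linearD !innerDl /=; ring.
- by rewrite !linearZ !innerZl /=; ring.
- apply: le_trans (nc_sqrD _ _) _; rewrite normcN.
  have h1 := cauchy_schwarz (T u) (delta R x); have h2 := cauchy_schwarz (S u) (delta R x).
  have h3 := proj1 (bounded_byP T (opnorm_ge0 T)) (opnormP T) u.
  have h4 := proj1 (bounded_byP S K0) Sb u.
  by move: h1 h2; rewrite N2_delta !mulr1 => h1 h2; have := le_trans h1 h3; have := le_trans h2 h4; lra.
- by rewrite -!/(mxcoef _ _ _) hT hS subrr.
Qed.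

End OpTheory.

(** * Square roots, absolute values and trace duality *)

Section Sqrt.
Variables (R : realType) (X : choiceType).
Notation C := R[i].
Notation V := (l2 R X).
Implicit Types (u v w : V) (f g P Q : V -> V).

Lemma nc_small (z : C) (M : R) : (forall e : R, 0 < e -> nc z <= e * M) -> z = 0.
Proof.
move=> h; apply/eqP; rewrite -nc_eq0 eq_le nc_ge0 andbT.
apply/ler_addgt0Pr => e e0; rewrite add0r.
have M0 : 0 <= M by have := h 1 ltr01; have := nc_ge0 z; lra.
have e1 : 0 < e / (M + 1) by rewrite divr_gt0 //; lra.
apply: le_trans (h _ e1) _; rewrite mulrAC ler_pdivrMr; last lra.
by rewrite mulrDr mulr1 lerDl ltW.
Qed.

(* L = 1 - (1 - A)^(1/2) is the limit of Y_0 = 0, Y_(n+1) = (A + Y_n^2) / 2; the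
   increments are dominated by those of the same recursion for A = 1. *)
Lemma sqrt_contraction A : is_linear A -> selfadj A -> bounded_by A 1 ->
  exists L, [/\ is_linear L, selfadj L, bounded_by L 1 & forall u, 2%:R *: L u = A u + L (L u)].
Proof.
move=> Al As Ab.
pose Y := fix Y n := if n is m.+1 then fun u => (2^-1 : R)%:C *: (A u + Y m (Y m u)) else fun=> 0 : V.
pose y := fix y n := if n is m.+1 then (1 + y m ^+ 2) / 2 else 0 : R.
have YS n u : Y n.+1 u = (2^-1 : R)%:C *: (A u + Y n (Y n u)) by [].
have yS n : y n.+1 = (1 + y n ^+ 2) / 2 by [].
have y01 n : 0 <= y n <= 1.
  by elim: n => [|n /andP[h1 h2]]; rewrite ?lexx ?ler01 // yS; apply/andP; split; nra.
have half (u : V) : l2norm ((2^-1 : R)%:C *: u) = l2norm u / 2.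
  by rewrite l2normZ nc_real ger0_norm ?invr_ge0 // mulrC.
have Yl n : is_linear (Y n).
  elim: n => [|n ih] a u v; first by rewrite /= scaler0 addr0.
  rewrite !YS Al ih ih; apply: l2_ext => x; rewrite !(l2D, l2Z); ring.
have Yb n : bounded_by (Y n) (y n).
  elim: n => [|n ih] u; first by rewrite /= l2norm0 mul0r.
  rewrite YS half yS mulrAC ler_wpM2r ?invr_ge0 // mulrDl.
  apply: le_trans (l2normD _ _) _; apply: lerD; first exact: Ab.
  apply: le_trans (ih _) _; rewrite expr2 -mulrA ler_wpM2l ?ih //; by case/andP: (y01 n).
have Ys n : selfadj (Y n).
  elim: n => [|n ih] u v; first by rewrite /= inner0l inner0r.
  rewrite !YS innerZl innerZr cjR innerDl innerDr As !ih //.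
have ymon n : y n <= y n.+1.
  by rewrite yS; have /andP[h1 h2] := y01 n; have := sqr_ge0 (y n - 1); rewrite sqrrB1 => ?; lra.
have Yd n : bounded_by (fun u => Y n.+1 u - Y n u) (y n.+1 - y n).
  elim: n => [|n ih] u.
    rewrite YS /= addr0 !subr0 half expr0n addr0 mul1r mulrC ler_wpM2l ?invr_ge0 //.
    by have := Ab u; rewrite mul1r.
  rewrite (_ : _ - _ = (2^-1 : R)%:C *: (Y n.+1 (Y n.+1 u - Y n u) + (Y n.+1 (Y n u) - Y n (Y n u)))); last first.
    rewrite [in LHS]YS [in X in _ - X = _]YS -scalerBr (linB (Yl _)); congr (_ *: _).
    by rewrite opprD addrACA subrr add0r addrA subrK.
  have ye : y n.+2 - y n.+1 = (y n.+1 ^+ 2 - y n ^+ 2) / 2.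
    have := yS n.+1; have := yS n; move: (y n) (y n.+1) (y n.+2) => a b c h1 h2.
    rewrite h2 {2}h1; by field.
  rewrite half ler_pdivrMr // ye.
  apply: le_trans (l2normD _ _) _.
  have /andP[h1 h2] := y01 n; have /andP[h3 h4] := y01 n.+1.
  have b1 : l2norm (Y n.+1 (Y n.+1 u - Y n u)) <= y n.+1 * ((y n.+1 - y n) * l2norm u).
    by apply: le_trans (Yb _ _) _; rewrite ler_wpM2l.
  have b2 : l2norm (Y n.+1 (Y n u) - Y n (Y n u)) <= (y n.+1 - y n) * (y n * l2norm u).
    by apply: le_trans (ih _) _; rewrite ler_wpM2l ?Yb // subr_ge0.
  apply: le_trans (lerD b1 b2) _.
  by apply: eq_leW; field.
have [L Ll hL] := @op_limit R X Y y 1 Yl ymon (fun n => proj2 (andP (y01 n))) Yd.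
have Lb : bounded_by L 1.
  move=> u; apply/ler_addgt0Pr => e e0; rewrite mul1r.
  have e1 : 0 < e / (l2norm u + 1) by rewrite divr_gt0 // ltr_wpDl ?l2norm_ge0.
  have [n /(_ n (leqnn n)) hn] := hL _ e1.
  rewrite -(subrK (Y n u) (L u)); apply: le_trans (l2normD _ _) _; rewrite addrC.
  apply: lerD.
    by apply: le_trans (Yb n u) _; rewrite ler_piMl ?l2norm_ge0 //; case/andP: (y01 n).
  apply: le_trans (hn u) _; rewrite mulrAC ler_pdivrMr ?ltr_wpDl ?l2norm_ge0 //.
  by rewrite ler_wpM2l ?(ltW e0) ?lerDl ?ler01.
exists L; split => //.
  move=> u v; apply/eqP; rewrite -subr_eq0; apply/eqP.
  apply: (@nc_small _ (2 * (l2norm u * l2norm v))) => e e0.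
  have [n /(_ n (leqnn n)) hn] := hL _ e0.
  rewrite (_ : _ - _ = inner (L u - Y n u) v - inner u (L v - Y n v)); last first.
    by rewrite innerBl innerBr Ys; ring.
  apply: le_trans (le_normcD _ _) _; rewrite normcN.
  have h1 := le_trans (cauchy_schwarz_norm (L u - Y n u) v) (ler_wpM2r (l2norm_ge0 v) (hn u)).
  have h2 := le_trans (cauchy_schwarz_norm u (L v - Y n v)) (ler_wpM2l (l2norm_ge0 u) (hn v)).
  by apply: le_trans (lerD h1 h2) _; apply: eq_leW; ring.
move=> u; apply/eqP; rewrite -subr_eq0; apply/eqP.
apply: (@l2norm_small _ _ _ (4 * l2norm u)) => e e0.
have [n hn] := hL _ e0; have hn1 := hn n.+1 (leqnSn n); have {}hn := hn n (leqnn n).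
rewrite (_ : _ - _ = 2%:R *: (L u - Y n.+1 u) - (Y n (L u - Y n u) + (L (L u) - Y n (L u)))); last first.
  rewrite YS (linB (Yl _)) scalerBr scalerA.
  have -> : (2%:R * (2^-1 : R)%:C : C) = 1 by rewrite -[2%:R](rmorph_nat (real_complex R)) -rmorphM divff.
  by apply: l2_ext => x; rewrite !(l2D, l2N, l2Z); ring.
apply: le_trans (l2normB _ _) _.
have h0 : l2norm (2%:R *: (L u - Y n.+1 u)) <= 2 * (e * l2norm u).
  by rewrite l2normZ nc_nat ler_wpM2l //; exact: hn1.
have h1 : l2norm (Y n (L u - Y n u)) <= e * l2norm u.
  by apply: le_trans (Yb _ _) _; apply: le_trans (hn u); rewrite ler_piMl ?l2norm_ge0 //; case/andP: (y01 n).
have h2 : l2norm (L (L u) - Y n (L u)) <= e * l2norm u.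
  by apply: le_trans (hn _) _; rewrite ler_wpM2l ?(ltW e0) //; have := Lb u; rewrite mul1r.
apply: le_trans (lerD h0 (le_trans (l2normD _ _) (lerD h1 h2))) _.
by apply: eq_leW; ring.
Qed.

(** This is P^2 <= rho P, obtained by testing positivity at u - P u / rho. It must precede the
    square root, whose construction relies on it. *)
Lemma psd_N2 P rho : is_linear P -> selfadj P -> psd P -> 0 < rho -> bounded_by P rho ->
  forall u, N2 (P u) <= rho * complex.Re (inner (P u) u).
Proof.
move=> Pl Ps Pp r0 Pb u.
have E : inner (P (u - (rho^-1)%:C *: P u)) (u - (rho^-1)%:C *: P u) =
    inner (P u) u - (2 * (rho^-1 * N2 (P u)))%:C + (rho^-1 * rho^-1)%:C * inner (P (P u)) (P u).
  rewrite linB // linZ // innerBl !innerBr !innerZl !innerZr !cjR (Ps (P u) u) !inner_self !rCM (rmorph_nat _ 2).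
  by ring.
have := Pp (u - (rho^-1)%:C *: P u); rewrite E cRe_lin => h2.
have h : complex.Re (inner (P (P u)) (P u)) <= rho * N2 (P u).
  apply: le_trans (Re_le_nc _) _; apply: le_trans (cauchy_schwarz_norm _ _) _.
  rewrite -l2norm_sqr expr2 mulrA ler_wpM2r ?l2norm_ge0 //; exact: Pb.
move: h h2; set a := complex.Re (inner (P u) u); set b := complex.Re _; set q := N2 (P u) => h h2.
rewrite -ler_pdivrMl //.
have h3 : rho^-1 * (rho^-1 * b) <= rho^-1 * q.
  by rewrite ler_wpM2l ?invr_ge0 ?(ltW r0) // -ler_pdivlMl ?invr_gt0 // invrK.
move: h2 h3; rewrite -!mulrA; lra.
Qed.

(** For A = 1 - P / rho the map L of [sqrt_contraction] satisfies (1 - L)^2 = 1 - A = P / rho, and A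
    is a contraction by [psd_N2]. *)
Lemma psd_sqrt P rho : is_linear P -> selfadj P -> psd P -> 0 < rho -> bounded_by P rho ->
  exists Q, [/\ is_linear Q, selfadj Q, psd Q, exists K, bounded_by Q K & forall u, Q (Q u) = P u].
Proof.
move=> Pl Ps Pp r0 Pb; have Pn := psd_N2 Pl Ps Pp r0 Pb.
pose A u := u - (rho^-1)%:C *: P u.
have Al : is_linear A by move=> a u v; rewrite /A Pl; apply: l2_ext => x; rewrite !(l2D, l2N, l2Z); ring.
have As : selfadj A by move=> u v; rewrite /A innerBl innerBr innerZl innerZr cjR Ps.
have Ab : bounded_by A 1.
  apply/bounded_byP => // u; rewrite /A expr1n mul1r N2B N2Z innerZr cjR nc_real gtr0_norm ?invr_gt0 //.
  rewrite innerC cReZ.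
  rewrite cReJ.
  have h := Pn u; set a := complex.Re _ in h *.
  rewrite -subr_ge0 (_ : _ - _ = rho^-1 ^+ 2 * (2 * (rho * a) - N2 (P u))); last by field; lra.
  rewrite mulr_ge0 ?sqr_ge0 //; have := N2_ge0 (P u); lra.
have [L [Ll Ls Lb LE]] := sqrt_contraction Al As Ab.
pose s := Num.sqrt rho.
have s0 : 0 <= s := sqrtr_ge0 _.
have ss : s%:C * s%:C = rho%:C :> C by rewrite -rCM -expr2 sqr_sqrtr // ltW.
exists (fun u => s%:C *: (u - L u)); split.
- by move=> a u v; rewrite Ll; apply: l2_ext => x; rewrite !(l2D, l2N, l2Z); ring.
- by move=> u v; rewrite innerZl innerZr cjR innerBl innerBr Ls.
- move=> u; rewrite innerZl innerBl cReZ mulr_ge0 // cReD cReN inner_self cReC subr_ge0.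
  apply: le_trans (Re_le_nc _) _; apply: le_trans (cauchy_schwarz_norm _ _) _.
  by rewrite -l2norm_sqr expr2 ler_wpM2r ?l2norm_ge0 //; have := Lb u; rewrite mul1r.
- exists (s * 2) => u; rewrite l2normZ nc_real ger0_norm // -mulrA ler_wpM2l //.
  by apply: le_trans (l2normB _ _) _; have := Lb u; lra.
- move=> u; rewrite (linZ Ll) (linB Ll) -scalerBr scalerA ss.
  have := LE u; rewrite /A => /(congr1 (fun z => rho%:C *: z)) h.
  have hr : rho%:C * rho^-1%:C = 1 :> C by rewrite -rCM divff // gt_eqF.
  have -> : P u = rho%:C *: (rho^-1%:C *: P u) by rewrite scalerA hr scale1r.
  apply/eqP; rewrite -subr_eq0; apply/eqP; move/eqP: h; rewrite -subr_eq0 => /eqP h.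
  rewrite -[RHS]oppr0 -h; apply: l2_ext => x; rewrite !(l2D, l2N, l2Z); ring.
Qed.

(** Neumann series: P + e = (rho + e) (1 - B) with B = (rho - P) / (rho + e), whose norm is at most
    rho / (rho + e) < 1 by [psd_N2]. The last claim expands the squared norm of u = P Z u + e Z u,
    where the cross term is nonnegative. *)
Lemma psd_resolvent P rho (e : R) : is_linear P -> selfadj P -> psd P -> 0 < rho -> bounded_by P rho -> 0 < e ->
  exists Z, [/\ is_linear Z, selfadj Z, forall u, P (Z u) + e%:C *: Z u = u,
    forall u, Z (P u + e%:C *: u) = u & forall u, N2 (P (Z u)) <= N2 u].
Proof.
move=> Pl Ps Pp r0 Pb e0; have Pn := psd_N2 Pl Ps Pp r0 Pb.
pose k := (rho + e)^-1.
have re0 : 0 < rho + e by lra.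
have k0 : 0 < k by rewrite invr_gt0.
pose B u := k%:C *: (rho%:C *: u - P u).
pose r := k * rho.
have r0' : 0 <= r by rewrite mulr_ge0 ?ltW.
have r1 : r < 1 by rewrite /r /k mulrC ltr_pdivrMr // mul1r; lra.
have Bl : is_linear B by move=> a u v; rewrite /B Pl; apply: l2_ext => x; rewrite !(l2D, l2N, l2Z); ring.
have Bb : bounded_by B r.
  apply/bounded_byP => // u; rewrite /B N2Z nc_real gtr0_norm // /r exprMn -[leRHS]mulrA ler_wpM2l ?sqr_ge0 //.
  rewrite N2B N2Z nc_real gtr0_norm // innerZl cReZ.
  rewrite innerC cReJ.
  by have := Pn u; have := N2_ge0 (P u); lra.
pose Y := fix Y n := if n is m.+1 then fun u => u + B (Y m u) else fun=> 0 : V.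
pose y := fix y n := if n is m.+1 then y m + r ^+ m else 0 : R.
have YS n u : Y n.+1 u = u + B (Y n u) by [].
have Yl n : is_linear (Y n).
  elim: n => [|n ih] a u v; first by rewrite /= scaler0 addr0.
  rewrite !YS ih Bl; apply: l2_ext => x; rewrite !(l2D, l2Z); ring.
have ymon n : y n <= y n.+1 by rewrite /= lerDl exprn_ge0.
have yB n : y n <= (1 - r)^-1.
  suff -> : y n = (1 - r ^+ n) / (1 - r).
    by rewrite ler_pdivrMr ?subr_gt0 // mulVf ?gt_eqF ?subr_gt0 // gerBl exprn_ge0.
  elim: n => [|n ih]; first by rewrite /= expr0 subrr mul0r.
  by rewrite /= ih exprS; field; rewrite gt_eqF // subr_gt0.
have Yd n : bounded_by (fun u => Y n.+1 u - Y n u) (y n.+1 - y n).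
  rewrite /= [y n + _]addrC addrK.
  elim: n => [|n ih] u; first by rewrite /= (lin0 Bl) addr0 subr0 expr0 mul1r.
  rewrite !YS -YS opprD addrACA subrr add0r -linB // exprS -mulrA.
  by apply: le_trans (Bb _) _; rewrite ler_wpM2l //; exact: ih.
have [W Wl hW] := op_limit Yl ymon yB Yd.
have WE u : W u = u + B (W u).
  apply/eqP; rewrite -subr_eq0; apply/eqP.
  apply: (@l2norm_small _ _ _ (2 * l2norm u)) => d d0.
  have [n hn] := hW _ d0; have hn1 := hn n.+1 (leqnSn n); have {}hn := hn n (leqnn n).
  rewrite (_ : _ - _ = (W u - Y n.+1 u) - B (W u - Y n u)); last first.
    by rewrite YS [B (_ - _)](linB Bl); move: (W u) (B (W u)) (B (Y n u)) => a b c; apply: l2_ext => x; rewrite !(l2D, l2N); ring.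
  apply: le_trans (l2normB _ _) _.
  have h : l2norm (B (W u - Y n u)) <= d * l2norm u.
    by apply: le_trans (Bb _) _; apply: le_trans (hn u); rewrite ler_piMl ?l2norm_ge0 // ltW.
  by apply: le_trans (lerD (hn1 u) h) _; apply: eq_leW; ring.
pose Z u := k%:C *: W u.
have kk : k%:C * (rho%:C + e%:C) = 1 :> C by rewrite -rmorphD -rCM /k mulVf ?gt_eqF.
have PZ u : P (Z u) + e%:C *: Z u = u.
  rewrite /Z (linZ Pl); move: (WE u); rewrite /B => h.
  apply: l2_ext => x; have := congr1 (fun w : V => (w x : C)) h.
  rewrite !(l2D, l2N, l2Z).
  move: (W u x : C) (P (W u) x : C) (u x : C) => a b c hh.
  have -> : c = a - k%:C * (rho%:C * a - b) by rewrite {1}hh; ring.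
  have -> : k%:C * b + e%:C * (k%:C * a) = (k%:C * (rho%:C + e%:C)) * a - k%:C * (rho%:C * a - b) by ring.
  by rewrite kk mul1r.
have Zl : is_linear Z by move=> a u v; rewrite /Z Wl; apply: l2_ext => x; rewrite !(l2D, l2N, l2Z); ring.
have ZP u : Z (P u + e%:C *: u) = u.
  set w := Z _; apply/eqP; rewrite -subr_eq0; apply/eqP.
  have h : P (w - u) + e%:C *: (w - u) = 0.
    have := PZ (P u + e%:C *: u); rewrite -/w => /eqP; rewrite -subr_eq0 => /eqP h.
    rewrite -[RHS]h (linB Pl); apply: l2_ext => x; rewrite !(l2D, l2N, l2Z); ring.
  have : complex.Re (inner (P (w - u) + e%:C *: (w - u)) (w - u)) = 0 by rewrite h inner0l.
  rewrite innerDl innerZl inner_self -rCM cReDC.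
  have h1 := Pp (w - u); have h2 := N2_ge0 (w - u) => h3.
  have h4 : e * N2 (w - u) = 0.
    apply/eqP; rewrite eq_le mulr_ge0 ?(ltW e0) // andbT; lra.
  by apply: N2_eq0; move/eqP: h4; rewrite mulf_eq0 gt_eqF //= => /eqP.
exists Z; split => //.
- move=> u v; rewrite -{1}(PZ v) innerDr innerZr cjR -Ps -innerZl -[in RHS](PZ u) innerDl.
  by congr (_ + _); rewrite !innerZl.
move=> u; rewrite -[in leRHS](PZ u) N2D N2Z innerZr cjR cReZ.
rewrite -addrA lerDl addr_ge0 ?mulr_ge0 ?sqr_ge0 ?N2_ge0 ?nc_ge0 ?(ltW e0) //; exact: (Pp (Z u)).
Qed.

(** Polarization: the imaginary part of the quadratic form vanishes at i u + v and at u + v, which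
    yields the real and the imaginary part of the symmetry. *)
Lemma positive_selfadj (P : bounded_operator R X) : positive_op P -> selfadj P /\ psd P.
Proof.
move=> hP; have Pl := lin_op P.
have im u : complex.Im (inner (P u) u) = 0 by exact: (ger0_Im (hP u)).
split; last by move=> u; have := hP u; rewrite lecE => /andP[].
move=> u v; rewrite (innerC (P v) u); apply: complex_ext.
  have := im ('i%C *: u + v); rewrite Pl innerDl innerZl !innerDr !innerZr cIm_i // cReJ => /eqP.
  by rewrite subr_eq0 => /eqP.
have := im (u + v); rewrite (linD Pl) innerDl !innerDr cIm_sum4 // cImJ => /eqP.
by rewrite addr_eq0 => /eqP.
Qed.

Lemma selfadj_positive (P : bounded_operator R X) : selfadj P -> psd P -> positive_op P.
Proof.
move=> hs hp u; rewrite lecE hp andbT; apply/eqP; rewrite (_ : complex.Im 0 = 0) //.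
have : inner (P u) u = (inner (P u) u)^* by rewrite -innerC hs.
by move/(congr1 (@complex.Im R)); rewrite cImJ; move: (complex.Im _) => a; lra.
Qed.

Lemma adjointP (T : bounded_operator R X) : exists2 S : bounded_operator R X,
  adjoint T S & bounded_by S (opnorm T).
Proof.
have [g [gl gb gE]] := adjoint_ex (opnorm_ge0 T) (lin_op T) (opnormP T).
have [S hS] := mk_op gl gb.
by exists S => [u v|u]; rewrite hS.
Qed.

Lemma absopP (T : bounded_operator R X) : is_absop T (absop T).
Proof.
rewrite /absop; apply: (@xgetPex _ _ [set P | is_absop T P]).
have [S hS Sb] := adjointP T.
pose M u := S (T u).
have Ml : is_linear M by move=> a u v; rewrite /M !linearP.
have ME u v : inner (M u) v = inner (T u) (T v) by rewrite innerC -hS -innerC.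
have Ms : selfadj M by move=> u v; rewrite ME -hS.
have Mp : psd M by move=> u; rewrite ME inner_self N2_ge0.
have Mb : bounded_by M (opnorm T ^+ 2 + 1).
  move=> u; apply: le_trans (Sb _) _.
  apply: (@le_trans _ _ (opnorm T * (opnorm T * l2norm u))).
    by rewrite ler_wpM2l ?opnorm_ge0 // opnormP.
  by rewrite mulrA -expr2 ler_wpM2r ?l2norm_ge0 // lerDl.
have [Q [Ql Qs Qp [K Qb] QE]] := psd_sqrt Ml Ms Mp (ltr_wpDl (sqr_ge0 _) ltr01) Mb.
have [P hP] := mk_op Ql Qb; exists P; split.
  by apply: selfadj_positive => [u v|u]; rewrite !hP.
by exists S => // u; rewrite !hP QE.
Qed.

End Sqrt.

(** * Trace norm and finite kernels *)

Section TraceDuality.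
Variable R : realType.
Notation C := R[i].

(** Rotating by the unimodular c makes the sum real and nonnegative; bounding real and imaginary
    parts separately would cost a constant. *)
Lemma csum_bound (X : choiceType) (f : X -> C) (M : R) :
  (forall F : {fset X}, \sum_(x <- F) nc (f x) <= M) -> nc (csum f) <= M.
Proof.
move=> h; have hM : (\esum_(x in [set: X]) (nc (f x))%:E <= M%:E)%E.
  by apply: esum_leF => F; rewrite lee_fin.
have sf : csummable f.
  rewrite /csummable /rsummable; under eq_esum do rewrite ger0_norm ?nc_ge0 //.
  exact: le_lt_trans hM (ltry _).
have [f0|fn0] := eqVneq (nc (csum f)) 0.
  by rewrite f0; have := h fset0; rewrite big_seq_fset0.
have n0 : 0 < nc (csum f) by rewrite lt_def fn0 nc_ge0.
pose c := (nc (csum f))^-1%:C * (csum f)^*.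
have c1 : nc c = 1 by rewrite Normc.normcM ncJ nc_real gtr0_norm ?invr_gt0 // mulVf.
have cf : c * csum f = (nc (csum f))%:C.
  by rewrite /c -mulrA (mulrC _^*) mulcJ -rCM expr2 mulrA mulVf // mul1r.
have sg : csummable (fun x => c * f x).
  apply: (rsummable_le (b := fun x => nc (f x))) => [x|].
    by rewrite ger0_norm ?nc_ge0 // Normc.normcM c1 mul1r.
  exact: sf.
have -> : nc (csum f) = complex.Re (csum (fun x => c * f x)) by rewrite csumZ // cf.
rewrite /csum [complex.Re _]/= /rsum.
set p := (X in X - _); set q := (X in _ - X).
have q0 : 0 <= q.
  by apply: fine_ge0; apply: esum_ge0 => x _; rewrite lee_fin le_max lexx orbT.
apply: (@le_trans _ _ p); first by rewrite gerBl.
have sr := csummable_Re sg.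
rewrite -lee_fin /p (esum_fin (rsummable_pos sr) (pos_ge0 _)).
apply: le_trans hM; apply: le_esum => x _; rewrite lee_fin.
apply: le_trans (pos_le _ _) _; apply: le_trans (nc_Re _) _.
by rewrite Normc.normcM c1 mul1r.
Qed.

Lemma csummable0 (X : choiceType) : csummable (fun _ : X => 0 : C).
Proof.
rewrite /csummable /rsummable esum1 ?ltry // => x _.
by rewrite Normc.normc0 normr0.
Qed.

Lemma csummable_sum (X : choiceType) (I : Type) (r : seq I) (f : I -> X -> C) :
  (forall i, csummable (f i)) -> csummable (fun x => \sum_(i <- r) f i x).
Proof.
move=> h; elim: r => [|i r ih].
  rewrite (_ : (fun x => _) = fun=> 0); first exact: csummable0.
  by apply/funext => x; rewrite big_nil.
apply: (rsummable_le (b := fun x => nc (f i x) + nc (\sum_(i <- r) f i x))) => [x|].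
  by rewrite big_cons ger0_norm ?nc_ge0 // le_normcD.
exact: (rsummableD (h i) ih).
Qed.

Lemma csum_sum (X : choiceType) (I : Type) (r : seq I) (f : I -> X -> C) :
  (forall i, csummable (f i)) ->
  csum (fun x => \sum_(i <- r) f i x) = \sum_(i <- r) csum (f i).
Proof.
move=> h; elim: r => [|i r ih].
  have h0 := csumZ 0 (@csummable0 X); rewrite !mul0r in h0; rewrite big_nil -[RHS]h0.
  by apply: eq_csum => x; rewrite big_nil.
rewrite big_cons -ih -csumD //; last exact: csummable_sum.
by apply: eq_csum => x; rewrite big_cons.
Qed.

Lemma csummableZ (X : choiceType) (k : C) (f : X -> C) : csummable f -> csummable (fun x => k * f x).
Proof.
move=> h; apply: (rsummable_le (b := fun x => nc k * nc (f x))); last exact: rsummableZ h.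
by move=> x; rewrite ger0_norm ?nc_ge0 // Normc.normcM.
Qed.

Definition fin_bound (I J : finType) (G : I -> J -> C) (g : R) :=
  forall (u : J -> C) (v : I -> C),
  2 * nc (\sum_i \sum_j G i j * u j * v i) <=
  g * (\sum_j nc (u j) ^+ 2 + \sum_i nc (v i) ^+ 2).

(** The scalar inequality for [G] is applied at each coordinate x to the numbers [a j x] and the
    conjugates of [b i x], then summed over x. *)
Lemma gram_bound (X : choiceType) (I J : finType) (G : I -> J -> C) g
   (a : J -> l2 R X) (b : I -> l2 R X) : 0 <= g -> fin_bound G g ->
  2 * nc (\sum_i \sum_j G i j * inner (a j) (b i)) <=
  g * (\sum_j N2 (a j) + \sum_i N2 (b i)).
Proof.
move=> g0 hG.
have sab i j : csummable (fun x => G i j * ((a j x : C) * (b i x : C)^*)).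
  exact/csummableZ/inner_summable.
have -> : \sum_i \sum_j G i j * inner (a j) (b i) =
   csum (fun x => \sum_i \sum_j G i j * (a j x : C) * (b i x : C)^*).
  under eq_bigr => i _ do under eq_bigr => j _ do rewrite /inner -(csumZ _ (inner_summable _ _)).
  under eq_bigr => i _ do rewrite -csum_sum //.
  rewrite -csum_sum => [|i]; last exact: csummable_sum.
  by apply: eq_csum => x; apply: eq_bigr => i _; apply: eq_bigr => j _; rewrite mulrA.
rewrite mulrC -ler_pdivlMr //; apply: csum_bound => F.
rewrite ler_pdivlMr // mulrC mulr_sumr.
apply: (@le_trans _ _ (\sum_(x <- F) g * (\sum_j nc (a j x) ^+ 2 + \sum_i nc (b i x) ^+ 2))).
  apply: ler_sum => x _; apply: le_trans (hG _ _) _.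
  by under [X in _ + X]eq_bigr => i _ do rewrite ncJ.
rewrite -mulr_sumr ler_wpM2l // big_split /=; apply: lerD.
  by rewrite exchange_big; apply: ler_sum => j _; exact: N2_geF.
by rewrite exchange_big; apply: ler_sum => j _; exact: N2_geF.
Qed.

Lemma sum_N2_le (X : choiceType) (I : finType) (b : I -> l2 R X) (M : R) :
  (forall F : {fset X}, \sum_i \sum_(x <- F) nc (b i x) ^+ 2 <= M) -> \sum_i N2 (b i) <= M.
Proof.
move=> h; rewrite -lee_fin -sumEFin.
under eq_bigr do rewrite sqnorm_fin /sqnorm.
rewrite -esum_sum => [|x i _ _]; last by rewrite lee_fin sqr_ge0.
under eq_esum do rewrite sumEFin.
by apply: esum_leF => F; rewrite lee_fin exchange_big.
Qed.

Definition ord_fset n : {fset nat} := [fset x in iota 0 n]%fset.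

Lemma big_ord_fset (A : zmodType) n (F : nat -> A) : \sum_(x <- ord_fset n) F x = \sum_(i < n) F i.
Proof.
rewrite -(big_mkord predT F) /index_iota subn0; apply: perm_big.
apply: uniq_perm; rewrite ?fset_uniq ?iota_uniq // => x.
by rewrite in_fset.
Qed.

Lemma sub_ord_fset (F : {fset nat}) : exists m, forall n, (m <= n)%N -> (F `<=` ord_fset n)%fset.
Proof.
exists (\max_(x <- F) x).+1 => n mn; apply/fsubsetP => x xF.
rewrite !inE /= mem_iota add0n /=; apply: leq_trans mn; rewrite ltnS.
exact: leq_bigmax_seq.
Qed.

Variable T : bounded_operator R nat.
Notation P := (absop T).
Local Notation "'e_' i" := (@delta R nat i) (at level 10).

Lemma absop_facts : [/\ is_linear P, selfadj P, psd P, forall u, N2 (P u) = N2 (T u) &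
  exists2 S : bounded_operator R nat, adjoint T S & forall u, P (P u) = S (T u)].
Proof.
have [Ppos [S TS PS]] := absopP T; have [Ps Pp] := positive_selfadj Ppos.
split => //; [exact: lin_op| |by exists S].
move=> u; apply: (@complexI R); rewrite -!inner_self Ps PS -TS //.
Qed.

Lemma absop_diag i : 0 <= complex.Re (mxcoef P i i).
Proof. by have [_ _ Pp _ _] := absop_facts; exact: (Pp (e_ i)). Qed.

Lemma trace_norm_fin : trace_class T -> (fine (trace_norm T))%:E = trace_norm T.
Proof.
move=> h; apply: fineK; rewrite ge0_fin_numE //; apply: esum_ge0 => i _.
by rewrite lee_fin absop_diag.
Qed.

Lemma absop_sub F : trace_class T ->
  \sum_(i <- F : {fset nat}) complex.Re (mxcoef P i i) <= fine (trace_norm T).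
Proof.
move=> h; rewrite -lee_fin trace_norm_fin // /trace_norm.
by apply: (@esum_geF _ _ (fun i => complex.Re (mxcoef P i i))) => i; exact: absop_diag.
Qed.

(* With P = |T|, U = T (P + e)^-1 is a contraction and T = U P + e U; this stands
   in for the polar decomposition. *)
Lemma trace_dual_le n (G : 'I_n -> 'I_n -> C) g : 0 <= g -> fin_bound G g -> trace_class T ->
  nc (\sum_i \sum_j G i j * mxcoef T i j) <= g * fine (trace_norm T).
Proof.
move=> g0 hG hT; set t := fine _.
have [Pl Ps Pp PN _] := absop_facts.
pose rho := opnorm P + 1.
have r0 : 0 < rho by rewrite ltr_wpDl ?opnorm_ge0.
have Pb : bounded_by P rho.
  by move=> u; apply: le_trans (opnormP P u) _; rewrite ler_wpM2r ?l2norm_ge0 // lerDl.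
have [Q [Ql Qs Qp _ QE]] := psd_sqrt Pl Ps Pp r0 Pb.
have Qdiag i : N2 (Q (e_ i)) = complex.Re (mxcoef P i i).
  by rewrite /mxcoef -QE Qs inner_self.
have Qsum (F : {fset nat}) : \sum_(i <- F) N2 (Q (e_ i)) <= t.
  by under eq_bigr do rewrite Qdiag; exact: absop_sub.
pose S := \sum_i \sum_j nc (G i j).
have S0 : 0 <= S by apply: sumr_ge0 => i _; apply: sumr_ge0 => j _; exact: nc_ge0.
apply/ler_addgt0Pr => d d0.
have e0 : 0 < d / (S + 1) by rewrite divr_gt0 // ltr_wpDl.
set e := d / (S + 1) in e0.
have [Z [Zl Zs PZ ZP PZN]] := psd_resolvent Pl Ps Pp r0 Pb e0.
pose U u := T (Z u).
have Ul : is_linear U by move=> a u v; rewrite /U Zl linearP.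
have UN u : N2 (U u) <= N2 u by rewrite /U -PN PZN.
have Ub : bounded_by U 1 by apply/bounded_byP => // u; rewrite expr1n mul1r.
have [U' [U'l U'b U'E]] := adjoint_ex ler01 Ul Ub.
have TE i j : mxcoef T i j = inner (Q (e_ j)) (Q (U' (e_ i))) + e%:C * inner (U (e_ j)) (e_ i).
  rewrite /mxcoef -{1}(ZP (e_ j)) -/(U _) (linD Ul) (linZ Ul) innerDl innerZl.
  by rewrite -QE U'E -Qs.
have -> : \sum_i \sum_j G i j * mxcoef T i j =
    \sum_i \sum_j G i j * inner (Q (e_ j)) (Q (U' (e_ i))) +
    e%:C * \sum_i \sum_j G i j * inner (U (e_ j)) (e_ i).
  rewrite mulr_sumr -big_split; apply: eq_bigr => i _ /=.
  rewrite mulr_sumr -big_split; apply: eq_bigr => j _ /=.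
  by rewrite TE mulrDr mulrCA.
apply: le_trans (le_normcD _ _) _; apply: lerD.
  have := gram_bound (fun j : 'I_n => Q (e_ j)) (fun i : 'I_n => Q (U' (e_ i))) g0 hG.
  have h1 : \sum_(j < n) N2 (Q (e_ j)) <= t.
    by rewrite -(big_ord_fset n (fun j => N2 (Q (e_ j)))); exact: Qsum.
  (* A map and its adjoint have the same Hilbert-Schmidt norm: the sum for Q U' is bounded by the
     one for its adjoint U Q, and U is a contraction. *)
  have h2 : \sum_(i < n) N2 (Q (U' (e_ i))) <= t.
    apply: sum_N2_le => F; rewrite exchange_big /=; apply: le_trans (Qsum F); apply: ler_sum => x _.
    apply: le_trans (UN _).
    apply: (@le_trans _ _ (\sum_(i <- ord_fset n) nc (U (Q (e_ x)) i) ^+ 2)); last exact: N2_geF.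
    rewrite (big_ord_fset n (fun i => nc (U (Q (e_ x)) i) ^+ 2)); apply: eq_leW.
    apply: eq_bigr => i _; congr (_ ^+ 2).
    by rewrite -inner_delta Qs innerC -U'E inner_delta ncJ.
  have := ler_wpM2l g0 (lerD h1 h2); lra.
rewrite Normc.normcM nc_real gtr0_norm //.
apply: (@le_trans _ _ (e * S)); last by rewrite /e mulrAC ler_pdivrMr ?ltr_wpDl // ler_wpM2l ?(ltW d0) // lerDl.
rewrite ler_wpM2l ?(ltW e0) //; apply: le_trans (nc_sum _ _ _) _; apply: ler_sum => i _.
apply: le_trans (nc_sum _ _ _) _; apply: ler_sum => j _.
rewrite Normc.normcM ler_piMr ?nc_ge0 // inner_delta sqr_leP ?nc_ge0 // expr1n.
by have := UN (delta R (nat_of_ord j)); rewrite N2_delta; apply: le_trans; exact: N2_ge1.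
Qed.

(** The conjugated matrix of U = T (P + e)^-1 is a kernel of norm at most 1 whose pairing with T is
    nearly the trace of P; cutting it to finitely many rows and columns makes it an admissible
    test. *)
Lemma trace_norm_le (B : R) :
  (forall n (G : 'I_n -> 'I_n -> C), fin_bound G 1 ->
     nc (\sum_i \sum_j G i j * mxcoef T i j) <= B) -> (trace_norm T <= B%:E)%E.
Proof.
move=> h; have [Pl Ps Pp PN [S TS PS]] := absop_facts.
pose rho := opnorm P + 1.
have r0 : 0 < rho by rewrite ltr_wpDl ?opnorm_ge0.
have Pb : bounded_by P rho.
  by move=> u; apply: le_trans (opnormP P u) _; rewrite ler_wpM2r ?l2norm_ge0 // lerDl.
apply: (@esum_leF _ _ (fun i => complex.Re (mxcoef P i i))) => F; rewrite lee_fin.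
have [n /(_ n (leqnn n)) Fn] := sub_ord_fset F.
apply: (@le_trans _ _ (\sum_(i < n) complex.Re (mxcoef P i i))).
  rewrite -(big_ord_fset n (fun i => complex.Re (mxcoef P i i))).
  rewrite (big_fsetID _ (mem F) (ord_fset n)) /= (_ : [fset x in ord_fset n | x \in F]%fset = F).
    by rewrite lerDl sumr_ge0 // => x _; exact: absop_diag.
  by apply/fsetP => x; rewrite !inE /=; apply/andP/idP => [[]//|xA]; split => //; have := fsubsetP Fn x xA; rewrite !inE.
apply/ler_addgt0Pr => d d0.
(* Each of the n diagonal entries loses e twice, from cutting an inner product to k coordinates and
   from the resolvent parameter; [n.+1] keeps the quotient defined at n = 0. *)
pose e := d / (2 * n.+1%:R).
have n10 : 0 < 2 * n.+1%:R :> R by rewrite mulr_gt0 // ltr0Sn.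
have e0 : 0 < e by rewrite divr_gt0.
have en : n%:R * e * 2 <= d.
  rewrite /e mulrAC mulrA ler_pdivrMr // (mulrC d) [2 * _]mulrC ler_wpM2r ?(ltW d0) // ler_wpM2r //.
  by rewrite ler_nat.
have [Z [Zl Zs PZ ZP PZN]] := psd_resolvent Pl Ps Pp r0 Pb e0.
have UN u : N2 (T (Z u)) <= N2 u by rewrite -PN PZN.
have ZPP u : Z (P u) = P (Z u).
  have hz := ZP u; rewrite (linD Zl) (linZ Zl) in hz.
  by apply: (addIr (e%:C *: Z u)); rewrite PZ hz.
have PE i : mxcoef P i i = inner (T (e_ i)) (T (Z (e_ i))) + e%:C * inner (P (Z (e_ i))) (e_ i).
  rewrite /mxcoef -{1}(ZP (P (e_ i))) (linD Zl) (linZ Zl) innerDl innerZl (ZPP (e_ i)).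
  by congr (_ + _); rewrite PS Zs innerC -TS -innerC.
have Wex : exists Uo : bounded_operator R nat, forall u, Uo u = T (Z u).
  apply: (@mk_op _ _ (fun u => T (Z u)) 1); first by move=> a u v; rewrite Zl linearP.
  by apply/bounded_byP => // u; rewrite expr1n mul1r.
have [U UE] := Wex.
have Ub : bounded_by U 1 by apply/bounded_byP => // u; rewrite UE expr1n mul1r.
have Uf := form_of_op ler01 Ub.
have approx i : exists m, forall k, (m <= k)%N ->
   nc (inner (T (e_ i)) (U (e_ i)) - \sum_(l < k) mxcoef T l i * (mxcoef U l i)^*) <= e.
  have [F' hF] := fvec_approx (T (e_ i)) (mulr_gt0 e0 e0).
  have [m hm] := sub_ord_fset F'; exists m => k mk.
  rewrite -(big_ord_fset k (fun l => mxcoef T l i * (mxcoef U l i)^*)).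
  rewrite /mxcoef; under eq_bigr do rewrite !inner_delta.
  rewrite -inner_fvec -innerBl sqr_leP ?nc_ge0 ?(ltW e0) //.
  apply: le_trans (cauchy_schwarz _ _) _.
  apply: (@le_trans _ _ ((e * e) * 1)); last by rewrite mulr1 expr2.
  apply: ler_pM; rewrite ?N2_ge0 //; first exact: hF (hm _ mk).
  by rewrite -(@N2_delta R nat i) UE; exact: UN.
have [m hm] := choice approx.
pose k := (n + \max_(i < n) m i)%N.
have mk (i : 'I_n) : (m i <= k)%N by apply: leq_trans (leq_bigmax i) (leq_addl _ _).
have nk : (n <= k)%N by rewrite leq_addr.
(* The hypothesis speaks of square kernels, so the n useful columns are padded with zeros up to
   k. *)
pose G (l i : 'I_k) : C := (mxcoef U l i)^* *+ (i < n)%N.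
have hG : fin_bound G 1.
  move=> u v.
  pose uu (i : nat) : C := (if insub i is Some i' then u i' else 0)^*.
  pose vv (l : nat) : C := (if insub l is Some l' then v l' else 0)^*.
  have uE (i : 'I_k) : uu i = (u i)^* by rewrite /uu valK.
  have vE (i : 'I_k) : vv i = (v i)^* by rewrite /vv valK.
  have widen (A : zmodType) (f : nat -> A) : \sum_(i < n) f i = \sum_(i < k) f i *+ (i < n)%N.
    rewrite (big_ord_widen _ f nk) big_mkcond; apply: eq_bigr => i _; by case: ifP.
  have := Uf (ord_fset k) (ord_fset n) uu vv.
  rewrite !mul1r (big_ord_fset k (fun x => \sum_(y <- ord_fset n) mxcoef U x y * uu y * vv x)).
  rewrite (big_ord_fset n (fun i => nc (uu i) ^+ 2)) (big_ord_fset k (fun i => nc (vv i) ^+ 2)).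
  rewrite (widen _ (fun i => nc (uu i) ^+ 2)) => hh.
  have h1 : \sum_(i < k) nc (uu i) ^+ 2 *+ (i < n)%N <= \sum_i nc (u i) ^+ 2.
    by apply: ler_sum => i _; rewrite uE ncJ; case: (i < n)%N => //=; exact: sqr_ge0.
  have h2 : \sum_(i < k) nc (vv i) ^+ 2 = \sum_i nc (v i) ^+ 2.
    by apply: eq_bigr => i _; rewrite vE ncJ.
  rewrite -h2; apply: le_trans (lerD h1 (lexx _)); apply: le_trans hh.
  rewrite ler_wpM2l // -[leLHS]ncJ (big_morph _ (@cJD R) (conjC0 _)); apply: eq_leW; congr nc.
  apply: eq_bigr => l _; rewrite (big_morph _ (@cJD R) (conjC0 _)).
  rewrite (big_ord_fset n (fun y => mxcoef U l y * uu y * vv l)) (widen _ (fun y => mxcoef U l y * uu y * vv l)).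
  apply: eq_bigr => i _; rewrite uE vE /G; case: (i < n)%N => /=; last by rewrite !mul0r conjC0.
  by rewrite !cJM conjCK.
have := h k G hG.
have -> : \sum_(l < k) \sum_(i < k) G l i * mxcoef T l i = \sum_(i < n) \sum_(l < k) mxcoef T l i * (mxcoef U l i)^*.
  rewrite exchange_big /= (big_ord_widen _ (fun i => \sum_(l < k) mxcoef T l i * (mxcoef U l i)^*) nk) [RHS]big_mkcond /=.
  apply: eq_bigr => i _; case: ifP => hi.
    by apply: eq_bigr => l _; rewrite /G hi mulr1n mulrC.
  by rewrite big1 // => l _; rewrite /G hi mul0r.
set Sg := \sum_(i < n) _ => hS.
apply: (@le_trans _ _ (complex.Re Sg + n%:R * e * 2)); last first.
  by apply: lerD => //; apply: le_trans hS; exact: Re_le_nc.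
have -> : n%:R * e * 2 = \sum_(i < n) (e + e).
  by rewrite sumr_const card_ord -mulr_natl; ring.
rewrite /Sg cRe_sum -big_split; apply: ler_sum => i _; rewrite [leRHS](_ : _ = complex.Re (\sum_(l < k) mxcoef T l i * (mxcoef U l i)^*) + (e + e)) //.
rewrite PE cReD cReZ addrA; apply: lerD.
  rewrite -lerBlDl -cReN -cReD; apply: le_trans (Re_le_nc _) _.
  by rewrite -UE; exact: hm.
rewrite ler_piMr ?(ltW e0) //; apply: le_trans (Re_le_nc _) _.
rewrite sqr_leP ?nc_ge0 // expr1n; apply: le_trans (cauchy_schwarz _ _) _.
by rewrite N2_delta mulr1 -(@N2_delta R nat i); exact: PZN.
Qed.

End TraceDuality.

(** * Hankel matrices and sums over multi-indices *)

Section PolyFunctional.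
Variable R : realType.
Notation C := R[i].
Implicit Types (phi : nat -> C) (p q : {poly R}).

(** The linear functional on polynomials sending X^n to phi(n). It turns kernel identities between
    polynomials into identities for phi. *)
Definition poly_pair phi p : C := \sum_(i < size p) (p`_i)%:C * phi i.

Lemma poly_pairE phi p n : (size p <= n)%N -> poly_pair phi p = \sum_(i < n) (p`_i)%:C * phi i.
Proof.
move=> hn; rewrite /poly_pair (big_ord_widen _ (fun i => (p`_i)%:C * phi i) hn) big_mkcond.
apply: eq_bigr => i _; case: ltnP => // h; by rewrite nth_default // mul0r.
Qed.

Lemma poly_pairD phi p q : poly_pair phi (p + q) = poly_pair phi p + poly_pair phi q.
Proof.
set n := maxn (size p) (size q).
rewrite (poly_pairE phi (size_polyD p q)) !(@poly_pairE _ _ n) ?leq_maxl ?leq_maxr //.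
by rewrite -big_split; apply: eq_bigr => i _; rewrite coefD /= rmorphD mulrDl.
Qed.

Lemma poly_pairZ phi (a : R) p : poly_pair phi (a *: p) = a%:C * poly_pair phi p.
Proof.
rewrite (@poly_pairE _ _ (size p)) ?size_scale_leq // /poly_pair mulr_sumr.
by apply: eq_bigr => i _; rewrite coefZ rCM mulrA.
Qed.

Lemma poly_pairN phi p : poly_pair phi (- p) = - poly_pair phi p.
Proof. by rewrite -scaleN1r poly_pairZ rmorphN1 mulN1r. Qed.

Lemma poly_pairB phi p q : poly_pair phi (p - q) = poly_pair phi p - poly_pair phi q.
Proof. by rewrite poly_pairD poly_pairN. Qed.

Lemma poly_pair0 phi : poly_pair phi 0 = 0.
Proof. by rewrite /poly_pair size_poly0 big_ord0. Qed.

Lemma poly_pair_sum phi (I : Type) (r : seq I) (P : pred I) (F : I -> {poly R}) :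
  poly_pair phi (\sum_(i <- r | P i) F i) = \sum_(i <- r | P i) poly_pair phi (F i).
Proof. exact: (big_morph _ (poly_pairD phi) (poly_pair0 phi)). Qed.

Lemma poly_pairXn phi n : poly_pair phi 'X^n = phi n.
Proof.
rewrite /poly_pair size_polyXn (bigD1 ord_max) //= coefXn eqxx mul1r big1 ?addr0 // => i hi.
rewrite coefXn (_ : (i == n :> nat) = false) ?mul0r //; apply/negbTE; apply: contra hi => /eqP h.
exact/eqP/val_inj.
Qed.

Lemma poly_pair_deriv phi p : poly_pair (discrete_derivative phi) p = poly_pair phi ((1 - 'X) * p).
Proof.
rewrite mulrBl mul1r ['X * p]mulrC poly_pairB (@poly_pairE _ (p * 'X) (size p).+1); last first.
  by have [->|p0] := eqVneq p 0; rewrite ?mul0r ?size_poly0 // size_mulX.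
rewrite big_ord_recl coefMX eqxx mul0r add0r /poly_pair -sumrB; apply: eq_bigr => i _.
by rewrite coefMX /= /bump /= add1n mulrBr.
Qed.

Lemma poly_pair_iter phi N p : poly_pair (iter N (@discrete_derivative R) phi) p = poly_pair phi ((1 - 'X) ^+ N * p).
Proof.
elim: N p => [|N ih] p; first by rewrite expr0 mul1r.
by rewrite iterS poly_pair_deriv ih mulrA -exprSr.
Qed.

(** Expanding the product gives one monomial without any factor X^K and 2^(size r) - 1 monomials of
    exponent at least K, where phi is at most e in modulus. *)
Lemma poly_pair_tele phi (K : nat) (e : R) (I : Type) (d : I -> nat) (r : seq I) t : 0 <= e ->
  (forall n, (K <= n)%N -> nc (phi n) <= e) ->
  nc (poly_pair phi ('X^t * \prod_(s <- r) ('X^(d s) - 'X^K)) - phi (t + \sum_(s <- r) d s)%N)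
    <= (2 ^+ size r - 1) * e.
Proof.
move=> e0 he; elim: r t => [|s r ih] t.
  by rewrite !big_nil mulr1 poly_pairXn addn0 subrr Normc.normc0 /= expr0 subrr mul0r.
rewrite !big_cons mulrA mulrBr mulrBl poly_pairB -!exprD addnA.
set A := poly_pair _ _; set B := poly_pair _ _; set u := phi _.
have h1 := ih (t + d s)%N; have h2 := ih (t + K)%N.
have h3 : nc (phi (t + K + \sum_(j <- r) d j)%N) <= e by apply: he; lia.
rewrite (_ : A - B - u = (A - u) - ((B - phi (t + K + \sum_(j <- r) d j)%N) + phi (t + K + \sum_(j <- r) d j)%N)); last by ring.
apply: le_trans (le_normcD _ _) _; rewrite normcN.
apply: le_trans (lerD h1 (le_trans (le_normcD _ _) (lerD h2 h3))) _.
by rewrite /= exprS; apply: eq_leW; ring.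
Qed.

Lemma poly_pair_bound phi p K (a : nat -> R) (e : R) :
  (forall j, (j < K)%N -> p`_j = 0) -> (forall j, `|p`_j| <= a j) ->
  (forall n, \sum_(K <= j < n) a j * nc (phi j) <= e) -> nc (poly_pair phi p) <= e.
Proof.
move=> h0 ha he; rewrite (@poly_pairE _ _ (maxn K (size p))) ?leq_maxr //.
apply: le_trans (nc_sum _ _ _) _; apply: le_trans (he (maxn K (size p))).
rewrite -(big_mkord predT (fun i => nc ((p`_i)%:C * phi i))) /=.
rewrite (big_cat_nat (leq0n K) (leq_maxl K (size p))) /= big_nat big1 ?add0r => [|i /andP[_ iK]].
  apply: ler_sum => i _; rewrite Normc.normcM nc_real ler_wpM2r ?nc_ge0 //.
by rewrite h0 // mul0r Normc.normc0.
Qed.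

End PolyFunctional.

(** * Binomial weights and products of geometric series *)

Section Binomials.
Variable R : realType.

Lemma hockey_stick m j : (\sum_(i < j.+1) 'C(m + i, m) = 'C(m.+1 + j, m.+1))%N.
Proof.
elim: j => [|j ih]; first by rewrite big_ord1 /= !addn0 !binn.
by rewrite big_ord_recr /= ih -addSnnS addnS binS.
Qed.

(** Entry h(2a) or h(2a+1) of the Hankel matrix is seen near its diagonal with weight at a; this
    compares it with the weight at 2a or 2a+1. Each induction step costs a ratio (m + 2a + 2) / (m +
    1 + a) <= 2. *)
Lemma binom_double m a : ('C(m + a.*2.+1, m) <= 2 ^ m * 'C(m + a, m))%N.
Proof.
elim: m => [|m ih]; first by rewrite !bin0.
have h b : (m.+1 * 'C(m.+1 + b, m.+1) = (m.+1 + b) * 'C(m + b, m))%N.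
  by rewrite -mul_bin_diag addSn.
rewrite -(leq_pmul2l (ltn0Sn m)) h mulnCA h expnS.
move: ih; move: 'C(_, _) 'C(_, _) (2 ^ m)%N => c x t ih.
have h1 := leq_mul (leqnn (m.+1 + a.*2.+1)) ih.
apply: leq_trans h1 _.
rewrite (_ : (2 * t * ((m.+1 + a) * c) = (2 * (m.+1 + a)) * (t * c))%N); last by ring.
by rewrite leq_mul2r; apply/orP; right; lia.
Qed.

(** Every factor is dominated coefficientwise by 1 / (1 - X), so the product is dominated by the
    power series of (1 - X)^(-(m+1)). *)
Lemma coef_prod_le m (r : m.+1.-tuple {poly R}) :
  (forall p, p \in tval r -> forall j, 0 <= p`_j <= 1) ->
  forall j, 0 <= (\prod_(p <- r) p)`_j <= ('C(m + j, m))%:R.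
Proof.
elim: m r => [|m ih] r hr j.
  case/tupleP: r hr => p r; rewrite (tuple0 r) big_cons big_nil mulr1 bin0 => h.
  by apply: h; rewrite mem_head.
case/tupleP: r hr => p r hr; rewrite big_cons coefM.
have hp i : 0 <= p`_i <= 1 by apply: hr; rewrite mem_head.
have hq i : 0 <= (\prod_(q <- r) q)`_i <= ('C(m + i, m))%:R.
  by apply: ih => q hq; apply: hr; rewrite in_cons hq orbT.
apply/andP; split.
  by apply: sumr_ge0 => i _; have /andP[h1 _] := hp i; have /andP[h2 _] := hq (j - i)%N; rewrite mulr_ge0.
rewrite -hockey_stick natr_sum (reindex_inj rev_ord_inj) /=; apply: ler_sum => i _.
rewrite subSS subKn; last by rewrite -ltnS ltn_ord.
have /andP[h1 h2] := hp (j - i)%N; have /andP[h3 h4] := hq i.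
by apply: le_trans h4; rewrite ler_piMl.
Qed.

Lemma coef_prod_eq m K (r : m.+1.-tuple {poly R}) :
  (forall p, p \in tval r -> forall j, (j < K)%N -> p`_j = 1) ->
  forall j, (j < K)%N -> (\prod_(p <- r) p)`_j = ('C(m + j, m))%:R.
Proof.
elim: m r => [|m ih] r hr j jK.
  case/tupleP: r hr => p r; rewrite (tuple0 r) big_cons big_nil mulr1 bin0 => h.
  by apply: h => //; rewrite mem_head.
case/tupleP: r hr => p r hr; rewrite big_cons coefM.
have hp i : (i < K)%N -> p`_i = 1 by apply: hr; rewrite mem_head.
have hq i : (i < K)%N -> (\prod_(q <- r) q)`_i = ('C(m + i, m))%:R.
  by apply: ih => q hq; apply: hr; rewrite in_cons hq orbT.
rewrite -hockey_stick natr_sum (reindex_inj rev_ord_inj) /=; apply: eq_bigr => i _.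
have ij := ltn_ord i.
rewrite subSS subKn; last by rewrite -ltnS ltn_ord.
by rewrite hp ?hq ?mul1r //; lia.
Qed.

Lemma coef_prod_congr K (I : Type) (r : seq I) (P Q : I -> {poly R}) :
  (forall s j, (j < K)%N -> (P s)`_j = (Q s)`_j) ->
  forall j, (j < K)%N -> (\prod_(s <- r) P s)`_j = (\prod_(s <- r) Q s)`_j.
Proof.
move=> h; elim: r => [|s r ih] j jK; first by rewrite !big_nil.
rewrite !big_cons !coefM; apply: eq_bigr => i _; have := ltn_ord i => ij.
by rewrite h ?ih //; lia.
Qed.

Definition isum N K (m : {ffun 'I_N -> 'I_K}) : nat := \sum_s m s.
Definition isum_card N K i := #|[pred m : {ffun 'I_N -> 'I_K} | isum m == i]|.

(** The generating function reduces the counting of multi-indices to [coef_prod_le] and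
    [coef_prod_eq]. *)
Lemma isum_card_coef N K i : (isum_card N K i)%:R = ((\prod_(s < N) \sum_(k < K) 'X^k) : {poly R})`_i.
Proof.
rewrite bigA_distr_bigA coef_sum /isum_card -sum1_card natr_sum big_mkcond /=.
apply: eq_bigr => f _; rewrite prodrXr coefXn eq_sym inE /isum.
by case: (_ == _).
Qed.

Lemma coef_geom K j : (\sum_(k < K) 'X^k : {poly R})`_j = (j < K)%N%:R.
Proof.
rewrite coef_sum; under eq_bigr do rewrite coefXn.
case: ltnP => h.
  rewrite (bigD1 (Ordinal h)) //= eqxx big1 ?addr0 // => i /eqP hi.
  by case: eqP => // e; case: hi; apply: val_inj.
by rewrite big1 // => i _; case: eqP => // e; have := ltn_ord i; rewrite -e ltnNge h.
Qed.

Lemma isum_card_le m K i : (isum_card m.+1 K i <= 'C(m + i, m))%N.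
Proof.
rewrite -(ler_nat R) isum_card_coef.
have := @coef_prod_le m [tuple \sum_(k < K) 'X^k | s < m.+1].
rewrite big_map big_enum /= => /(_ _ i) h.
apply: (proj2 (andP (h _))) => p /mapP[s _ ->] j; rewrite coef_geom.
by case: (j < K)%N; rewrite ?lexx ?ler01.
Qed.

Lemma isum_card_eq m K i : (i < K)%N -> isum_card m.+1 K i = 'C(m + i, m).
Proof.
move=> iK; apply/eqP; rewrite -(eqr_nat R) isum_card_coef; apply/eqP.
have := @coef_prod_eq m K [tuple \sum_(k < K) 'X^k | s < m.+1].
rewrite big_map big_enum /= => h; apply: h => // p /mapP[s _ ->] j jK; rewrite coef_geom.
by rewrite jK.
Qed.

End Binomials.

(** * Elementary estimates for finite kernels *)

Section FiniteForms.
Variable R : realType.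
Notation C := R[i].

Lemma twice_mul_le (a b : R) : 2 * (a * b) <= a ^+ 2 + b ^+ 2.
Proof. by rewrite -subr_ge0 (_ : _ - _ = (a - b) ^+ 2) ?sqr_ge0 //; ring. Qed.

Lemma fin_bound_schur (I J : finType) (G : I -> J -> C) :
  (forall i, \sum_j nc (G i j) <= 1) -> (forall j, \sum_i nc (G i j) <= 1) -> fin_bound G 1.
Proof.
move=> h1 h2 u v; rewrite mul1r.
apply: (@le_trans _ _ (\sum_i \sum_j nc (G i j) * (nc (u j) ^+ 2 + nc (v i) ^+ 2))).
  apply: (@le_trans _ _ (2 * \sum_i \sum_j nc (G i j * u j * v i))).
    rewrite ler_wpM2l //; apply: le_trans (nc_sum _ _ _) _; apply: ler_sum => i _.
    exact: nc_sum.
  rewrite mulr_sumr; apply: ler_sum => i _; rewrite mulr_sumr; apply: ler_sum => j _.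
  rewrite !Normc.normcM -mulrA mulrCA ler_wpM2l ?nc_ge0 //; exact: twice_mul_le.
under eq_bigr => i _ do under eq_bigr => j _ do rewrite mulrDr.
under eq_bigr => i _ do rewrite big_split.
rewrite big_split /=; apply: lerD.
  rewrite exchange_big; apply: ler_sum => j _; rewrite -mulr_suml.
  by rewrite ler_piMl ?sqr_ge0.
by apply: ler_sum => i _; rewrite -mulr_suml ler_piMl ?sqr_ge0.
Qed.

Lemma sqr_sum_le (I : finType) (P : pred I) (a : I -> R) :
  (\sum_(i | P i) a i) ^+ 2 <= #|P|%:R * \sum_(i | P i) a i ^+ 2.
Proof.
rewrite expr2 big_distrlr /=.
apply: (@le_trans _ _ (\sum_(i | P i) \sum_(j | P j) (a i ^+ 2 / 2 + a j ^+ 2 / 2))).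
  apply: ler_sum => i _; apply: ler_sum => j _.
  by have := twice_mul_le (a i) (a j); lra.
rewrite (eq_bigr (fun i => #|P|%:R * (a i ^+ 2 / 2) + \sum_(j | P j) a j ^+ 2 / 2)); last first.
  by move=> i _; rewrite big_split /= sumr_const mulr_natl.
rewrite big_split /= sumr_const -mulr_sumr -mulr_suml -[X in _ + X]mulr_natl.
by apply: eq_leW; field.
Qed.

Lemma nc_sqr_sum_le (I : finType) (P : pred I) (a : I -> C) :
  nc (\sum_(i | P i) a i) ^+ 2 <= #|P|%:R * \sum_(i | P i) nc (a i) ^+ 2.
Proof.
apply: le_trans (sqr_sum_le P (fun i => nc (a i))).
rewrite -sqr_leP ?nc_ge0 ?nc_sum // sumr_ge0 // => i _; exact: nc_ge0.
Qed.

Lemma nc_dot_le (I : finType) (f u : I -> C) :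
  nc (\sum_i f i * u i) ^+ 2 <= (\sum_i nc (f i) ^+ 2) * (\sum_i nc (u i) ^+ 2).
Proof.
apply: (@le_trans _ _ ((\sum_i nc (f i) * nc (u i)) ^+ 2)).
  rewrite -sqr_leP ?nc_ge0 //; last by apply: sumr_ge0 => i _; rewrite mulr_ge0 ?nc_ge0.
  by apply: le_trans (nc_sum _ _ _) _; under eq_bigr do rewrite Normc.normcM.
rewrite expr2 !big_distrlr /=.
rewrite -(ler_pM2l (ltr0Sn R 1)) !mulr_sumr.
have e : \sum_i 2 * (\sum_j nc (f i) ^+ 2 * nc (u j) ^+ 2) =
  \sum_i \sum_j (nc (f i) ^+ 2 * nc (u j) ^+ 2 + nc (f j) ^+ 2 * nc (u i) ^+ 2).
  under [RHS]eq_bigr do rewrite big_split; rewrite big_split /= [X in _ = _ + X]exchange_big /=.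
  by rewrite -mulr_sumr -mulr2n mulr_natl.
rewrite (eq_bigr _ (fun i _ => erefl)) e; apply: ler_sum => i _; rewrite mulr_sumr; apply: ler_sum => j _.
have := twice_mul_le (nc (f i) * nc (u j)) (nc (f j) * nc (u i)); rewrite !exprMn.
by rewrite (_ : nc (f i) * nc (u j) * _ = nc (f i) * nc (u i) * (nc (f j) * nc (u j))) //; ring.
Qed.

(** With the convention 0^-1 = 0 the phase of 0 is 0, so [phaseE] holds for every z, with modulus at
    most 1 rather than equal to 1. *)
Definition phase (z : C) : C := (nc z)^-1%:C * z^*.

Lemma phaseE (z : C) : z * phase z = (nc z)%:C.
Proof.
rewrite /phase mulrCA mulcJ -rCM; have [->|z0] := eqVneq (nc z) 0; first by rewrite expr0n mulr0.
by rewrite expr2 mulKf.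
Qed.

Lemma phase_le1 (z : C) : nc (phase z) <= 1.
Proof.
rewrite Normc.normcM ncJ nc_real ger0_norm ?invr_ge0 ?nc_ge0 //.
by have [->|z0] := eqVneq (nc z) 0; rewrite ?mulr0 ?ler01 // mulVf.
Qed.

End FiniteForms.

(** * Summability, limits and recovery of phi from its derivative *)

Section Sequences.
Variable R : realType.
Notation C := R[i].
Notation dd := (@discrete_derivative R).
Implicit Types phi : nat -> C.

Definition wt m j : R := ('C(m + j, m))%:R.

Lemma wt_gt0 m j : 0 < wt m j.
Proof. by rewrite ltr0n bin_gt0 leq_addr. Qed.
Lemma wt_ge1 m j : 1 <= wt m j.
Proof. by rewrite ler1n bin_gt0 leq_addr. Qed.

Lemma gen_hankelE m phi i j : gen_hankel m.+1 phi i j =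
  (Num.sqrt (wt m i) * Num.sqrt (wt m j))%:C * iter m.+1 dd phi (i + j)%N.
Proof. by rewrite /gen_hankel rCM !addSn !subn1. Qed.

Lemma wt_mono m i : wt m i <= wt m i.+1.
Proof. by rewrite ler_nat leq_bin2l // leq_add2l. Qed.

Lemma sum_pairs (a : nat -> R) n : \sum_(j < n.*2) a j = \sum_(j < n) (a j.*2 + a j.*2.+1).
Proof.
elim: n => [|n ih]; first by rewrite !big_ord0.
by rewrite doubleS !big_ord_recr /= ih addrA.
Qed.

Lemma sum_le_mono (a : nat -> R) n k : (forall j, 0 <= a j) -> (n <= k)%N ->
  \sum_(j < n) a j <= \sum_(j < k) a j.
Proof.
move=> a0 nk; rewrite -(subnKC nk) big_split_ord /= lerDl.
by apply: sumr_ge0.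
Qed.

(** The diagonal of the Hankel matrix shows h at even arguments and the adjacent diagonal at odd
    ones. Kernels of phases supported on one diagonal have norm at most 1, so trace duality sums the
    moduli. *)
Lemma hankel_sum m phi (T : bounded_operator R nat) :
  has_matrix T (gen_hankel m.+1 phi) -> trace_class T ->
  exists B, forall n, \sum_(j < n) wt m j * nc (iter m.+1 dd phi j) <= B.
Proof.
move=> hT tT; set h := iter m.+1 dd phi; set t := fine (trace_norm T).
have d0 n : \sum_(i < n) wt m i * nc (h i.*2) <= t.
  have hG : fin_bound (fun i j : 'I_n => phase (h i.*2) *+ (i == j)) 1.
    apply: fin_bound_schur => i.
      rewrite (bigD1 i) //= eqxx big1 ?addr0 ?phase_le1 // => j /negPf ji.
      by rewrite eq_sym ji Normc.normc0.
    by rewrite (bigD1 i) //= eqxx big1 ?addr0 ?phase_le1 // => j /negPf ->; rewrite Normc.normc0.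
  have := trace_dual_le ler01 hG tT; rewrite mul1r -/t; apply: le_trans.
  have -> : \sum_(i < n) \sum_(j < n) (phase (h i.*2) *+ (i == j)) * mxcoef T i j = (\sum_(i < n) wt m i * nc (h i.*2))%:C.
    rewrite rC_sum; apply: eq_bigr => i _.
    rewrite (bigD1 i) //= eqxx big1 ?addr0 => [|j /negPf ji]; last by rewrite eq_sym ji mul0r.
    rewrite hT gen_hankelE addnn -/h mulr1n mulrCA mulrC [phase _ * _]mulrC phaseE -rCM -expr2 sqr_sqrtr ?(ltW (wt_gt0 _ _)) //.
    by rewrite mulrC.
  by rewrite nc_real ler_norm.
have d1 n : \sum_(i < n) wt m i * nc (h i.*2.+1) <= t.
  have hG : fin_bound (fun i j : 'I_n.+1 => phase (h i.*2.+1) *+ (i.+1 == j :> nat)) 1.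
    apply: fin_bound_schur => i.
      case: (ltnP i n) => hi.
        rewrite (bigD1 (Ordinal (hi : i.+1 < n.+1)%N)) //= eqxx big1 ?addr0 ?phase_le1 // => j ji.
        case: eqP => [e|_]; last by rewrite Normc.normc0.
        by case/eqP: ji; apply: val_inj.
      rewrite big1 ?ler01 // => j _; case: eqP => [e|_]; last by rewrite Normc.normc0.
      by have := ltn_ord j; lia.
    case: (posnP i) => hi.
      rewrite big1 ?ler01 // => j _; case: eqP => [e|_]; [by rewrite hi in e|by rewrite Normc.normc0].
    have hi' : (i.-1 < n.+1)%N by apply: leq_ltn_trans (leq_pred _) (ltn_ord i).
    rewrite (bigD1 (Ordinal hi')) //= prednK // eqxx big1 ?addr0 ?phase_le1 // => j ji.
    case: eqP => [e|_]; last by rewrite Normc.normc0.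
    by case/eqP: ji; apply: val_inj => /=; rewrite -e.
  have := trace_dual_le ler01 hG tT; rewrite mul1r -/t; apply: le_trans.
  have -> : \sum_(i < n.+1) \sum_(j < n.+1) (phase (h i.*2.+1) *+ (i.+1 == j :> nat)) * mxcoef T i j =
     (\sum_(i < n) Num.sqrt (wt m i) * Num.sqrt (wt m i.+1) * nc (h i.*2.+1))%:C.
    rewrite big_ord_recr /= [X in _ + X]big1 ?addr0 => [|j _]; last first.
      by rewrite (gtn_eqF (ltn_ord j)) mul0r.
    rewrite rC_sum; apply: eq_bigr => i _.
    rewrite (bigD1 (Ordinal (ltn_ord i : i.+1 < n.+1)%N)) //= eqxx big1 ?addr0 => [|j ji]; last first.
      case: eqP => [e|_]; last by rewrite mul0r.
      by case/eqP: ji; apply: val_inj.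
    rewrite hT gen_hankelE -/h addnS addnn mulr1n mulrCA [phase _ * _]mulrC phaseE -rCM //.
  rewrite nc_real; apply: le_trans (ler_norm _); apply: ler_sum => i _.
  rewrite ler_wpM2r ?nc_ge0 // -{1}(sqr_sqrtr (ltW (wt_gt0 m i))) expr2 ler_wpM2l ?sqrtr_ge0 //.
  by rewrite ler_sqrt ?(ltW (wt_gt0 _ _)) // wt_mono.
exists (2 ^+ m * (t + t)) => n.
apply: (@le_trans _ _ (\sum_(j < n.*2) wt m j * nc (h j))).
  apply: (@sum_le_mono (fun j => wt m j * nc (h j))); last by rewrite -addnn leq_addr.
  by move=> j; rewrite mulr_ge0 ?nc_ge0 ?(ltW (wt_gt0 _ _)).
rewrite (sum_pairs (fun j => wt m j * nc (h j))).
apply: le_trans (ler_wpM2l (exprn_ge0 m (ler0n R 2)) (lerD (d0 n) (d1 n))).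
rewrite -big_split mulr_sumr; apply: ler_sum => i _ /=; rewrite mulrDr.
have w1 : wt m i.*2.+1 <= 2 ^+ m * wt m i by rewrite -natrX -natrM ler_nat binom_double.
have w0 : wt m i.*2 <= 2 ^+ m * wt m i by apply: le_trans (wt_mono _ _) w1.
by apply: lerD; rewrite mulrA ler_wpM2r ?nc_ge0.
Qed.

Lemma tail_small (a : nat -> R) (B e : R) : (forall j, 0 <= a j) ->
  (forall n, \sum_(j < n) a j <= B) -> 0 < e ->
  exists K, forall K', (K <= K')%N -> forall n, \sum_(K' <= j < n) a j <= e.
Proof.
move=> a0 aB e0.
have ymon n : \sum_(j < n) a j <= \sum_(j < n.+1) a j by rewrite big_ord_recr /= lerDl.
have [K hK] := sup_adh ymon aB e0.
exists K => K' KK' n; case: (leqP n K') => h; first by rewrite big_geq ?(ltW e0).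
have /andP[_ h1] := hK K' KK'.
have /andP[h2 _] := hK n (leq_trans KK' (ltnW h)).
have : \sum_(j < n) a j = \sum_(j < K') a j + \sum_(K' <= j < n) a j.
  by rewrite -!(big_mkord predT a) (big_cat_nat (leq0n K') (ltnW h)).
by move=> e1; rewrite e1 in h2; lra.
Qed.

Definition tends_to phi (c : C) := forall e : R, 0 < e -> exists K, forall n, (K <= n)%N ->
  nc (phi n - c) <= e.

(** The norm on [R[i]^o] takes values in [R[i]]; a positive element there is real, which makes the
    two choices of e correspond. *)
Lemma tends_toP phi (c : C) : tends_to phi c <-> (phi @ \oo --> (c : R[i]^o)).
Proof.
have nE (z : R[i]^o) : `|z| = (nc z)%:C by case: z.
have P := @cvgrPdist_le R[i] R[i]^o nat eventually (@eventually_filter : Filter _) (phi : nat -> R[i]^o) c.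
split=> [h|/(proj1 P) h].
  apply: (proj2 P) => e; rewrite lt_def => /andP[en0 e0].
  have ee : e = (complex.Re e)%:C by case: e e0 {en0} => a b; rewrite lecE /= => /andP[/eqP -> _].
  have e1 : 0 < complex.Re e.
    by rewrite -ltcR -ee lt_def en0.
  have [K hK] := h _ e1; exists K => // n /= Kn.
  by rewrite nE ee lecR nc_distC; exact: hK.
move=> e e0; have e1 : (0 : R[i]) < e%:C by rewrite ltcR.
have [K _ hK] := h _ e1; exists K => n Kn.
by rewrite nc_distC -lecR -nE; exact: hK.
Qed.

Lemma tele_dist phi n k : (n <= k)%N ->
  nc (phi n) <= nc (phi k) + \sum_(n <= j < k) nc (dd phi j).
Proof.
move=> /subnK <-; elim: (k - n)%N => [|l ih]; first by rewrite add0n big_geq // addr0.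
rewrite addSn big_nat_recr /= ?leq_addl //.
apply: le_trans ih _; rewrite [_ + nc _]addrC addrA lerD2r.
rewrite -{1}(subrK (phi (l + n).+1) (phi (l + n)%N)) addrC; exact: le_normcD.
Qed.

Lemma sum_dd phi n : \sum_(j < n) dd phi j = phi 0%N - phi n.
Proof.
elim: n => [|n ih]; first by rewrite big_ord0 subrr.
by rewrite big_ord_recr /= ih /dd addrA subrK.
Qed.

Lemma abs_conv phi B : (forall n, \sum_(j < n) nc (dd phi j) <= B) -> exists c, tends_to phi c.
Proof.
move=> hB; pose y n := \sum_(j < n) nc (dd phi j).
have ymon n : y n <= y n.+1 by rewrite /y big_ord_recr /= lerDl nc_ge0.
have yd n : y n.+1 - y n = nc (dd phi n) by rewrite /y big_ord_recr /= addrAC subrr add0r.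
have [lr hr] : exists l, forall n, `|l - complex.Re (phi n)| <= 1 * (sup (range y) - y n).
  apply: (mono_limit ler01 ymon hB) => n; rewrite mul1r yd /discrete_derivative -normrN opprB -cReN -cReD; exact: nc_Re.
have [li hi] : exists l, forall n, `|l - complex.Im (phi n)| <= 1 * (sup (range y) - y n).
  apply: (mono_limit ler01 ymon hB) => n; rewrite mul1r yd /discrete_derivative -normrN opprB -cImN -cImD; exact: nc_Im.
exists (lr +i* li) => e e0; have e2 : 0 < e / 2 by rewrite divr_gt0.
have [K hK] := sup_adh ymon hB e2; exists K => n Kn.
have /andP[_ h] := hK n Kn.
rewrite nc_distC; apply: le_trans (nc_leReIm _) _; rewrite cReD cImD cReN cImN /=.
have := hr n; have := hi n; rewrite !mul1r; lra.
Qed.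

Lemma dd_bounded phi m M : (forall n, nc (phi n) <= M) ->
  exists M', forall n, nc (iter m dd phi n) <= M'.
Proof.
move=> hM; elim: m => [|m [M' ih]]; first by exists M.
exists (M' + M') => n; rewrite iterS /discrete_derivative; apply: le_trans (le_normcD _ _) _.
by rewrite normcN lerD.
Qed.

(** A nonzero limit of the increments would make phi drift linearly; the telescoped sum over n steps
    would exceed 2 M. *)
Lemma limit_dd0 phi M a : (forall n, nc (phi n) <= M) -> tends_to (dd phi) a -> a = 0.
Proof.
move=> hM ha; apply/eqP; rewrite -nc_eq0; apply/eqP/eqP; apply: contraT => an0.
have a0 : 0 < nc a by rewrite lt_def an0 nc_ge0.
have e0 : 0 < nc a / 2 by rewrite divr_gt0.
have [K hK] := ha _ e0.
have key n : n%:R * (nc a / 2) <= 2 * M.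
  pose psi j := phi (K + j)%N.
  have h : \sum_(j < n) dd psi j = psi 0%N - psi n := sum_dd psi n.
  have h1 : n%:R * a = (psi 0%N - psi n) - \sum_(j < n) (dd psi j - a).
    by rewrite sumrB h sumr_const card_ord -mulr_natl; ring.
  have h2 : nc (n%:R * a) <= 2 * M + n%:R * (nc a / 2).
    rewrite h1; apply: le_trans (le_normcD _ _) _; rewrite normcN; apply: lerD.
      apply: le_trans (le_normcD _ _) _; rewrite normcN.
      by have := hM (K + 0)%N; have := hM (K + n)%N; rewrite /psi; lra.
    apply: le_trans (nc_sum _ _ _) _; rewrite mulr_natl -[in leRHS](card_ord n) -sumr_const.
    apply: ler_sum => j _; rewrite /discrete_derivative /psi addnS; exact: (hK (K + j)%N (leq_addr _ _)).
  by move: h2; rewrite Normc.normcM nc_nat; lra.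
have M0 : 0 <= M := le_trans (nc_ge0 _) (hM 0%N).
have q0 : 0 <= 2 * M / (nc a / 2) by apply: divr_ge0 (ltW e0); rewrite mulr_ge0.
have := archi_boundP q0; rewrite ltr_pdivrMr // => h.
by have := key (Num.Def.archi_bound (2 * M / (nc a / 2))); rewrite leNgt h.
Qed.

(** Induction lowers the order of the derivative: the top one but one tends to 0 by [limit_dd0], so
    it is bounded by the tail of the next one, and exchanging the two sums raises the weight from m
    to m + 1 by [hockey_stick]. *)
Lemma hankel_cvg m phi M B : (forall n, nc (phi n) <= M) ->
  (forall n, \sum_(j < n) wt m j * nc (iter m.+1 dd phi j) <= B) -> exists c, tends_to phi c.
Proof.
elim: m B => [|m ih] B hM hB.
  apply: (@abs_conv _ B) => n; apply: le_trans (hB n).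
  by apply: ler_sum => j _; rewrite ler_peMl ?nc_ge0 // wt_ge1.
set psi := iter m.+1 dd phi.
have hB' n : \sum_(j < n) wt m.+1 j * nc (dd psi j) <= B by exact: hB.
have [a ha] : exists a, tends_to psi a.
  apply: (@abs_conv _ B) => n; apply: le_trans (hB' n).
  by apply: ler_sum => j _; rewrite ler_peMl ?nc_ge0 // wt_ge1.
have [M' hM'] := dd_bounded m hM.
have a0 : a = 0 by apply: (limit_dd0 hM').
(* The extra 1 pays for the end value [psi n] of the finite tails: n is taken so large that it is
   below 1 / (S + 1), S being the total weight up to J. *)
apply: (ih (1 + B)) => // J; rewrite -/psi.
pose S : R := \sum_(j < J) wt m j.
have S0 : 0 <= S by apply: sumr_ge0 => j _; exact: ltW (wt_gt0 _ _).
have e0 : 0 < (S + 1)^-1 by rewrite invr_gt0 ltr_wpDl.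
have [K hK] := ha _ e0; pose n := maxn J K.
have hn : nc (psi n) <= (S + 1)^-1 by have := hK n (leq_maxr _ _); rewrite a0 subr0.
apply: (@le_trans _ _ (\sum_(j < J) wt m j * (nc (psi n) + \sum_(j <= k < n) nc (dd psi k)))).
  apply: ler_sum => j _; rewrite ler_wpM2l ?(ltW (wt_gt0 _ _)) //; apply: tele_dist.
  by apply: leq_trans (ltnW (ltn_ord j)) (leq_maxl _ _).
under eq_bigr do rewrite mulrDr.
rewrite big_split /= -mulr_suml -/S; apply: lerD.
  apply: (@le_trans _ _ (S * (S + 1)^-1)); first by rewrite ler_wpM2l.
  by rewrite ler_pdivrMr ?ltr_wpDl // mul1r lerDl.
apply: le_trans (hB' n).
apply: (@le_trans _ _ (\sum_(j < n) wt m j * \sum_(j <= k < n) nc (dd psi k))).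
  apply: (@sum_le_mono (fun j => wt m j * \sum_(j <= k < n) nc (dd psi k))); last exact: leq_maxl.
  by move=> j; rewrite mulr_ge0 ?(ltW (wt_gt0 _ _)) // sumr_ge0 // => k _; exact: nc_ge0.
have E (j : nat) : \sum_(j <= k < n) nc (dd psi k) = \sum_(k < n) (j <= k)%N%:R * nc (dd psi k).
  rewrite -(big_mkord predT (fun k => (j <= k)%N%:R * nc (dd psi k))) /=.
  case: (leqP j n) => jn; last first.
    rewrite [LHS]big_geq ?(ltnW jn) // big_nat big1 // => k /andP[_ kn].
    by rewrite leqNgt (ltn_trans kn jn) mul0r.
  rewrite [RHS](big_cat_nat (leq0n j) jn) /= [X in _ = X + _](_ : _ = 0) ?add0r; last first.
    by rewrite big_nat big1 // => k /andP[_ kj]; rewrite leqNgt kj mul0r.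
  by apply: eq_big_nat => k /andP[-> _]; rewrite mul1r.
under eq_bigr do rewrite E mulr_sumr.
rewrite exchange_big /=; apply: eq_leW; apply: eq_bigr => k _.
under eq_bigr do rewrite mulrA.
rewrite -mulr_suml; congr (_ * _); rewrite /wt -hockey_stick natr_sum.
rewrite (big_ord_widen n (fun i => ('C(m + i, m))%:R : R) (ltn_ord k)) [RHS]big_mkcond.
by apply: eq_bigr => j _; rewrite ltnS; case: leqP; rewrite ?mulr1 ?mulr0.
Qed.

(** If P s is cut to Q s = X^(d s) + ... + X^(K-1), then (1 - X) Q s = X^(d s) - X^K and
    [poly_pair_tele] applies to phi - c. The products of the P s and of the Q s agree below degree
    K, and beyond it the binomial bound leaves a tail of the convergent weighted sum. *)
Lemma radial_approx m phi c B (d : 'I_m.+1 -> nat) (e : R) : tends_to phi c ->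
  (forall n, \sum_(j < n) wt m j * nc (iter m.+1 dd phi j) <= B) -> 0 < e ->
  exists K0, forall K, (K0 <= K)%N -> forall P : 'I_m.+1 -> {poly R},
    (forall s j, 0 <= (P s)`_j <= 1) ->
    (forall s j, (j < K)%N -> (P s)`_j = (d s <= j)%N%:R) ->
    nc (poly_pair (iter m.+1 dd phi) (\prod_s P s) - (phi (\sum_s d s)%N - c)) <= e.
Proof.
move=> hc hB e0; set h := iter m.+1 dd phi.
(* Half of e is shared among the fewer than 2^(m+1) error monomials of [poly_pair_tele]; the other
   half is for the tail. *)
have e1 : 0 < e / 2 / 2 ^+ m.+1 by rewrite !divr_gt0 // exprn_gt0.
have e2 : 0 < e / 2 by rewrite divr_gt0.
have [K1 hK1] := hc _ e1.
have w0 j : 0 <= wt m j * nc (h j) by rewrite mulr_ge0 ?nc_ge0 ?(ltW (wt_gt0 _ _)).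
have [K2 hK2] := tail_small w0 hB e2.
exists (maxn (maxn K1 K2) (\max_s d s)) => K hK P P01 PK.
have K1K : (K1 <= K)%N by lia.
have K2K : (K2 <= K)%N by lia.
have dK s : (d s <= K)%N by apply: leq_trans hK; rewrite leq_max (leq_bigmax s) orbT.
pose phi0 n := phi n - c.
have hphi0 : iter m.+1 dd phi0 = h.
  rewrite /h; suff ek : dd (fun n => phi n - c) = dd phi by rewrite !iterSr ek.
  by apply/funext => k; rewrite /discrete_derivative; ring.
pose Q s : {poly R} := \sum_(d s <= k < K) 'X^k.
have QE s j : (Q s)`_j = (d s <= j < K)%N%:R.
  rewrite coef_sum big_nat_cond; under eq_bigr do rewrite coefXn.
  case: (boolP (d s <= j < K)%N) => hj.
    rewrite -big_nat_cond (bigD1_seq j) ?mem_index_iota ?iota_uniq //= eqxx big1 ?addr0 // => i ij.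
    by rewrite eq_sym (negPf ij).
  rewrite big1 // => i /andP[hi _]; case: eqP => // ij; by rewrite ij hi in hj.
have tele s : (1 - 'X) * Q s = 'X^(d s) - 'X^K.
  have e' (k : nat) : (1 - 'X) * 'X^k = - (('X^(k.+1)) - ('X^k)) :> {poly R} by rewrite mulrBl mul1r -exprS opprB.
  rewrite /Q mulr_sumr; under eq_bigr do rewrite e'.
  by rewrite sumrN telescope_sumr // opprB.
have main : nc (poly_pair h (\prod_s Q s) - phi0 (\sum_s d s)%N) <= e / 2.
  rewrite -hphi0 poly_pair_iter.
  have -> : (1 - 'X) ^+ m.+1 * \prod_s Q s = \prod_s ('X^(d s) - 'X^K) :> {poly R}.
    have -> : (1 - 'X) ^+ m.+1 = \prod_(s < m.+1) (1 - 'X) :> {poly R} by rewrite prodr_const card_ord.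
    by rewrite -big_split; apply: eq_bigr => s _; exact: tele.
  have := @poly_pair_tele _ phi0 K _ _ d (index_enum 'I_m.+1) 0 (ltW e1) (fun n Kn => hK1 n (leq_trans K1K Kn)).
  rewrite expr0 mul1r add0n => h1; apply: le_trans h1 _.
  have -> : size (index_enum 'I_m.+1) = m.+1 by rewrite -[RHS]card_ord cardT enumT.
  rewrite mulrBl mul1r [2 ^+ _ * _]mulrC divfK ?gt_eqF ?exprn_gt0 //.
  by rewrite gerBl ltW.
have rest : nc (poly_pair h (\prod_s P s - \prod_s Q s)) <= e / 2.
  apply: (@poly_pair_bound _ h _ K (wt m)) => [j jK|j|n]; last exact: (hK2 K K2K n).
    rewrite coefB (@coef_prod_congr _ K _ _ P Q) ?subrr // => s i iK.
    by rewrite PK // QE iK andbT.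
  have hp := @coef_prod_le _ m [tuple P s | s < m.+1]; rewrite big_map big_enum /= in hp.
  have hq := @coef_prod_le _ m [tuple Q s | s < m.+1]; rewrite big_map big_enum /= in hq.
  have /andP[p0 p1] : 0 <= (\prod_s P s)`_j <= ('C(m + j, m))%:R.
    by apply: hp => p /mapP[s _ ->].
  have qPle : 0 <= (\prod_s Q s)`_j <= ('C(m + j, m))%:R.
    by apply: hq => p /mapP[s _ ->] i; rewrite QE; case: (_ <= _ < _)%N; rewrite ?lexx ?ler01.
  have /andP[q0 q1] := qPle.
  by rewrite coefB ler_norml /wt; apply/andP; split; lra.
rewrite (_ : _ - _ = (poly_pair h (\prod_s Q s) - phi0 (\sum_s d s)%N) + poly_pair h (\prod_s P s - \prod_s Q s)).
  by apply: le_trans (le_normcD _ _) _; apply: le_trans (lerD main rest) _; lra.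
by rewrite poly_pairB /phi0; ring.
Qed.

End Sequences.

(** * Passage between multi-indices and the weighted Hankel matrix *)

Section Transfer.
Variable R : realType.
Notation C := R[i].
Notation dd := (@discrete_derivative R).
Variables (m : nat) (phi : nat -> C).
Notation h := (iter m.+1 dd phi).
Notation M K := {ffun 'I_m.+1 -> 'I_K}.
Notation wt := (wt R m).

Definition rsqrt_wt j : R := (Num.sqrt (wt j))^-1.

Lemma rsqrt_wt_ge0 j : 0 <= rsqrt_wt j. Proof. by rewrite invr_ge0 sqrtr_ge0. Qed.
Lemma rsqrt_wt_sqr j : rsqrt_wt j ^+ 2 = (wt j)^-1.
Proof. by rewrite exprVn sqr_sqrtr // ltW // wt_gt0. Qed.
Lemma rsqrt_wtM j : rsqrt_wt j * Num.sqrt (wt j) = 1.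
Proof. by rewrite mulVf // gt_eqF // sqrtr_gt0 wt_gt0. Qed.
Lemma rsqrt_wtK j : rsqrt_wt j * wt j = Num.sqrt (wt j).
Proof.
have h := sqr_sqrtr (ltW (wt_gt0 R m j)).
by rewrite -[X in _ * X]h expr2 mulrA rsqrt_wtM mul1r.
Qed.

(** Sending u to the family of u(|b|) / sqrt(wt |b|) is a contraction, because at most wt(i)
    multi-indices have sum i. Compressing gm by it keeps the norm bound, and the weights of the
    Hankel matrix cancel the square roots. *)
Lemma trace_multi_le (T : bounded_operator R nat) K g (gm : M K -> M K -> C) :
  0 <= g -> fin_bound gm g -> has_matrix T (gen_hankel m.+1 phi) -> trace_class T ->
  nc (\sum_a \sum_b gm a b * h (isum a + isum b)%N) <= g * fine (trace_norm T).
Proof.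
move=> g0 hg hT tT; pose L := (m.+1 * K)%N.
have ioL (a : M K) : (isum a < L.+1)%N.
  rewrite ltnS /isum /L -[X in (X * _)%N](card_ord m.+1) -sum_nat_const.
  by apply: leq_sum => s _; exact: ltnW.
pose io (a : M K) : 'I_L.+1 := Ordinal (ioL a).
pose G (i j : 'I_L.+1) : C := \sum_(a | io a == i) \sum_(b | io b == j) (rsqrt_wt i * rsqrt_wt j)%:C * gm a b.
have cio (i : 'I_L.+1) : #|[pred a | io a == i]|%:R <= wt i.
  by rewrite ler_nat; exact: (isum_card_le R m K i).
have fold (u : 'I_L.+1 -> C) : \sum_b nc ((rsqrt_wt (io b))%:C * u (io b)) ^+ 2 <= \sum_j nc (u j) ^+ 2.
  rewrite (partition_big io xpredT) //=; apply: ler_sum => j _.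
  rewrite (eq_bigr (fun=> (wt j)^-1 * nc (u j) ^+ 2)) => [|b /eqP <-]; last first.
    by rewrite Normc.normcM nc_real ger0_norm ?rsqrt_wt_ge0 // exprMn rsqrt_wt_sqr.
  rewrite sumr_const -mulr_natl mulrA ler_piMl ?sqr_ge0 //.
  by rewrite ler_pdivrMr ?wt_gt0 // mul1r cio.
have dbl (F : M K -> M K -> C) : \sum_a \sum_b F a b =
    \sum_i \sum_j \sum_(a | io a == i) \sum_(b | io b == j) F a b.
  rewrite (partition_big io xpredT) //=; apply: eq_bigr => i _; rewrite [RHS]exchange_big /=.
  by apply: eq_bigr => a _; rewrite (partition_big io xpredT).
have hG : fin_bound G g.
  move=> u v.
  have -> : \sum_i \sum_j G i j * u j * v i =
     \sum_a \sum_b gm a b * ((rsqrt_wt (io b))%:C * u (io b)) * ((rsqrt_wt (io a))%:C * v (io a)).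
    rewrite dbl; apply: eq_bigr => i _; apply: eq_bigr => j _.
    rewrite /G !mulr_suml; apply: eq_bigr => a /eqP <-; rewrite !mulr_suml; apply: eq_bigr => b /eqP <-.
    by rewrite rCM; ring.
  apply: le_trans (hg _ _) _; rewrite ler_wpM2l //; apply: lerD; exact: fold.
apply: le_trans (trace_dual_le g0 hG tT); apply: eq_leW; congr nc.
rewrite dbl; apply: eq_bigr => i _; apply: eq_bigr => j _.
rewrite hT gen_hankelE /G !mulr_suml; apply: eq_bigr => a /eqP ai.
rewrite !mulr_suml; apply: eq_bigr => b /eqP bj.
have -> : isum a = i by rewrite -ai.
have -> : isum b = j by rewrite -bj.
have e : (rsqrt_wt i * rsqrt_wt j)%:C * (Num.sqrt (wt i) * Num.sqrt (wt j))%:C = 1 :> C.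
  by rewrite -rCM mulrACA !rsqrt_wtM mulr1.
by move: (h _) => x; rewrite -[LHS]mul1r -e; ring.
Qed.

(** The converse lifts a kernel on ['I_n] to multi-indices with entries below n. For i < n exactly
    wt(i) of them have sum i, which gives equality of the pairings; those of larger sum get the
    value 0. *)
Lemma multi_trace_bound (B : R) :
  (forall K g (gm : M K -> M K -> C), 0 < g -> fin_bound gm g ->
     nc (\sum_a \sum_b gm a b * h (isum a + isum b)%N) <= B * g) ->
  forall n g (G : 'I_n -> 'I_n -> C), 0 < g -> fin_bound G g ->
     nc (\sum_i \sum_j G i j * gen_hankel m.+1 phi i j) <= B * g.
Proof.
move=> hB n g G g0 hG.
pose io (a : M n) : option 'I_n := insub (isum a).
pose gm (a b : M n) : C := if (io a, io b) is (Some i, Some j) then (rsqrt_wt i * rsqrt_wt j)%:C * G i j else 0.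
have cio (i : 'I_n) : #|[pred a | io a == Some i]|%:R = wt i.
  transitivity ((isum_card m.+1 n i)%:R : R); last by rewrite (isum_card_eq R m (ltn_ord i)).
  congr (_%:R); apply: eq_card => a; rewrite !inE /io.
  case: insubP => [k _ ke|] /=; first by rewrite -ke; apply/eqP/eqP => [[->]//|/val_inj ->].
  by move=> h; apply/esym/negbTE; apply: contra h => /eqP ->.
have part (A : nmodType) (F : M n -> A) : (forall a, io a = None -> F a = 0) ->
    \sum_a F a = \sum_i \sum_(a | io a == Some i) F a.
  move=> h0; rewrite (partition_big io xpredT) //= (bigD1 None) //= big1 ?add0r => [|a /eqP]; last exact: h0.
  rewrite (reindex_omap (@Some _) id) /=; last by case=> [i|//].
  by apply: eq_bigl => i; rewrite /= eqxx.
have fold (u : M n -> C) : \sum_(i < n) nc ((rsqrt_wt i)%:C * \sum_(a | io a == Some i) u a) ^+ 2 <= \sum_a nc (u a) ^+ 2.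
  apply: (@le_trans _ _ (\sum_a nc (if io a is Some _ then u a else 0) ^+ 2)); last first.
    by apply: ler_sum => a _; case: (io a) => [k|]; rewrite ?lexx // Normc.normc0 expr0n sqr_ge0.
  rewrite (part _ (fun a => nc (if io a is Some _ then u a else 0) ^+ 2)); last first.
    by move=> a ->; rewrite Normc.normc0 expr0n.
  apply: ler_sum => i _; rewrite Normc.normcM nc_real ger0_norm ?rsqrt_wt_ge0 // exprMn rsqrt_wt_sqr.
  rewrite ler_pdivrMl ?wt_gt0 //; apply: le_trans (nc_sqr_sum_le _ _) _; rewrite cio.
  by rewrite ler_wpM2l ?(ltW (wt_gt0 _ _ _)) //; apply: ler_sum => a /eqP ->.
have dbl (F : M n -> M n -> C) : (forall a b, io a = None \/ io b = None -> F a b = 0) ->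
   \sum_a \sum_b F a b = \sum_i \sum_j \sum_(a | io a == Some i) \sum_(b | io b == Some j) F a b.
  move=> h0; rewrite part => [|a ha]; last by rewrite big1 // => b _; apply: h0; left.
  apply: eq_bigr => i _; rewrite [RHS]exchange_big /=.
  by apply: eq_bigr => a _; rewrite part // => b hb; apply: h0; right.
have gm0 a b : io a = None \/ io b = None -> gm a b = 0.
  by rewrite /gm => -[->//|->]; case: (io a).
have hgm : fin_bound gm g.
  move=> u v.
  have -> : \sum_a \sum_b gm a b * u b * v a =
     \sum_i \sum_j G i j * ((rsqrt_wt j)%:C * \sum_(b | io b == Some j) u b) * ((rsqrt_wt i)%:C * \sum_(a | io a == Some i) v a).
    rewrite dbl => [|a b /gm0 ->]; last by rewrite !mul0r.
    apply: eq_bigr => i _; apply: eq_bigr => j _.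
    transitivity ((rsqrt_wt i * rsqrt_wt j)%:C * G i j * (\sum_(b | io b == Some j) u b) * (\sum_(a | io a == Some i) v a)); last by rewrite rCM; ring.
    rewrite mulr_sumr; apply: eq_bigr => a /eqP ai; rewrite mulr_sumr mulr_suml; apply: eq_bigr => b /eqP bj.
    by rewrite /gm ai bj.
  apply: le_trans (hG _ _) _; rewrite ler_wpM2l ?(ltW g0) //; apply: lerD; exact: fold.
have := hB n g gm g0 hgm; congr (nc _ <= _).
rewrite dbl => [|a b /gm0 ->]; last by rewrite mul0r.
apply: eq_bigr => i _; apply: eq_bigr => j _.
have inj (a : M n) (k : 'I_n) : io a = Some k -> isum a = k.
  by rewrite /io; case: insubP => // k' _ <- [->].
have cioC (k : 'I_n) : #|[pred a | io a == Some k]|%:R = (wt k)%:C :> C.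
  by rewrite -(rmorph_nat (real_complex R)) cio.
rewrite (eq_bigr (fun=> (wt j)%:C * ((rsqrt_wt i * rsqrt_wt j)%:C * G i j * h (i + j)%N))) => [|a /eqP ai]; last first.
  rewrite (eq_bigr (fun=> (rsqrt_wt i * rsqrt_wt j)%:C * G i j * h (i + j)%N)) => [|b /eqP bj]; last first.
    by rewrite /gm ai bj (inj _ _ ai) (inj _ _ bj).
  by rewrite sumr_const -mulr_natl cioC.
rewrite sumr_const -mulr_natl cioC gen_hankelE -!rsqrt_wtK !rCM.
by move: (h _) => x; ring.
Qed.

(** The bound is used twice: on rank-one kernels it makes the Hankel form bounded, so that an
    operator exists, and on all kernels it bounds the trace norm of that operator. *)
Lemma hankel_trace_class (B : R) :
  (forall K g (gm : M K -> M K -> C), 0 < g -> fin_bound gm g ->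
     nc (\sum_a \sum_b gm a b * h (isum a + isum b)%N) <= B * g) ->
  exists2 T : bounded_operator R nat, has_matrix T (gen_hankel m.+1 phi) & trace_class T.
Proof.
move=> hB0; have hB := multi_trace_bound hB0.
have B0 : 0 <= B.
  have := hB 0%N 1 (fun _ _ => 0) ltr01; rewrite mulr1 => h; apply: le_trans (nc_ge0 _) (h _).
  by move=> u v; rewrite !big_ord0 Normc.normc0 mulr0 addr0 mulr0.
have hf : form_bound (gen_hankel m.+1 phi) (2 * B).
  move=> F E f g; apply/ler_addgt0Pr => e e0.
  pose p := \sum_(y <- E) nc (f y) ^+ 2; pose q := \sum_(x <- F) nc (g x) ^+ 2.
  rewrite -/p -/q.
  have p0 : 0 <= p by apply: sumr_ge0 => y _; exact: sqr_ge0.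
  have q0 : 0 <= q by apply: sumr_ge0 => y _; exact: sqr_ge0.
  have [n1 h1] := sub_ord_fset F; have [n2 h2] := sub_ord_fset E.
  pose n := maxn n1 n2.
  have hF : (F `<=` ord_fset n)%fset by apply: h1; exact: leq_maxl.
  have hE : (E `<=` ord_fset n)%fset by apply: h2; exact: leq_maxr.
  have ext (A : zmodType) (D : {fset nat}) (a : nat -> A) : (D `<=` ord_fset n)%fset ->
      \sum_(x <- D) a x = \sum_(x < n) (if (x : nat) \in D then a x else 0).
    move=> hD; rewrite -(big_ord_fset n (fun x => if x \in D then a x else 0)).
    rewrite (big_fsetID _ (mem D) (ord_fset n)) /= (_ : [fset x in ord_fset n | x \in D]%fset = D).
      rewrite [X in _ = _ + X]big_seq [X in _ = _ + X]big1 ?addr0 => [|x].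
        by apply: eq_big_seq => x ->.
      by rewrite !inE /= => /andP[_ /negPf ->].
    by apply/fsetP => x; rewrite !inE /=; apply/andP/idP => [[]//|xD]; split => //; have := fsubsetP hD x xD; rewrite !inE.
  pose f' (j : 'I_n) := if (j : nat) \in E then f j else 0.
  pose g' (j : 'I_n) := if (j : nat) \in F then g j else 0.
  have pE : p = \sum_j nc (f' j) ^+ 2.
    rewrite /p ext //; apply: eq_bigr => j _; rewrite /f'; case: ifP => //.
    by rewrite Normc.normc0 expr0n.
  have qE : q = \sum_j nc (g' j) ^+ 2.
    rewrite /q ext //; apply: eq_bigr => j _; rewrite /g'; case: ifP => //.
    by rewrite Normc.normc0 expr0n.
  (* A positive kernel bound is required, while p + q may vanish; the perturbation e' costs at most
     2 B e' <= e. *)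
  pose e' := e / (2 * (B + 1)).
  have b1 : 0 < 2 * (B + 1) by lra.
  have e'0 : 0 < e' by rewrite divr_gt0.
  have hG : fin_bound (fun i j : 'I_n => f' j * g' i) (p + q + e').
    move=> u v.
    have -> : \sum_i \sum_j f' j * g' i * u j * v i = (\sum_j f' j * u j) * (\sum_i g' i * v i).
      rewrite mulr_sumr; apply: eq_bigr => i _; rewrite mulr_suml; apply: eq_bigr => j _; ring.
    rewrite Normc.normcM; apply: le_trans (twice_mul_le _ _) _.
    have k1 := nc_dot_le f' u; have k2 := nc_dot_le g' v.
    have u0 : 0 <= \sum_j nc (u j) ^+ 2 by apply: sumr_ge0 => y _; exact: sqr_ge0.
    have v0 : 0 <= \sum_j nc (v j) ^+ 2 by apply: sumr_ge0 => y _; exact: sqr_ge0.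
    rewrite -pE in k1; rewrite -qE in k2; apply: le_trans (lerD k1 k2) _.
    have k3 := mulr_ge0 p0 v0; have k4 := mulr_ge0 q0 u0.
    have k5 := mulr_ge0 (ltW e'0) (addr_ge0 u0 v0).
    rewrite [leRHS]mulrDl [(p + q) * _]mulrDr !mulrDl; lra.
  have pq0 : 0 < p + q + e' by apply: ltr_wpDl => //; exact: addr_ge0.
  have := hB n _ _ pq0 hG.
  have -> : \sum_(i < n) \sum_(j < n) f' j * g' i * gen_hankel m.+1 phi i j =
     \sum_(x <- F) \sum_(y <- E) gen_hankel m.+1 phi x y * f y * g x.
    rewrite ext //; apply: eq_bigr => i _; rewrite /g'; case: ifP => _; last first.
      by rewrite big1 // => j _; rewrite mulr0 mul0r.
    rewrite ext //; apply: eq_bigr => j _; rewrite /f'; case: ifP => _; last by rewrite !mul0r.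
    by rewrite mulrC mulrA.
  have k6 : B * e' * 2 <= e.
    rewrite /e' mulrA mulrAC ler_pdivrMr // mulrC; have := mulr_ge0 (ltW e0) B0; lra.
  by rewrite mulrDr; lra.
have [T [hT _]] := op_of_form (mulr_ge0 (ler0n R 2) B0) hf.
exists T => //; rewrite /trace_class.
apply: (@le_lt_trans _ _ B%:E); last exact: ltry.
apply: trace_norm_le => n G hG; have := hB n 1 G ltr01 hG; rewrite mulr1.
by under eq_bigr => i _ do under eq_bigr => j _ do rewrite -(hT i j).
Qed.

End Transfer.

(** * Kernels on hyperbolic graphs *)

Section Graph.
Variable X : connected_graph.
Implicit Types x y z w : X.
Notation d := (@gdist X).

Lemma gdist_walk x y : exists p, [/\ path (@edge X) x p, last x p = y & size p = d x y].
Proof. by rewrite /gdist; case: ex_minnP => n /asboolP. Qed.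

Lemma gdist_min x s : path (@edge X) x s -> (d x (last x s) <= size s)%N.
Proof. by move=> hs; rewrite /gdist; case: ex_minnP => n _; apply; apply/asboolP; exists s. Qed.

Lemma gdistxx x : d x x = 0%N.
Proof. by apply/eqP; rewrite -leqn0; exact: (@gdist_min x [::]). Qed.

Lemma gdist_eq0 x y : d x y = 0%N -> x = y.
Proof. by have [s [_ <- h]] := gdist_walk x y; rewrite -h => /size0nil ->. Qed.

Lemma gdist_tri x y z : (d x z <= d x y + d y z)%N.
Proof.
have [s [ps <- <-]] := gdist_walk x y; have [t [pt <- <-]] := gdist_walk (last x s) z.
by rewrite -last_cat -size_cat; apply: gdist_min; rewrite cat_path ps.
Qed.

Lemma gdist_sym x y : d x y = d y x.
Proof.
have le a b : (d b a <= d a b)%N.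
  have [s [ps e <-]] := gdist_walk a b.
  have ha : last (last a s) (rev (belast a s)) = a.
    by case: s {ps e} => //= c s; rewrite rev_cons last_rcons.
  have hp : path (@edge X) (last a s) (rev (belast a s)).
    by rewrite rev_path (eq_path (e' := @edge X)) // => u v; rewrite edge_sym.
  by have := gdist_min hp; rewrite ha e size_rev size_belast.
by apply/eqP; rewrite eqn_leq !le.
Qed.

Lemma geodesic x y k : (k <= d x y)%N -> exists z, (d x z <= k)%N /\ (d z y <= d x y - k)%N.
Proof.
have [s [ps e hs]] := gdist_walk x y; rewrite -hs => ks.
exists (last x (take k s)); move: ps e; rewrite -{1 2}(cat_take_drop k s) cat_path last_cat => /andP[p1 p2] e.
split; first by apply: leq_trans (gdist_min p1) _; rewrite size_take_min geq_minl.
by have := gdist_min p2; rewrite e size_drop.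
Qed.

Lemma gdist_step x y n : (d x y <= n.+1)%N -> y = x \/ exists2 z, edge x z & (d z y <= n)%N.
Proof.
have [s [ps e <-]] := gdist_walk x y; case: s ps e => [|z s] /= ps e hs; first by left.
by right; case/andP: ps => xz ps; exists z => //; apply: (@leq_trans (size s)) => //; rewrite -e; exact: (gdist_min ps).
Qed.

Lemma ball_bound r : bounded_degree X -> exists M, forall x, exists s : seq X, (size s <= M)%N /\
  forall y, (d x y <= r)%N -> y \in s.
Proof.
move=> [D hD].
have nb x : exists s : seq X, (size s <= D)%N /\ forall y, edge x y -> y \in s.
  exists (fset_set [set y | edge x y]); split; first exact: geq_card_fset_set (hD x).
  move=> y xy; rewrite in_fset_set; last by apply/finite_set_leP; exists D; exact: hD.
  by rewrite inE.
elim: r => [|r [M ih]].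
  exists 1%N => x; exists [:: x]; split => // y; rewrite leqn0 => /eqP /gdist_eq0 ->.
  by rewrite mem_head.
have [b hb] := choice ih.
exists (1 + D * M)%N => x; have [s [sD hs]] := nb x.
exists (x :: flatten [seq b z | z <- s]); split.
  rewrite /= add1n ltnS size_flatten /shape -map_comp sumnE big_map.
  apply: (@leq_trans (size s * M)); last by rewrite leq_mul2r sD orbT.
  elim: s {sD hs} => [|z s IH]; first by rewrite big_nil.
  by rewrite big_cons mulSn leq_add //; case: (hb z).
move=> y /gdist_step[->|[z xz zy]]; first by rewrite mem_head.
rewrite in_cons; apply/orP; right; apply/flattenP; exists (b z).
  by apply/mapP; exists z => //; exact: hs.
by case: (hb z) => _; apply.
Qed.

Section Hyperbolic.
Variables (D : nat) (p : X).
Hypothesis fourpt : forall x y z w,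
  (d x z + d y w <= maxn (d x y + d z w) (d x w + d y z) + D)%N.
Notation Rd := (3 * D + 1)%N.

(* The points close to the point at distance k from x on a geodesic from x to p. *)
Definition near_geo x k w := ((d x w <= k) && (d w p <= (d x p - k) + Rd))%N.

(** The four-point condition for w, x, w', p gives Rd + D. If k is at least d(x, p), the truncated
    difference is 0 and both points lie within Rd of p, which is where 2 Rd comes from. *)
Lemma near_geo_diam x k w w' : near_geo x k w -> near_geo x k w' -> (d w w' <= 2 * Rd)%N.
Proof.
move=> /andP[h1 h2] /andP[h3 h4].
have [ak|ka] := leqP (d x p) k.
  by have := gdist_tri w p w'; rewrite (gdist_sym p w'); lia.
by have := fourpt w x w' p; rewrite (gdist_sym w x); lia.
Qed.

Lemma near_geo_meet x y k l : (d x y <= k + l)%N ->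
  (d x p + l == d y p + k)%N || (d x p + l == d y p + k + 1)%N ->
  exists2 w, near_geo x k w & near_geo y l w.
Proof.
move=> dn lev; pose a := d x p; pose b := d y p.
suff [w [h1 h2 h3]] : exists w, [/\ (d x w <= k)%N, (d y w <= l)%N & (d w p <= (b - l) + Rd)%N].
  by exists w; rewrite /near_geo ?h1 ?h2 -/a -/b /=; move: lev; rewrite -/a -/b; lia.
move: lev; rewrite -/a -/b => lev.
(* With slack 2 D the meeting point can be sought on the geodesic from x to p, at distance k - D:
   backing off by D absorbs the D of the four-point condition for its distance to y. *)
have [hA|hB] := leqP (d x y + 2 * D)%N (k + l)%N.
  have [kD|Dk] := ltnP k D.
    by exists x; rewrite gdistxx -/a (gdist_sym y x); split; lia.
  have [ha|ha] := ltnP a (k - D)%N.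
    by exists p; rewrite -/a -/b gdistxx; split; lia.
  have [z [z1 z2]] := geodesic ha.
  exists z; have f := fourpt y x z p; rewrite (gdist_sym y x) -/a -/b in f; rewrite -/a in z2.
  by split; lia.
(* Without slack a point of the geodesic from x to y is within l of y. The missing slack, less than
   2 D, plus the D of the four-point condition give the 3 D in Rd; the 1 is for the parity offset of
   the levels. *)
have hm : (minn k (d x y) <= d x y)%N by lia.
have [z [z1 z2]] := geodesic hm.
exists z; have f := fourpt z x p y.
rewrite (gdist_sym z x) (gdist_sym p y) -/a -/b in f; rewrite (gdist_sym y z).
by split; lia.
Qed.

(** The points reached after k steps from x and l steps from y towards p must be equally far from p.
    With k + l prescribed, parity may prevent this; allowing an offset of one makes exactly one of
    the two alternatives solvable. *)
Definition meet_level x y k l :=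
  (((d x p + l == d y p + k) || (d x p + l == d y p + k + 1)) && (d x y <= k + l))%N.

Lemma meet_level_unique x y k l k' l' : meet_level x y k l -> meet_level x y k' l' -> (k + l = k' + l')%N -> k = k'.
Proof. by move=> /andP[h _] /andP[h' _]; lia. Qed.

Lemma meet_level_exists x y n : (d x y <= n)%N -> exists2 k, (k <= n)%N & meet_level x y k (n - k).
Proof.
move=> hn; have h1 := gdist_tri x y p; have h2 := gdist_tri y x p; rewrite (gdist_sym y x) in h2.
exists ((n + d x p - d y p)./2)%N; first by lia.
rewrite /meet_level; apply/andP; split; lia.
Qed.

End Hyperbolic.

(** Gromov products carry a factor 1/2, so 2 delta is rounded up to a natural number. *)
Lemma hyperbolic_fourpt (R : realType) : hyperbolic X R -> exists D, forall x y z w,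
  (d x z + d y w <= maxn (d x y + d z w) (d x w + d y z) + D)%N.
Proof.
move=> [delta h]; pose D := Num.Def.archi_bound (2 * `|delta|).
exists D => x y z w.
have hD : 2 * delta <= D%:R :> R.
  apply: le_trans (ltW (archi_boundP _)); last by rewrite mulr_ge0.
  by rewrite ler_wpM2l // ler_norm.
suff : (d x z + d y w <= d x y + d z w + D)%N \/ (d x z + d y w <= d x w + d y z + D)%N by lia.
rewrite -!(ler_nat R) !natrD; have := h x y z w; rewrite /gromov_product.
by rewrite minEle; case: ifP => h1 h2; [left|right]; lra.
Qed.

End Graph.

(** * Inclusion-exclusion and coded index types *)

Section Kernel.
Variable R : realType.

Lemma sum_at_most_one (I : finType) (P : pred I) :
  (forall i j, P i -> P j -> i = j) -> \sum_i (P i)%:R <= 1 :> R.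
Proof.
move=> h; case: (pickP P) => [i Pi|P0]; last by rewrite big1 ?ler01 // => i _; rewrite P0.
rewrite (bigD1 i) //= Pi big1 ?addr0 // => j ji; case: (boolP (P j)) => // Pj.
by rewrite (h _ _ Pi Pj) eqxx in ji.
Qed.

(** Expand the product of 1 + (-1) over S: it is 0 unless S is empty, and the empty subset
    contributes 1. *)
Lemma sum_subset_sign (V : finType) (S : {set V}) :
  \sum_(A : {set V}) ((A != finset.set0) && (A \subset S))%:R * - (-1) ^+ #|A| =
  (S != finset.set0)%:R :> R.
Proof.
have h : \prod_(i : V) ((if i \in S then -1 else 0) + 1) =
    \sum_(A : {set V}) \prod_i (if i \in A then (if i \in S then -1 else 0) else 1) :> R.
  by rewrite bigA_distr.
have e (A : {set V}) : \prod_i (if i \in A then (if i \in S then -1 else 0) else 1) =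
    (A \subset S)%:R * (-1) ^+ #|A| :> R.
  case: (boolP (A \subset S)) => AS; last first.
    have [x xA xS] := subsetPn AS.
    by rewrite (bigD1 x) //= xA (negPf xS) mul0r mul0r.
  rewrite mul1r -prodr_const [RHS]big_mkcond /=; apply: eq_bigr => i _.
  by case: ifP => // iA; rewrite (fintype.subsetP AS).
rewrite (bigD1 finset.set0) //= eqxx mul0r add0r.
rewrite (eq_bigr (fun A : {set V} => - ((A \subset S)%:R * (-1) ^+ #|A|))) => [|A ->]; last by rewrite /= mulrN.
rewrite sumrN.
have := h; rewrite (eq_bigr (fun A : {set V} => (A \subset S)%:R * (-1) ^+ #|A|)) => [|A _]; last exact: e.
rewrite (bigD1 (finset.set0 : {set V})) //= finset.sub0set cards0 expr0 mulr1 => h1.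
have -> : - \sum_(A : {set V} | A != finset.set0) (A \subset S)%:R * (-1) ^+ #|A| = 1 - \prod_i ((if i \in S then -1 else 0) + 1) :> R.
  by rewrite h1 opprD addrA subrr add0r.
case: (boolP (S == finset.set0)) => [/eqP ->|/set0Pn[x xS]].
  by rewrite big1 ?subrr // => i _; rewrite finset.in_set0 add0r.
by rewrite (bigD1 x) //= xS addNr mul0r subr0.
Qed.

Variable E : finType.
(* Transfers functions on a finite index type to naturals below any large bound, so
   that several index types can share one range. *)
Definition coded (G : E -> R) (k : nat) : R :=
  if insub k is Some i then G (enum_val (i : 'I_#|E|)) else 0.

Lemma coded_sum (G : E -> R) r : (#|E| <= r)%N -> \sum_(k < r) coded G k = \sum_e G e.
Proof.
move=> hr; have -> : \sum_e G e = \sum_(i < #|E|) G (enum_val i).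
  by rewrite -big_enum_val; exact: eq_bigl.
rewrite -(subnKC hr) big_split_ord /= [X in _ + X]big1 ?addr0 => [|i _]; last first.
  by rewrite /coded insubF // ltnNge leq_addr.
by apply: eq_bigr => i _; rewrite /coded (_ : insub _ = Some i) // (valK i).
Qed.

Lemma codedM (G H : E -> R) k : coded G k * coded H k = coded (fun e => G e * H e) k.
Proof. by rewrite /coded; case: insub => // ; rewrite mul0r. Qed.

Lemma coded_norm (G : E -> R) k : `|coded G k| = coded (fun e => `|G e|) k.
Proof. by rewrite /coded; case: insub => // ; rewrite normr0. Qed.

Lemma coded_bound (I : finType) (G : I -> E -> R) B : 0 <= B ->
  (forall e, \sum_i `|G i e| <= B) -> forall k, \sum_i `|coded (G i) k| <= B.
Proof.
move=> B0 h k; rewrite /coded; case: insub => [i|]; first exact: h.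
by rewrite big1 // => i _; rewrite normr0.
Qed.

End Kernel.

(** * Factorization of the distance kernel *)

Section Ozawa.
Variables (R : realType) (X : connected_graph) (D M : nat) (p : X).
Notation d := (@gdist X).
Notation Rd := (3 * D + 1)%N.
Hypothesis fourpt : forall x y z w,
  (d x z + d y w <= maxn (d x y + d z w) (d x w + d y z) + D)%N.
Hypothesis ballM : forall x, exists s : seq X, (size s <= M)%N /\
  forall y, (d x y <= 2 * Rd)%N -> y \in s.

(* The indicator of [S x m] meeting [S y n] is a scalar product of vectors
   indexed by the nonempty subsets, by inclusion-exclusion; the first component of
   the index records the distance to [p]. *)
Lemma ozawa_kernel (F : seq X) K : exists r0, exists al be : nat -> X -> nat -> R,
  forall r, (r0 <= r)%N -> forall x y, x \in F -> y \in F ->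
  [/\ forall m n, (m < K)%N -> (n < K)%N ->
        \sum_(e < r) al m x e * be n y e = (meet_level p x y m n)%:R,
      forall e, \sum_(m < K) `|al m x e| <= 2, forall e, \sum_(m < K) `|be m x e| <= 2,
      forall m, (m < K)%N -> \sum_(e < r) `|al m x e| <= 2 * 2 ^+ M
    & forall m, (m < K)%N -> \sum_(e < r) `|be m x e| <= 2 * 2 ^+ M].
Proof.
have lst (xk : X * nat) : exists s : seq X, (size s <= M)%N /\ forall w, near_geo D p xk.1 xk.2 w -> w \in s.
  case: (pselect (exists w, near_geo D p xk.1 xk.2 w)) => [[w0 h0]|h0].
    have [s [s1 s2]] := ballM w0; exists s; split => // w hw; apply: s2; exact: (near_geo_diam fourpt h0 hw).
  by exists [::]; split => // w hw; case: h0; exists w.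
have [ls hls] := choice lst.
pose Vs : seq X := flatten [seq ls (x, k) | x <- F, k <- iota 0 K].
have inV x k w : x \in F -> (k < K)%N -> near_geo D p x k w -> w \in Vs.
  move=> xF kK hw; apply/flattenP; exists (ls (x, k)); last by case: (hls (x, k)) => _; apply.
  by apply/allpairsP; exists (x, k); rewrite mem_iota.
pose V := seq_sub Vs.
pose SS x k : {set V} := [set v : V | near_geo D p x k (val v)]%SET.
have cSS x k : (#|SS x k| <= M)%N.
  have [s1 s2] := hls (x, k); apply: leq_trans s1; rewrite cardE -(size_map val).
  apply: uniq_leq_size; first by rewrite map_inj_uniq ?enum_uniq //; exact: val_inj.
  by move=> w /mapP[v]; rewrite mem_enum inE => hv ->; exact: s2.
have meet x y m n : x \in F -> (m < K)%N ->
   (d x p + n == d y p + m)%N || (d x p + n == d y p + m + 1)%N ->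
   ((SS x m :&: SS y n)%SET != finset.set0) = (d x y <= m + n)%N.
  move=> xF mK lev; apply/set0Pn/idP => [[v]|h].
    rewrite !inE => /andP[/andP[h1 _] /andP[h2 _]].
    by apply: leq_trans (gdist_tri x (val v) y) _; rewrite (gdist_sym (val v) y); exact: leq_add h1 h2.
  have [w w1 w2] := near_geo_meet fourpt h lev.
  by exists (SeqSub (inV _ _ _ xF mK w1)); rewrite !inE w1 w2.
(* Levels are shifted by K so that subtracting m < K is never truncated, and [Lm] exceeds every
   shifted level of a point of [F], including the extra one in [bE]. *)
pose Lm := (\sum_(x <- F) d x p + K + 2)%N.
pose E : finType := ('I_Lm * {set V})%type.
pose adm x m (A : {set V}) := (A != finset.set0) && (A \subset SS x m).
pose aE m x (e : E) : R := (e.1 == (d x p + K - m)%N :> nat)%:R * (adm x m e.2)%:R.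
(* Two levels on this side only: they are the two alternatives of [meet_level]. The signs of the
   inclusion-exclusion are also put on this side. *)
pose bE n y (e : E) : R := ((e.1 == (d y p + K - n)%N :> nat) || (e.1 == (d y p + K - n + 1)%N :> nat))%:R
   * ((adm y n e.2)%:R * - (-1) ^+ #|e.2|).
exists #|E|, (fun m x k => coded (aE m x) k), (fun m x k => coded (bE m x) k) => r hr x y xF yF.
have dF z : z \in F -> (d z p <= \sum_(x <- F) d x p)%N.
  by move=> zF; rewrite (big_rem z) //= leq_addr.
have nadm z m : \sum_(A : {set V}) (adm z m A)%:R <= 2 ^+ M :> R.
  apply: (@le_trans _ _ (\sum_(A : {set V}) (A \in finset.powerset (SS z m))%:R)).
    by apply: ler_sum => A _; rewrite /adm powersetE; case: (A \subset _); case: (_ != _); rewrite ?ler01.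
  rewrite -natr_sum -natrX ler_nat -big_mkcond /= sum1_card card_powerset leq_exp2l //.
have nlev (a : nat) : \sum_(l < Lm) (l == a :> nat)%:R <= 1 :> R.
  by apply: sum_at_most_one => i j /eqP hi /eqP hj; apply: val_inj => /=; rewrite hi hj.
have nlev2 (a b : nat) : \sum_(l < Lm) ((l == a :> nat) || (l == b :> nat))%:R <= 2 :> R.
  apply: le_trans (_ : 1 + 1 <= 2); last by [].
  apply: le_trans (lerD (nlev a) (nlev b)); rewrite -big_split; apply: ler_sum => l _ /=.
  by case: (_ == _); case: (_ == _); rewrite /= ?addr0 ?add0r ?lerDl ?ler01.
split.
- move=> m n mK nK; under eq_bigr do rewrite codedM.
  rewrite coded_sum // -(pair_bigA _ (fun l A => aE m x (l, A) * bE n y (l, A))) /=.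
  pose lev := (d x p + n == d y p + m)%N || (d x p + n == d y p + m + 1)%N.
  have hl : (d x p + K - m < Lm)%N by have := dF x xF; rewrite /Lm; lia.
  rewrite (bigD1 (Ordinal hl)) //= [X in _ + X]big1 ?addr0 => [|l hl']; last first.
    rewrite big1 // => A _; rewrite /aE /= (_ : (l == _ :> nat) = false) ?mul0r //.
    by apply/negbTE; apply: contra hl' => /eqP e; apply/eqP/val_inj.
  have elev : ((d x p + K - m)%N == (d y p + K - n)%N) || ((d x p + K - m)%N == (d y p + K - n + 1)%N) = lev.
    by rewrite /lev; apply/idP/idP; lia.
  rewrite (eq_bigr (fun A : {set V} => lev%:R * (((A != finset.set0) && (A \subset (SS x m :&: SS y n)%SET))%:R * - (-1) ^+ #|A|))); last first.
    move=> A _; rewrite /aE /bE /= eqxx elev mul1r mulrCA; congr (_ * _); rewrite mulrA; congr (_ * _).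
    by rewrite -natrM mulnb /adm finset.subsetI; case: (A != finset.set0).
  rewrite -mulr_sumr sum_subset_sign -natrM mulnb /meet_level -/lev.
  by case: (boolP lev) => //= hlev; rewrite meet.
- apply: coded_bound => // e; apply: (@le_trans _ _ (\sum_(m < K) ((e.1 == (d x p + K - m)%N :> nat))%:R)).
    apply: ler_sum => m _; rewrite /aE -natrM ger0_norm // ler_nat; case: (_ == _); case: (adm _ _ _) => //.
  apply: le_trans (_ : 1 <= 2); last by lra.
  apply: sum_at_most_one => i j /eqP hi /eqP hj; apply: val_inj => /=; have := ltn_ord i; have := ltn_ord j; lia.
- apply: coded_bound => // e; apply: (@le_trans _ _ (\sum_(m < K) ((e.1 == (d x p + K - m)%N :> nat)%:R + (e.1 == (d x p + K - m + 1)%N :> nat)%:R))).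
    apply: ler_sum => m _; rewrite /bE !normrM normrN normrX normrN1 expr1n mulr1 !ger0_norm //.
    by case: (_ == _); case: (_ == _); case: (adm _ _ _); rewrite /= ?mulr0 ?mulr1 ?mul0r ?addr0 ?add0r ?addr_ge0 ?lerDl ?ler01.
  rewrite big_split /=; apply: le_trans (_ : 1 + 1 <= 2); last by lra.
  apply: lerD; apply: sum_at_most_one => i j /eqP hi /eqP hj; apply: val_inj => /=; have := ltn_ord i; have := ltn_ord j; lia.
- move=> m mK; under eq_bigr do rewrite coded_norm.
  rewrite coded_sum // -(pair_bigA _ (fun l A => `|aE m x (l, A)|)) /=.
  rewrite (eq_bigr (fun l : 'I_Lm => (l == (d x p + K - m)%N :> nat)%:R * \sum_(A : {set V}) (adm x m A)%:R)); last first.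
    by move=> l _; rewrite mulr_sumr; apply: eq_bigr => A _; rewrite /aE -natrM ger0_norm.
  rewrite -mulr_suml; apply: ler_pM => //; try by apply: sumr_ge0.
  by apply: le_trans (nlev _) _; lra.
- move=> m mK; under eq_bigr do rewrite coded_norm.
  rewrite coded_sum // -(pair_bigA _ (fun l A => `|bE m x (l, A)|)) /=.
  rewrite (eq_bigr (fun l : 'I_Lm => ((l == (d x p + K - m)%N :> nat) || (l == (d x p + K - m + 1)%N :> nat))%:R * \sum_(A : {set V}) (adm x m A)%:R)); last first.
    move=> l _; rewrite mulr_sumr; apply: eq_bigr => A _.
    by rewrite /bE !normrM normrN normrX normrN1 expr1n mulr1 !ger0_norm.
  by rewrite -mulr_suml; apply: ler_pM => //; try by apply: sumr_ge0.
Qed.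

End Ozawa.

(** * The Schur test *)

Section SchurTest.
Variable R : realType.
Notation C := R[i].

(** Cauchy-Schwarz after splitting w into sqrt|w| and sign(w) sqrt|w|. *)
Lemma schur_test (I E : finType) (w : E -> I -> R) (a b : R) : 0 <= a ->
  (forall e, \sum_i `|w e i| <= a) -> (forall i, \sum_e `|w e i| <= b) ->
  forall u : I -> C, \sum_e nc (\sum_i (w e i)%:C * u i) ^+ 2 <= a * b * \sum_i nc (u i) ^+ 2.
Proof.
move=> a0 ha hb u.
have key e : nc (\sum_i (w e i)%:C * u i) ^+ 2 <= a * \sum_i `|w e i| * nc (u i) ^+ 2.
  pose s i := Num.sqrt `|w e i|.
  have ss i : s i ^+ 2 = `|w e i| by rewrite sqr_sqrtr.
  have s0 i : 0 <= s i by exact: sqrtr_ge0.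
  have := nc_dot_le (fun i => (s i)%:C) (fun i => (Num.sg (w e i) * s i)%:C * u i).
  have -> : \sum_i (s i)%:C * ((Num.sg (w e i) * s i)%:C * u i) = \sum_i (w e i)%:C * u i.
    apply: eq_bigr => i _; rewrite mulrA -rCM; congr (_%:C * _).
    by rewrite mulrCA -expr2 ss -numEsg.
  move/le_trans; apply; apply: ler_pM; try by apply: sumr_ge0 => i _; exact: sqr_ge0.
    by under eq_bigr do rewrite nc_real (real_normK (num_real _)) ss.
  apply: ler_sum => i _; rewrite Normc.normcM nc_real exprMn (real_normK (num_real _)) exprMn ss.
  rewrite ler_wpM2r ?sqr_ge0 // ler_piMl // sqr_sg.
  by case: (_ != _); rewrite ?lexx ?ler01.
apply: (@le_trans _ _ (\sum_e a * \sum_i `|w e i| * nc (u i) ^+ 2)); first by apply: ler_sum => e _; exact: key.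
rewrite -mulr_sumr -mulrA ler_wpM2l // exchange_big mulr_sumr /=; apply: ler_sum => i _.
by rewrite -mulr_suml ler_wpM2r ?sqr_ge0.
Qed.

Lemma exchange_big3 (A B E : Type) (sA : seq A) (sB : seq B) (sE : seq E) (F : A -> B -> E -> C) :
  \sum_(a <- sA) \sum_(b <- sB) \sum_(e <- sE) F a b e =
  \sum_(e <- sE) \sum_(a <- sA) \sum_(b <- sB) F a b e.
Proof.
by rewrite [RHS]exchange_big; apply: eq_bigr => a _; rewrite exchange_big.
Qed.

Lemma prod_weights (N K : nat) (w : 'I_N -> nat -> R) (c : R) :
  (forall i, \sum_(k < K) `|w i k| <= c) ->
  \sum_(a : {ffun 'I_N -> 'I_K}) `|\prod_i w i (a i)| <= c ^+ N.
Proof.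
move=> h.
rewrite (eq_bigr (fun a : {ffun 'I_N -> 'I_K} => \prod_i `|w i (a i)|)) => [|a _]; last exact: normr_prod.
rewrite -(bigA_distr_bigA (fun i (k : 'I_K) => `|w i k|)) -[X in _ <= c ^+ X](card_ord N) -prodr_const.
by apply: ler_prod => i _; rewrite h andbT sumr_ge0.
Qed.

End SchurTest.

(** * The generating polynomial of the distance kernel *)

Section KernelPoly.
Variables (R : realType) (X : connected_graph) (p : X).

(** A truncation of X^d / (1 - X) with d the distance of x and y. Each exponent has at most one
    admissible split, so the coefficients stay in [0, 1] even above K where some splits are lost;
    these are the hypotheses of [radial_approx]. *)
Definition meet_poly (x y : X) K : {poly R} :=
  \sum_(k < K) \sum_(l < K) (meet_level p x y k l)%:R *: 'X^(k + l).

Lemma meet_poly_coef x y K j : (meet_poly x y K)`_j =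
  \sum_(kl : 'I_K * 'I_K) (meet_level p x y kl.1 kl.2 && (kl.1 + kl.2 == j)%N)%:R.
Proof.
rewrite /meet_poly pair_bigA /= coef_sum; apply: eq_bigr => kl _.
by rewrite coefZ coefXn eq_sym -natrM mulnb.
Qed.

Lemma meet_poly_01 x y K j : 0 <= (meet_poly x y K)`_j <= 1.
Proof.
rewrite meet_poly_coef; apply/andP; split; first exact: sumr_ge0.
apply: sum_at_most_one => -[k l] [k' l'] /= /andP[h1 /eqP h2] /andP[h3 /eqP h4].
have e := meet_level_unique h1 h3 (etrans h2 (esym h4)).
by congr (_, _); apply: val_inj => //=; lia.
Qed.

Lemma meet_poly_lt x y K j : (j < K)%N -> (meet_poly x y K)`_j = (gdist x y <= j)%N%:R.
Proof.
move=> jK; have /andP[_ h1] := meet_poly_01 x y K j; move: h1; rewrite meet_poly_coef.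
case: (leqP (gdist x y) j) => h h1.
  have [k kj hk] := meet_level_exists p h.
  have kK : (k < K)%N by lia.
  have lK : (j - k < K)%N by lia.
  apply/eqP; rewrite eq_le h1 (bigD1 (Ordinal kK, Ordinal lK)) //= hk subnKC // eqxx.
  by rewrite lerDl sumr_ge0.
rewrite big1 // => -[k l] _ /=; case: eqP => [e|_]; last by rewrite andbF.
by rewrite /meet_level e leqNgt h !andbF.
Qed.

End KernelPoly.

(** * Trace class implies Schur multiplier *)

Section Sufficiency.
Variables (R : realType) (m : nat) (X : 'I_m.+1 -> connected_graph).
Notation C := R[i].
Notation PV := (product_vertex X).
Notation N := m.+1.

(** The order of quantifiers matters: [c0] depends on the graphs alone, whereas the vectors and
    their dimension r depend on the finite section. One r serves all coordinates, so their indices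
    form a single function type. *)
Lemma kernel_family : hyperbolic_family R X ->
  exists2 c0 : R, 1 <= c0 & exists p : forall i, X i,
  forall (F : seq PV) K, exists r (al be : forall i, nat -> X i -> nat -> R),
    forall x y : PV, x \in F -> y \in F -> forall i,
  [/\ forall k l, (k < K)%N -> (l < K)%N ->
        \sum_(e < r) al i k (x i) e * be i l (y i) e = (meet_level (p i) (x i) (y i) k l)%:R,
      forall e, \sum_(k < K) `|al i k (x i) e| <= 2, forall e, \sum_(k < K) `|be i k (x i) e| <= 2,
      forall k, (k < K)%N -> \sum_(e < r) `|al i k (x i) e| <= c0
    & forall k, (k < K)%N -> \sum_(e < r) `|be i k (x i) e| <= c0].
Proof.
move=> hX.
have hD i : exists D, forall x y z w : X i,
   (gdist x z + gdist y w <= maxn (gdist x y + gdist z w) (gdist x w + gdist y z) + D)%N.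
  by apply: (@hyperbolic_fourpt _ R); case: (hX i).
have [D {}hD] := choice hD.
have hM i : exists M, forall x : X i, exists s : seq (X i), (size s <= M)%N /\
  forall y, (gdist x y <= 2 * (3 * D i + 1))%N -> y \in s.
  by apply: ball_bound; case: (hX i).
have [M0 {}hM] := choice hM; pose M := \max_i M0 i.
have {}hM i (x : X i) : exists s : seq (X i), (size s <= M)%N /\
  forall y, (gdist x y <= 2 * (3 * D i + 1))%N -> y \in s.
  by have [s [s1 s2]] := hM i x; exists s; split => //; apply: leq_trans s1 (leq_bigmax i).
have hp i : exists x : X i, True by case: (vertex_inhabited (X i)) => x; exists x.
pose p i : X i := sval (cid (hp i)).
exists (2 * 2 ^+ M).
  by rewrite -natrX -natrM ler1n muln_gt0 /= expn_gt0.
exists p => F K.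
pose Q i (q : nat * (nat -> X i -> nat -> R) * (nat -> X i -> nat -> R)) :=
  forall r, (q.1.1 <= r)%N -> forall x y, x \in (map (fun z : PV => z i) F) -> y \in (map (fun z : PV => z i) F) ->
  [/\ forall k l, (k < K)%N -> (l < K)%N ->
        \sum_(e < r) q.1.2 k x e * q.2 l y e = (meet_level (p i) x y k l)%:R,
      forall e, \sum_(k < K) `|q.1.2 k x e| <= 2, forall e, \sum_(k < K) `|q.2 k x e| <= 2,
      forall k, (k < K)%N -> \sum_(e < r) `|q.1.2 k x e| <= 2 * 2 ^+ M
    & forall k, (k < K)%N -> \sum_(e < r) `|q.2 k x e| <= 2 * 2 ^+ M].
have hQ i : exists q, Q i q.
  have [r0 [al [be h]]] := @ozawa_kernel R (X i) (D i) M (p i) (hD i) (hM i) (map (fun z : PV => z i) F) K.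
  by exists (r0, al, be).
pose q i := sval (cid (hQ i)); have qP i : Q i (q i) := svalP (cid (hQ i)).
exists (\max_i (q i).1.1), (fun i => (q i).1.2), (fun i => (q i).2) => x y xF yF i.
by apply: (qP i); [exact: leq_bigmax|apply/mapP; exists x|apply/mapP; exists y].
Qed.

Notation MK K := {ffun 'I_N -> 'I_K}.

Lemma sufficiency : hyperbolic_family R X -> exists2 A : R, 0 < A &
  forall (phi : nat -> C) (T : bounded_operator R nat) (c : C),
    has_matrix T (gen_hankel N phi) -> trace_class T -> tends_to phi c ->
    forall S : bounded_operator R PV,
    form_bound (schur_product (@radial_symbol R phi N X) S) ((A * fine (trace_norm T) + nc c) * opnorm S).
Proof.
move=> hX; have [c0 c01 [p hker]] := kernel_family hX.
have c00 : 0 <= c0 by lra.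
pose cc := (2 ^+ N * c0 ^+ N : R).
have cc0 : 0 < cc by rewrite mulr_gt0 ?exprn_gt0 //; lra.
(* The 2 is the one on the left of [form_bound], which the trace bound in [main] does not
   contain. *)
exists (2 * cc); first by rewrite mulr_gt0.
move=> phi T c hT tT hc S F G f g.
set tau := opnorm S; set t := fine (trace_norm T).
have tau0 : 0 <= tau := opnorm_ge0 S.
have hS := form_of_op tau0 (opnormP S).
have [B hB] := hankel_sum hT tT.
pose P := \sum_(y <- G) nc (f y) ^+ 2; pose Q := \sum_(x <- F) nc (g x) ^+ 2.
rewrite -/P -/Q.
have P0 : 0 <= P by apply: sumr_ge0 => y _; exact: sqr_ge0.
have Q0 : 0 <= Q by apply: sumr_ge0 => y _; exact: sqr_ge0.
pose s x y := mxcoef S x y * f y * g x.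
pose h := iter N (@discrete_derivative R) phi.
pose Ph x y K := \prod_i meet_poly R (p i) (x i) (y i) K.
have main K : nc (\sum_(x <- F) \sum_(y <- G) s x y * poly_pair h (Ph x y K)) <= tau * cc * (P + Q) * t.
  have [r [al [be hk]]] := hker (F ++ G : seq PV) K.
  have inF (x : PV) : x \in F -> x \in (F ++ G : seq PV) by rewrite mem_cat => ->.
  have inG (y : PV) : y \in G -> y \in (F ++ G : seq PV) by rewrite mem_cat orbC => ->.
  pose A (x : PV) (e : MK r) (a : MK K) := \prod_i al i (a i) (x i) (e i).
  pose Bt (x : PV) (e : MK r) (a : MK K) := \prod_i be i (a i) (x i) (e i).
  pose kr (x y : PV) (a b : MK K) : R := \prod_i (meet_level (p i) (x i) (y i) (a i) (b i))%:R.
  have krE x y a b : x \in F -> y \in G -> kr x y a b = \sum_e A x e a * Bt y e b.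
    move=> xF yG; rewrite /kr /A /Bt.
    under [RHS]eq_bigr do rewrite -big_split.
    rewrite -(bigA_distr_bigA (fun i (e : 'I_r) => al i (a i) (x i) e * be i (b i) (y i) e)) /=.
    by apply: eq_bigr => i _; have [-> //] := hk x y (inF _ xF) (inG _ yG) i.
  have testA x (u : MK K -> C) : x \in F -> \sum_e nc (\sum_a (A x e a)%:C * u a) ^+ 2 <= cc * \sum_a nc (u a) ^+ 2.
    move=> xF; have hx i := hk x x (inF _ xF) (inF _ xF) i.
    apply: schur_test => [|e|a]; first by rewrite exprn_ge0.
      by apply: (prod_weights (w := fun i k => al i k (x i) (e i))) => i; have [_ h1 _ _ _] := hx i.
    by apply: (prod_weights (w := fun i e => al i (a i) (x i) e)) => i; have [_ _ _ h1 _] := hx i; exact: h1.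
  have testB y (u : MK K -> C) : y \in G -> \sum_e nc (\sum_a (Bt y e a)%:C * u a) ^+ 2 <= cc * \sum_a nc (u a) ^+ 2.
    move=> yG; have hy i := hk y y (inG _ yG) (inG _ yG) i.
    apply: schur_test => [|e|a]; first by rewrite exprn_ge0.
      by apply: (prod_weights (w := fun i k => be i k (y i) (e i))) => i; have [_ _ h1 _ _] := hy i.
    by apply: (prod_weights (w := fun i e => be i (a i) (y i) e)) => i; have [_ _ _ _ h1] := hy i; exact: h1.
  (* Summing out the vertices first leaves a kernel on multi-indices paired with h. Its norm is
     bounded by moving the factors of [kr] onto f and g, applying the bound of S for each e, and
     summing over e by the Schur test. *)
  pose gm (a b : MK K) : C := \sum_(x <- F) \sum_(y <- G) (kr x y a b)%:C * s x y.
  have hgm : fin_bound gm (tau * cc * (P + Q)).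
    move=> u v; set U := \sum_j nc (u j) ^+ 2; set W := \sum_i nc (v i) ^+ 2.
    have U0 : 0 <= U by apply: sumr_ge0 => y _; exact: sqr_ge0.
    have W0 : 0 <= W by apply: sumr_ge0 => y _; exact: sqr_ge0.
    pose fu e y := f y * \sum_b (Bt y e b)%:C * u b.
    pose gv e x := g x * \sum_a (A x e a)%:C * v a.
    have -> : \sum_a \sum_b gm a b * u b * v a =
        \sum_e \sum_(x <- F) \sum_(y <- G) mxcoef S x y * fu e y * gv e x.
      transitivity (\sum_a \sum_b \sum_(x <- F) \sum_(y <- G) \sum_e
          (A x e a)%:C * (Bt y e b)%:C * s x y * u b * v a).
        apply: eq_bigr => a _; apply: eq_bigr => b _; rewrite /gm !mulr_suml.
        apply: eq_big_seq => x xF; rewrite !mulr_suml; apply: eq_big_seq => y yG.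
        rewrite krE // rC_sum !mulr_suml; apply: eq_bigr => e _; by rewrite rCM.
      rewrite exchange_big3 -[RHS]exchange_big3; apply: eq_bigr => x _.
      rewrite exchange_big3; apply: eq_bigr => y _.
      rewrite exchange_big3; apply: eq_bigr => e _.
      transitivity (s x y * ((\sum_a (A x e a)%:C * v a) * (\sum_b (Bt y e b)%:C * u b))); last by rewrite /fu /gv /s; ring.
      rewrite big_distrlr /= mulr_sumr; apply: eq_bigr => a _; rewrite mulr_sumr; apply: eq_bigr => b _; ring.
    apply: (@le_trans _ _ (\sum_e tau * (\sum_(y <- G) nc (fu e y) ^+ 2 + \sum_(x <- F) nc (gv e x) ^+ 2))).
      apply: (@le_trans _ _ (2 * \sum_e nc (\sum_(x <- F) \sum_(y <- G) mxcoef S x y * fu e y * gv e x))).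
        by rewrite ler_wpM2l // nc_sum.
      by rewrite mulr_sumr; apply: ler_sum => e _; exact: hS.
    have -> : tau * cc * (P + Q) * (U + W) = tau * (cc * ((P + Q) * (U + W))) by ring.
    rewrite -mulr_sumr big_split ler_wpM2l //=.
    have h1 : \sum_e \sum_(y <- G) nc (fu e y) ^+ 2 <= cc * (P * U).
      have -> : cc * (P * U) = \sum_(y <- G) nc (f y) ^+ 2 * (cc * U) by rewrite -mulr_suml -/P mulrCA.
      rewrite exchange_big big_seq [X in _ <= X]big_seq; apply: ler_sum => y yG.
      have -> : \sum_e nc (fu e y) ^+ 2 = nc (f y) ^+ 2 * \sum_e nc (\sum_b (Bt y e b)%:C * u b) ^+ 2.
        by rewrite mulr_sumr; apply: eq_bigr => e _; rewrite Normc.normcM exprMn.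
      by rewrite ler_wpM2l ?sqr_ge0 //; exact: testB.
    have h2 : \sum_e \sum_(x <- F) nc (gv e x) ^+ 2 <= cc * (Q * W).
      have -> : cc * (Q * W) = \sum_(x <- F) nc (g x) ^+ 2 * (cc * W) by rewrite -mulr_suml -/Q mulrCA.
      rewrite exchange_big big_seq [X in _ <= X]big_seq; apply: ler_sum => y yG.
      have -> : \sum_e nc (gv e y) ^+ 2 = nc (g y) ^+ 2 * \sum_e nc (\sum_b (A y e b)%:C * v b) ^+ 2.
        by rewrite mulr_sumr; apply: eq_bigr => e _; rewrite Normc.normcM exprMn.
      by rewrite ler_wpM2l ?sqr_ge0 //; exact: testA.
    apply: le_trans (lerD h1 h2) _; rewrite -mulrDr ler_wpM2l ?(ltW cc0) //.
    have := mulr_ge0 P0 W0; have := mulr_ge0 Q0 U0; rewrite mulrDl !mulrDr; lra.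
  have g0 : 0 <= tau * cc * (P + Q) by exact: (mulr_ge0 (mulr_ge0 tau0 (ltW cc0)) (addr_ge0 P0 Q0)).
  have := trace_multi_le g0 hgm hT tT; congr (nc _ <= _).
  transitivity (\sum_a \sum_b \sum_(x <- F) \sum_(y <- G) s x y * ((kr x y a b)%:C * h (isum a + isum b)%N)).
    apply: eq_bigr => a _; apply: eq_bigr => b _; rewrite /gm !mulr_suml.
    apply: eq_bigr => x _; rewrite !mulr_suml; apply: eq_bigr => y _; by rewrite mulrAC mulrC.
  rewrite exchange_big3; apply: eq_bigr => x _; rewrite exchange_big3; apply: eq_bigr => y _.
  transitivity (s x y * \sum_a \sum_b (kr x y a b)%:C * h (isum a + isum b)%N).
    by rewrite mulr_sumr; apply: eq_bigr => a _; rewrite mulr_sumr.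
  congr (_ * _).
  have -> : Ph x y K = \sum_(a : MK K) \sum_(b : MK K) kr x y a b *: 'X^(isum a + isum b).
    rewrite /Ph /meet_poly bigA_distr_bigA; apply: eq_bigr => a _.
    rewrite bigA_distr_bigA; apply: eq_bigr => b _.
    by rewrite scaler_prod prodrXr /isum big_split.
  rewrite poly_pair_sum; apply: eq_bigr => a _; rewrite poly_pair_sum; apply: eq_bigr => b _.
  by rewrite poly_pairZ poly_pairXn.
apply/ler_addgt0Pr => e e0.
pose Wt := \sum_(x <- F) \sum_(y <- G) nc (s x y).
have Wt0 : 0 <= Wt by apply: sumr_ge0 => x _; apply: sumr_ge0 => y _; exact: nc_ge0.
have e1 : 0 < e / (2 * (Wt + 1)) by rewrite divr_gt0 //; lra.
set e' := e / (2 * (Wt + 1)) in e1.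
have approx (xy : PV * PV) := radial_approx (fun i => gdist (xy.1 i) (xy.2 i)) hc hB e1.
have [K0 hK0] := choice approx.
pose K := (\sum_(x <- F) \sum_(y <- G) K0 (x, y))%N.
have hK x y : x \in F -> y \in G -> nc (poly_pair h (Ph x y K) - (phi (product_dist x y) - c)) <= e'.
  move=> xF yG; apply: (hK0 (x, y) K).
  - by rewrite /K (big_rem x) //= (big_rem y) //= -addnA leq_addr.
  - by move=> i j; exact: meet_poly_01.
  - by move=> i j jK; exact: meet_poly_lt.
have -> : \sum_(x <- F) \sum_(y <- G) schur_product (@radial_symbol R phi N X) S x y * f y * g x =
   \sum_(x <- F) \sum_(y <- G) s x y * poly_pair h (Ph x y K) +
   (\sum_(x <- F) \sum_(y <- G) s x y * (phi (product_dist x y) - c - poly_pair h (Ph x y K)) +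
    c * \sum_(x <- F) \sum_(y <- G) s x y).
  rewrite mulr_sumr -!big_split; apply: eq_bigr => x _ /=.
  rewrite mulr_sumr -!big_split; apply: eq_bigr => y _ /=.
  by rewrite /schur_product /radial_symbol /s; ring.
have r1 := main K.
have r2 : nc (\sum_(x <- F) \sum_(y <- G) s x y * (phi (product_dist x y) - c - poly_pair h (Ph x y K))) <= Wt * e'.
  apply: le_trans (nc_sum _ _ _) _; rewrite /Wt mulr_suml big_seq [X in _ <= X]big_seq; apply: ler_sum => x xF.
  apply: le_trans (nc_sum _ _ _) _; rewrite mulr_suml big_seq [X in _ <= X]big_seq; apply: ler_sum => y yG.
  by rewrite Normc.normcM ler_wpM2l ?nc_ge0 // nc_distC; exact: hK.
have r3 : 2 * nc (\sum_(x <- F) \sum_(y <- G) s x y) <= tau * (P + Q) := hS F G f g.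
have r4 : 2 * (Wt * e') <= e.
  rewrite /e' mulrA mulrA ler_pdivrMr ?mulrA //; last lra.
  have := mulr_ge0 (ltW e0) Wt0; lra.
apply: le_trans (ler_wpM2l (ler0n R 2) (le_normcD _ _)) _.
apply: le_trans (ler_wpM2l (ler0n R 2) (lerD r1 (le_normcD _ _))) _.
rewrite Normc.normcM.
have r5 := ler_wpM2l (nc_ge0 c) r3.
have -> : (2 * cc * t + nc c) * tau * (P + Q) + e = 2 * (tau * cc * (P + Q) * t) + (nc c * (tau * (P + Q)) + e) by ring.
rewrite mulrDr lerD2l mulrDr [leRHS]addrC; apply: lerD; last by rewrite mulrCA.
by apply: le_trans r4; rewrite ler_wpM2l.
Qed.

End Sufficiency.

(** * The tree of triangles *)

Section TriangleTree.
Notation word := (seq (bool * bool)).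
Implicit Types x y z w : word.

(* In (t, c) the bit t selects a triangle at the current vertex and c one of its
   two other vertices.  lcp2 x y is twice the length of the common prefix, plus 1
   if the words then continue in the same triangle. *)
Fixpoint lcp2 x y : nat :=
  match x, y with
  | b :: x', b' :: y' =>
      if b.1 == b'.1 then (if b.2 == b'.2 then (lcp2 x' y').+2 else 1%N) else 0%N
  | _, _ => 0%N
  end.

(** The length of a word is its distance to the empty word, so [lcp2] is twice the Gromov product
    based there; an odd value means that the geodesic crosses a triangle along one edge. *)
Definition tree_dist x y := (size x + size y - lcp2 x y)%N.

Lemma lcp2C x y : lcp2 x y = lcp2 y x.
Proof. by elim: x y => [|b x ih] [|b' y] //=; rewrite (eq_sym b.1) (eq_sym b.2) ih. Qed.

Lemma lcp2_leq x y : (lcp2 x y <= 2 * size x)%N.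
Proof.
by elim: x y => [|b x ih] [|b' y] //=; case: eqP => //; case: eqP => // _ _; have := ih y; lia.
Qed.

Lemma lcp2_leqr x y : (lcp2 x y <= 2 * size y)%N.
Proof. by rewrite lcp2C lcp2_leq. Qed.

Lemma lcp2xx x : lcp2 x x = (2 * size x)%N.
Proof. by elim: x => //= b x ->; rewrite !eqxx mulnS. Qed.

Lemma lcp2_ultra x y z : (minn (lcp2 x y) (lcp2 y z) <= lcp2 x z)%N.
Proof.
elim: x y z => [|b x ih] [|b' y] [|b'' z] //=; rewrite ?minn0 ?min0n //.
have := ih y z; case: b b' b'' => [[] []] [[] []] [[] []] /=; lia.
Qed.

Lemma lcp2_cat x u : lcp2 x (x ++ u) = (2 * size x)%N.
Proof. by elim: x => //= b x ->; rewrite !eqxx mulnS. Qed.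

Lemma lcp2_take k x y : (2 * k <= lcp2 x y)%N -> take k x = take k y.
Proof.
elim: k x y => [|k ih] [|b x] [|b' y] //=; rewrite ?mulnS //.
by case: eqP => // e1; case: eqP => // e2 h; rewrite (ih x y) //; congr (_ :: _); case: b b' e1 e2 => ? ? [? ?] /= -> ->.
Qed.

Lemma tree_distC x y : tree_dist x y = tree_dist y x.
Proof. by rewrite /tree_dist lcp2C addnC. Qed.

Lemma tree_distxx x : tree_dist x x = 0%N.
Proof. by rewrite /tree_dist lcp2xx; lia. Qed.

Lemma tree_dist_eq0 x y : tree_dist x y = 0%N -> x = y.
Proof.
move=> h; have := lcp2_leq x y; have := lcp2_leqr x y; move: h; rewrite /tree_dist => h h1 h2.
have hs : size x = size y by lia.
have : take (size x) x = take (size x) y by apply: lcp2_take; lia.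
by rewrite take_size hs take_size.
Qed.

Lemma tree_dist_tri x y z : (tree_dist x z <= tree_dist x y + tree_dist y z)%N.
Proof.
have := lcp2_ultra x y z; have := lcp2_leq x y; have := lcp2_leqr x y.
have := lcp2_leq y z; have := lcp2_leqr y z; have := lcp2_leq x z; have := lcp2_leqr x z.
by rewrite /tree_dist; lia.
Qed.

(** The lengths cancel, and what remains is an inequality between sums of two values of [lcp2],
    which follows from four instances of the ultrametric inequality. *)
Lemma tree_dist_fourpt x y z w : (tree_dist x z + tree_dist y w <= maxn (tree_dist x y + tree_dist z w) (tree_dist x w + tree_dist y z))%N.
Proof.
have key a b c d e f : (minn a d <= b -> minn c f <= b -> minn a c <= e -> minn d f <= e -> minn (a + f) (c + d) <= b + e)%N.
  by rewrite !geq_min => /orP[] ? /orP[] ? /orP[] ? /orP[] ?; lia.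
have u2 := lcp2_ultra x w z; have u3 := lcp2_ultra y x w.
rewrite (lcp2C w z) in u2; rewrite (lcp2C y x) in u3.
have := key _ _ _ _ _ _ (lcp2_ultra x y z) u2 u3 (lcp2_ultra y z w).
have b1 := lcp2_leq x y; have b2 := lcp2_leqr x y.
have b5 := lcp2_leq x w; have b6 := lcp2_leqr x w; have b7 := lcp2_leq y z; have b8 := lcp2_leqr y z.
have b11 := lcp2_leq z w; have b12 := lcp2_leqr z w.
have b3 := lcp2_leq x z; have b4 := lcp2_leqr x z.
have b9 := lcp2_leq y w; have b10 := lcp2_leqr y w.
rewrite /tree_dist leq_max geq_min => /orP[] h; apply/orP; [left|right]; lia.
Qed.

Lemma tree_dist_cons b x y : tree_dist (b :: x) (b :: y) = tree_dist x y.
Proof. by rewrite /tree_dist /= !eqxx; lia. Qed.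

Lemma tree_dist_belast b x : tree_dist (b :: x) (take (size x) (b :: x)) = 1%N.
Proof.
have h := lcp2_cat (take (size x) (b :: x)) (drop (size x) (b :: x)).
rewrite cat_take_drop in h; rewrite /tree_dist lcp2C h size_take /= ltnS leqnn; lia.
Qed.

(** After the common prefix, the first step of a geodesic descends when x is exhausted, crosses to
    the sibling when one letter of x is left in the triangle of y, and otherwise deletes the last
    letter of x. *)
Lemma tree_dist_step x y n : tree_dist x y = n.+1 -> exists2 z, tree_dist x z = 1%N & tree_dist z y = n.
Proof.
elim: x y => [|b x ih] [|b' y] //=.
- by move=> [h]; exists [:: b'] => //; rewrite tree_dist_cons /tree_dist /= subn0 add0n -h.
- move=> h; exists (take (size x) (b :: x)); first exact: tree_dist_belast.
  by move: h; rewrite /tree_dist /= lcp2C /= size_take /= ltnS leqnn; lia.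
have [<-|bb] := eqVneq b b'.
  rewrite tree_dist_cons => /ih[z z1 z2]; exists (b :: z); by rewrite tree_dist_cons.
have lE u v : lcp2 (b :: u) (b' :: v) = if b.1 == b'.1 then 1%N else 0%N.
  rewrite /=; case: eqP => // t; case: eqP => // c.
  by case/eqP: bb; case: (b) (b') t c => ? ? [? ?] /= -> ->.
case: x ih => [|e x] ih.
  move=> h; move: h; rewrite {1}/tree_dist lE [size _]/= => h; have [t|t] := boolP (b.1 == b'.1).
    exists [:: b']; first by rewrite /tree_dist lE t.
    by move: h; rewrite t tree_dist_cons /tree_dist /=; lia.
  by exists [::] => //; move: h; rewrite (negPf t) /tree_dist /=; lia.
move=> h; exists (b :: take (size x) (e :: x)); first by rewrite tree_dist_cons tree_dist_belast.
move: h; rewrite /tree_dist !lE /= size_take /= ltnS leqnn; case: ifP => _; lia.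
Qed.

Definition tree_edge : rel word := fun x y => tree_dist x y == 1%N.

Lemma tree_sym : symmetric tree_edge.
Proof. by move=> x y; rewrite /tree_edge tree_distC. Qed.

Lemma tree_irr : irreflexive tree_edge.
Proof. by move=> x; rewrite /tree_edge tree_distxx. Qed.

Lemma tree_walk x y : exists p, [/\ path tree_edge x p, last x p = y & size p = tree_dist x y].
Proof.
move e : (tree_dist x y) => n; elim: n x e => [|n ih] x e.
  by exists [::]; rewrite /= (tree_dist_eq0 e).
have [z z1 /ih[p [p1 p2 p3]]] := tree_dist_step e.
by exists (z :: p); rewrite /= p1 p2 p3 /tree_edge z1.
Qed.

Lemma tree_connected x y : exists2 p, path tree_edge x p & last x p = y.
Proof. by have [p [p1 p2 _]] := tree_walk x y; exists p. Qed.

Definition triangle_tree : connected_graph :=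
  ConnectedGraph tree_sym tree_irr (inhabits ([::] : word)) tree_connected.

Lemma tree_gdist (x y : triangle_tree) : gdist x y = tree_dist x y.
Proof.
apply/eqP; rewrite eqn_leq; apply/andP; split.
  have [p [p1 p2 <-]] := tree_walk x y; rewrite -{1}p2; exact: (@gdist_min triangle_tree).
have [p [p1 <- <-]] := gdist_walk x y.
elim: p x p1 => [|z p ih] x /=; first by rewrite tree_distxx.
move=> /andP[xz zp]; apply: leq_trans (tree_dist_tri x z _) _; rewrite (eqP (xz : tree_edge x z)) add1n ltnS.
exact: ih.
Qed.

Lemma tree_hyperbolic (R : realType) : hyperbolic triangle_tree R.
Proof.
exists 0 => x y z w; rewrite subr0 /gromov_product !tree_gdist.
have h := tree_dist_fourpt x y z w.
have [h1|h1] : (tree_dist x z + tree_dist y w <= tree_dist x y + tree_dist z w)%N \/ (tree_dist x z + tree_dist y w <= tree_dist x w + tree_dist y z)%N by lia.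
  move: h1; rewrite -(ler_nat R) !natrD => h1.
  by rewrite ge_min; apply/orP; left; lra.
move: h1; rewrite -(ler_nat R) !natrD => h1.
by rewrite ge_min; apply/orP; right; lra.
Qed.

(** A neighbour of x agrees with it up to the last letter of x, and has at most two letters after
    that prefix. *)
Lemma tree_bounded : bounded_degree triangle_tree.
Proof.
exists #|{bseq 2 of bool * bool}| => x.
pose f (s : {bseq 2 of bool * bool}) : triangle_tree := take (size x).-1 x ++ val s.
apply: (@card_le_trans _ _ _ (f @` [set: {bseq 2 of bool * bool}])).
  apply: subset_card_le => y /eqP h.
  have h1 := lcp2_leq x y; have h2 := lcp2_leqr x y; rewrite /tree_dist in h.
  have h3 : (2 * (size x).-1 <= lcp2 x y)%N by move: h h1 h2; set a := size x; set b := size y; set l := lcp2 x y; lia.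
  have sz : (size (drop (size x).-1 y) <= 2)%N.
    by rewrite size_drop; move: h h1 h2; set a := size x; set b := size y; set l := lcp2 x y; lia.
  exists (Bseq sz) => //=; rewrite /f /= (lcp2_take h3) cat_take_drop //.
apply: card_le_trans (card_image_le _ _) _.
pose g (s : {bseq 2 of bool * bool}) : nat := enum_rank s.
have gi : {in [set: {bseq 2 of bool * bool}] &, injective g} by move=> s t _ _ /ord_inj/enum_rank_inj.
rewrite -(card_le_eql (inj_card_eq gi)).
by apply: subset_card_le => _ [s _ <-]; exact: ltn_ord.
Qed.

End TriangleTree.

(** * Bessel's inequality *)

Section Bessel.
Variables (R : realType) (J Z : finType) (E : J -> Z -> R).
Hypotheses (orth : forall j k, j != k -> \sum_z E j z * E k z = 0)
  (unit : forall j, \sum_z E j z ^+ 2 <= 1).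

(** The norms are only bounded by 1 because the tree vectors are shorter at index 0 and vanish when
    their support leaves the ball. *)
Lemma bessel_real (u : Z -> R) : \sum_j (\sum_z E j z * u z) ^+ 2 <= \sum_z u z ^+ 2.
Proof.
pose c j := \sum_z E j z * u z; pose w z := \sum_j c j * E j z.
have cw : \sum_z w z * u z = \sum_j c j ^+ 2.
  under eq_bigr => z _ do rewrite /w mulr_suml.
  rewrite exchange_big; apply: eq_bigr => j _ /=.
  by rewrite expr2 {2}/c mulr_sumr; apply: eq_bigr => z _; rewrite mulrA.
have ww : \sum_z w z ^+ 2 <= \sum_j c j ^+ 2.
  have -> : \sum_z w z ^+ 2 = \sum_j c j ^+ 2 * \sum_z E j z ^+ 2.
    transitivity (\sum_j \sum_k \sum_z (c j * c k) * (E j z * E k z)).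
      under eq_bigr => z _ do rewrite expr2 /w mulr_suml.
      rewrite exchange_big; apply: eq_bigr => j _ /=.
      under eq_bigr => z _ do rewrite mulr_sumr.
      by rewrite exchange_big; do 2 apply: eq_bigr => ? _; rewrite mulrACA.
    apply: eq_bigr => j _; rewrite (bigD1 j) //= [X in _ + X]big1 ?addr0 => [|k kj].
      by rewrite -mulr_sumr -expr2; congr (_ * _); apply: eq_bigr => z _; rewrite expr2.
    by rewrite -mulr_sumr orth ?mulr0 // eq_sym.
  by apply: ler_sum => j _; rewrite ler_piMr ?sqr_ge0.
have : 0 <= \sum_z (u z - w z) ^+ 2 by apply: sumr_ge0 => z _; exact: sqr_ge0.
have -> : \sum_z (u z - w z) ^+ 2 = \sum_z u z ^+ 2 - 2 * \sum_z w z * u z + \sum_z w z ^+ 2.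
  by rewrite mulr_sumr -sumrB -big_split; apply: eq_bigr => z _ /=; ring.
rewrite cw -/(\sum_j c j ^+ 2); lra.
Qed.

Lemma bessel (u : Z -> R[i]) :
  \sum_j nc (\sum_z (E j z)%:C * u z) ^+ 2 <= \sum_z nc (u z) ^+ 2.
Proof.
under eq_bigr => j _ do rewrite nc_sqr cRe_sum cIm_sum.
under [leRHS]eq_bigr => z _ do rewrite nc_sqr.
rewrite !big_split /=; apply: lerD.
  apply: le_trans (bessel_real _); apply: eq_leW.
  by apply: eq_bigr => j _; congr (_ ^+ 2); apply: eq_bigr => z _; rewrite cReZ.
apply: le_trans (bessel_real _); apply: eq_leW.
apply: eq_bigr => j _; congr (_ ^+ 2); apply: eq_bigr => z _.
by rewrite cImM cReC cImC mul0r addr0.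
Qed.

End Bessel.

(** * Tensor products of orthogonal families *)

Section ProductVectors.
Variables (R : realType) (I Kp L Z : finType) (a : Kp -> L -> Z -> R).
Hypotheses (orth : forall k i k' i', (k, i) != (k', i') -> \sum_z a k i z * a k' i' z = 0)
  (unit : forall k i, \sum_z a k i z ^+ 2 <= 1).

Definition tensor_vec (k : {ffun I -> Kp}) (p : {ffun I -> L}) (z : {ffun I -> Z}) : R :=
  \prod_s a (k s) (p s) (z s).

Lemma tensor_bessel (u : {ffun I -> Z} -> R[i]) :
  \sum_k \sum_p nc (\sum_z (tensor_vec k p z)%:C * u z) ^+ 2 <= \sum_z nc (u z) ^+ 2.
Proof.
rewrite pair_big /=; apply: (bessel (E := fun kp z => tensor_vec kp.1 kp.2 z)) => [[k p] [k' p'] /= ne|[k p] /=].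
  under eq_bigr => z _ do rewrite /tensor_vec -big_split /=.
  rewrite -(bigA_distr_bigA (fun s z => a (k s) (p s) z * a (k' s) (p' s) z)).
  have [s hs] : exists s, (k s, p s) != (k' s, p' s).
    apply/existsP; apply: contraNT ne; rewrite negb_exists => /forallP e.
    by apply/eqP; congr (_, _); apply/ffunP => s; have := e s; rewrite negbK => /eqP[].
  by rewrite (bigD1 s) //= orth ?mul0r.
under eq_bigr => z _ do rewrite /tensor_vec -prodrXl.
rewrite -(bigA_distr_bigA (fun s z => a (k s) (p s) z ^+ 2)).
by apply: prodr_ile1 => s _; rewrite unit andbT; apply: sumr_ge0 => z _; exact: sqr_ge0.
Qed.

End ProductVectors.

(** * Transport of a multi-index kernel *)

Section TensorKernel.
Variables (R : realType) (N K : nat) (Kp Z : finType).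
Notation C := R[i].
Notation I := 'I_N.
Notation M := {ffun I -> 'I_K}.
Notation dd := (@discrete_derivative R).
Variables (a b : Kp -> 'I_K -> Z -> R) (gm : M -> M -> C).

Definition tensor_kernel (z x : {ffun I -> Z}) : C :=
  \sum_p \sum_q gm p q * \sum_k (tensor_vec a k p z)%:C * (tensor_vec b k q x)%:C.

Section Bound.
Hypotheses (orta : forall k i k' i', (k, i) != (k', i') -> \sum_z a k i z * a k' i' z = 0)
  (unita : forall k i, \sum_z a k i z ^+ 2 <= 1)
  (ortb : forall k i k' i', (k, i) != (k', i') -> \sum_z b k i z * b k' i' z = 0)
  (unitb : forall k i, \sum_z b k i z ^+ 2 <= 1).

(** Each k carries a copy of gm. Since the vectors are orthogonal in k as well as in the
    multi-index, Bessel adds all copies without loss. *)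
Lemma tensor_kernel_bound g : 0 <= g -> fin_bound gm g -> fin_bound tensor_kernel g.
Proof.
move=> g0 hg u v.
pose A k p := \sum_z (tensor_vec a k p z)%:C * v z.
pose B k q := \sum_x (tensor_vec b k q x)%:C * u x.
have -> : \sum_z \sum_x tensor_kernel z x * u x * v z =
    \sum_k \sum_p \sum_q gm p q * B k q * A k p.
  transitivity (\sum_z \sum_x \sum_p \sum_q \sum_k
      gm p q * ((tensor_vec b k q x)%:C * u x) * ((tensor_vec a k p z)%:C * v z)).
    apply: eq_bigr => z _; apply: eq_bigr => x _; rewrite !mulr_suml.
    apply: eq_bigr => p _; rewrite !mulr_suml; apply: eq_bigr => q _.
    rewrite mulr_sumr !mulr_suml; apply: eq_bigr => k _; ring.
  transitivity (\sum_k \sum_p \sum_q \sum_z \sum_x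
      gm p q * ((tensor_vec b k q x)%:C * u x) * ((tensor_vec a k p z)%:C * v z)).
    under eq_bigr => z _ do rewrite exchange_big.
    rewrite exchange_big [RHS]exchange_big; apply: eq_bigr => p _ /=.
    under eq_bigr => z _ do rewrite exchange_big.
    rewrite exchange_big [RHS]exchange_big; apply: eq_bigr => q _ /=.
    under eq_bigr => z _ do rewrite exchange_big.
    by rewrite exchange_big.
  do 3 apply: eq_bigr => ? _; rewrite /A mulr_sumr; apply: eq_bigr => z _.
  by rewrite /B mulr_sumr mulr_suml.
apply: le_trans (_ : \sum_k 2 * nc (\sum_p \sum_q gm p q * B k q * A k p) <= _).
  by rewrite -mulr_sumr ler_pM2l // nc_sum.
apply: le_trans (ler_sum _ (fun k _ => hg (B k) (A k))) _.
rewrite -mulr_sumr ler_wpM2l // big_split /= lerD //; exact: tensor_bessel.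
Qed.
End Bound.

Variables (d : Z -> Z -> nat) (h f : Z -> R) (c : R).
Hypothesis one : forall i j, \sum_k \sum_z \sum_x (a k i z * b k j x * (h z * f x)) *: 'X^(d z x) =
  c *: ((1 - 'X) * 'X^(i + j)) :> {poly R}.

Lemma tensor_poly p q : \sum_k \sum_(z : {ffun I -> Z}) \sum_(x : {ffun I -> Z})
   (tensor_vec a k p z * tensor_vec b k q x * (\prod_s h (z s) * \prod_s f (x s))) *:
     'X^(\sum_s d (z s) (x s)) = c ^+ N *: ((1 - 'X) ^+ N * 'X^(isum p + isum q)) :> {poly R}.
Proof.
transitivity (\prod_(s < N) (\sum_k \sum_z \sum_x
  (a k (p s) z * b k (q s) x * (h z * f x)) *: 'X^(d z x) : {poly R})).
  rewrite bigA_distr_bigA; apply: eq_bigr => k _; rewrite bigA_distr_bigA.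
  apply: eq_bigr => z _; rewrite bigA_distr_bigA; apply: eq_bigr => x _.
  by rewrite scaler_prod prodrXr !big_split.
under eq_bigr => s _ do rewrite one.
by rewrite scaler_prod prodr_const card_ord big_split /= prodrXr prodr_const card_ord big_split.
Qed.

(** Distances add over the coordinates, so X^d is multiplicative and the polynomial identity factors
    into [one]; the functional [poly_pair] then transfers it to an arbitrary phi, which is not
    multiplicative. *)
Lemma tensor_pairing phi :
  \sum_(z : {ffun I -> Z}) \sum_(x : {ffun I -> Z}) phi (\sum_s d (z s) (x s))%N * tensor_kernel z x *
      (\prod_s f (x s))%:C * (\prod_s h (z s))%:C =
  (c ^+ N)%:C * \sum_p \sum_q gm p q * iter N dd phi (isum p + isum q)%N.
Proof.
transitivity (\sum_p \sum_q gm p q * \sum_k \sum_(z : {ffun I -> Z}) \sum_(x : {ffun I -> Z})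
   (tensor_vec a k p z * tensor_vec b k q x * (\prod_s h (z s) * \prod_s f (x s)))%:C *
     phi (\sum_s d (z s) (x s))%N).
  transitivity (\sum_(z : {ffun I -> Z}) \sum_(x : {ffun I -> Z}) \sum_p \sum_q \sum_k gm p q *
   ((tensor_vec a k p z * tensor_vec b k q x * (\prod_s h (z s) * \prod_s f (x s)))%:C *
     phi (\sum_s d (z s) (x s))%N)).
    apply: eq_bigr => z _; apply: eq_bigr => x _; rewrite mulr_sumr !mulr_suml.
    apply: eq_bigr => p _; rewrite mulr_sumr !mulr_suml; apply: eq_bigr => q _.
    rewrite !mulr_sumr !mulr_suml; apply: eq_bigr => k _; rewrite !rCM; ring.
  under eq_bigr => z _ do rewrite exchange_big.
  rewrite exchange_big; apply: eq_bigr => p _ /=.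
  under eq_bigr => z _ do rewrite exchange_big.
  rewrite exchange_big; apply: eq_bigr => q _ /=.
  under eq_bigr => z _ do rewrite exchange_big.
  rewrite exchange_big mulr_sumr; apply: eq_bigr => k _ /=.
  by rewrite mulr_sumr; apply: eq_bigr => z _; rewrite mulr_sumr.
rewrite mulr_sumr; apply: eq_bigr => p _; rewrite mulr_sumr; apply: eq_bigr => q _.
rewrite [RHS]mulrCA; congr (_ * _).
rewrite -[X in _ = _ * X]poly_pairXn poly_pair_iter -poly_pairZ -tensor_poly poly_pair_sum; apply: eq_bigr => k _.
rewrite poly_pair_sum; apply: eq_bigr => z _; rewrite poly_pair_sum; apply: eq_bigr => x _.
by rewrite poly_pairZ poly_pairXn.
Qed.

End TensorKernel.

(** * Restriction of Schur multipliers to finite sets *)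

Section FiniteEmbedding.
Variables (R : realType) (V : choiceType) (Z : finType) (e : Z -> V).
Hypothesis einj : injective e.
Notation C := R[i].

Definition push_kernel (T : Z -> Z -> C) (x y : V) : C :=
  \sum_z \sum_w T z w *+ ((x == e z) && (y == e w)).

Lemma push_kernelE T z w : push_kernel T (e z) (e w) = T z w.
Proof.
rewrite /push_kernel (bigD1 z) //= [X in _ + X]big1 ?addr0 => [|z' ne].
  rewrite (bigD1 w) //= [X in _ + X]big1 ?addr0 ?eqxx // => w' ne.
  by rewrite (inj_eq einj w w') eq_sym (negPf ne) andbF.
by rewrite big1 // => w' _; rewrite (inj_eq einj z z') eq_sym (negPf ne).
Qed.

Lemma big_fset_pick (F : {fset V}) (f : V -> C) z :
  \sum_(x <- F) f x *+ (x == e z) = f (e z) *+ (e z \in F).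
Proof.
have [h|h] := boolP (e z \in F).
  rewrite (big_fsetD1 (e z)) //= eqxx mulr1n big_seq big1 ?addr0 // => x.
  by rewrite in_fsetD1 => /andP[/negPf -> _].
rewrite big_seq big1 // => x xF; case: eqP => // xe; by rewrite -xe xF in h.
Qed.

Lemma sum_pick_le (F : {fset V}) (f : V -> C) :
  \sum_z nc (f (e z) *+ (e z \in F)) ^+ 2 <= \sum_(x <- F) nc (f x) ^+ 2.
Proof.
have -> : \sum_z nc (f (e z) *+ (e z \in F)) ^+ 2 =
    \sum_(x <- F) \sum_z nc (f x) ^+ 2 *+ (x == e z).
  rewrite exchange_big; apply: eq_bigr => z _ /=.
  have [h|h] := boolP (e z \in F).
    rewrite (big_fsetD1 (e z)) //= eqxx mulr1n big_seq big1 ?addr0 // => x.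
    by rewrite in_fsetD1 => /andP[/negPf -> _].
  rewrite Normc.normc0 expr0n big_seq big1 // => x xF; case: eqP => // xe; by rewrite -xe xF in h.
apply: ler_sum => x _; have [[z ->]|nz] := pselect (exists z, x = e z).
  rewrite (bigD1 z) //= eqxx big1 ?addr0 // => w; rewrite eq_sym => ne.
  by rewrite (inj_eq einj) (negPf ne).
by rewrite big1 ?sqr_ge0 // => z _; case: eqP => // xe; case: nz; exists z.
Qed.

Lemma push_form_bound T g : 0 <= g -> fin_bound T g -> form_bound (push_kernel T) g.
Proof.
move=> g0 hT F G f h.
have -> : \sum_(x <- F) \sum_(y <- G) push_kernel T x y * f y * h x =
    \sum_z \sum_w T z w * (f (e w) *+ (e w \in G)) * (h (e z) *+ (e z \in F)).
  transitivity (\sum_(x <- F) \sum_(y <- G) \sum_z \sum_w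
     T z w * (f y *+ (y == e w)) * (h x *+ (x == e z))).
    apply: eq_bigr => x _; apply: eq_bigr => y _; rewrite /push_kernel !mulr_suml.
    apply: eq_bigr => z _; rewrite !mulr_suml; apply: eq_bigr => w _.
    by case: (x == e z); case: (y == e w); rewrite /= ?mulr1n ?mulr0n ?mul0r ?mulr0 ?mul0r.
  under eq_bigr => x _ do rewrite exchange_big.
  rewrite exchange_big; apply: eq_bigr => z _ /=.
  under eq_bigr => x _ do rewrite exchange_big.
  rewrite exchange_big; apply: eq_bigr => w _ /=.
  rewrite -!big_fset_pick mulr_sumr; apply: eq_bigr => x _.
  by rewrite mulr_sumr mulr_suml.
apply: le_trans (hT _ _) _.
by rewrite ler_wpM2l // lerD // sum_pick_le.
Qed.

(** A finite kernel is extended by zero to an operator, multiplied there, and read off again; [|K|]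
    appears because K carries no sign. *)
Lemma schur_finite (phi : V -> V -> C) (M : bounded_operator R V -> bounded_operator R V)
    (K : R) T g :
  (forall S, has_matrix (M S) (schur_product phi S)) ->
  (forall S, opnorm (M S) <= K * opnorm S) -> 0 <= g -> fin_bound T g ->
  forall u v : Z -> C,
  2 * nc (\sum_z \sum_w phi (e z) (e w) * T z w * u w * v z) <=
    `|K| * g * (\sum_w nc (u w) ^+ 2 + \sum_z nc (v z) ^+ 2).
Proof.
move=> hM hK g0 hT u v.
have [S [hS bS]] := op_of_form g0 (push_form_bound g0 hT).
have b1 : bounded_by (M S) (`|K| * g).
  move=> x; apply: le_trans (opnormP _ _) _; apply: ler_wpM2r; first exact: l2norm_ge0.
  apply: le_trans (hK S) _; apply: le_trans (ler_wpM2r (opnorm_ge0 S) (ler_norm K)) _.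
  by rewrite ler_wpM2l // opnorm_le.
have Kg : 0 <= `|K| * g by rewrite mulr_ge0.
pose F := [fset e z | z in Z]%fset.
have Fe z : e z \in F by apply/imfsetP; exists z.
have bigF (A : zmodType) (G : V -> A) : \sum_(x <- F) G x = \sum_z G (e z).
  by rewrite /F big_imfset //= => [|x y _ _ /einj]; rewrite ?big_enum.
pose ext (w : Z -> C) (x : V) := \sum_z w z *+ (x == e z).
have extE w z : ext w (e z) = w z.
  rewrite /ext (bigD1 z) //= eqxx big1 ?addr0 // => w'; rewrite eq_sym => ne.
  by rewrite (inj_eq einj) (negPf ne).
have := form_of_op Kg b1 F F (ext u) (ext v); rewrite !bigF.
under eq_bigr => z _ do rewrite bigF; under [in leRHS]eq_bigr => z _ do rewrite extE.
under [X in _ <= _ * (_ + X)]eq_bigr => z _ do rewrite extE.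
apply: le_trans; apply: eq_leW; congr (_ * nc _).
apply: eq_bigr => z _; apply: eq_bigr => w _; rewrite !extE hM /schur_product hS.
by rewrite push_kernelE.
Qed.

End FiniteEmbedding.

(** * Sums over words of a given length *)

Section WordSums.
Notation word := (seq (bool * bool)).

Definition wsum (A : nmodType) n (F : word -> A) : A := \sum_(t : n.-tuple (bool * bool)) F t.

Lemma wsum0 (A : nmodType) (F : word -> A) : wsum 0 F = F [::].
Proof.
rewrite /wsum (bigD1 [tuple]) //= big1 ?addr0 // => t; by rewrite (tuple0 t); case/eqP.
Qed.

Lemma wsumS (A : nmodType) n (F : word -> A) :
  wsum n.+1 F = \sum_t \sum_c wsum n (fun u => F ((t, c) :: u)).
Proof.
rewrite pair_big pair_big /wsum /=.
rewrite (reindex (fun p : (bool * bool) * n.-tuple (bool * bool) => [tuple of p.1 :: p.2])) /=.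
  by apply: eq_bigr => -[[t c] u] _.
exists (fun t : n.+1.-tuple (bool * bool) => (thead t, [tuple of behead t])) => [[b u] _|t _] /=.
  by congr (_, _); apply: val_inj.
by rewrite [RHS]tuple_eta; apply: val_inj.
Qed.

Lemma eq_wsum (A : nmodType) n (F G : word -> A) :
  (forall z, size z = n -> F z = G z) -> wsum n F = wsum n G.
Proof. by move=> h; apply: eq_bigr => t _; rewrite h ?size_tuple. Qed.

Lemma wsum_const (A : nmodType) n (a : A) : wsum n (fun=> a) = a *+ 4 ^ n.
Proof. by rewrite /wsum sumr_const card_tuple card_prod card_bool. Qed.

Lemma wsum_eq0 (A : nmodType) n (F : word -> A) :
  (forall z, size z = n -> F z = 0) -> wsum n F = 0.
Proof. by move=> h; rewrite (eq_wsum h) wsum_const mul0rn. Qed.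

Lemma big_bseq (A : nmodType) L (F : word -> A) :
  \sum_(z : {bseq L of bool * bool}) F z = \sum_(n < L.+1) wsum n F.
Proof.
rewrite (reindex tagged_tuple_bseq) /=; last exact/onW_bij/tagged_tuple_bseq_bij.
by rewrite (sig_big_dep (fun=> true) (fun _ _ => true) (fun (n : 'I_L.+1) (t : n.-tuple (bool * bool)) => F t)).
Qed.

Lemma wsum_prefix (A : nmodType) n w (F : word -> A) : (size w <= n)%N ->
  wsum n (fun z => F (drop (size w) z) *+ (take (size w) z == w)) = wsum (n - size w) F.
Proof.
elim: w n => [|[t c] w ih] n /=.
  by move=> _; rewrite subn0; apply: eq_wsum => z _; rewrite take0 drop0 eqxx.
case: n => // n; rewrite ltnS => h; rewrite wsumS (bigD1 t) //= (bigD1 c) //= subSS -ih //.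
rewrite [X in _ + X + _]big1 ?addr0 => [|c' ne]; last first.
  apply: wsum_eq0 => z _; rewrite eqseq_cons xpair_eqE (negPf ne) andbF; exact: mulr0n.
rewrite [X in _ + X]big1 ?addr0 => [|t' ne]; last first.
  by rewrite big1 // => c' _; apply: wsum_eq0 => z _; rewrite eqseq_cons xpair_eqE (negPf ne) /=; exact: mulr0n.
by apply: eq_wsum => z _; rewrite eqseq_cons eqxx.
Qed.

End WordSums.

(** * Orthogonal families on the tree *)

Section TreeVectors.
Variable R : realType.
Notation word := (seq (bool * bool)).
Implicit Types (s t c : bool) (i j n L : nat) (w z u v : word) (k : word * bool).

(** The empty word carries both markers: it has no next letter that could share a triangle with the
    other family. *)
Definition marked s u : bool := if u is b :: _ then b.1 == s else true.

(** The marker halves the 4^i words u unless i = 0. The exceptional value at 0 makes their number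
    times [amp i] equal to 2^i / 2 in all cases, while the norms stay at most 1. *)
Definition amp i : R := if i is 0 then 2^-1 else (2 ^+ i)^-1.

Definition head_coef s t i u : R :=
  if u is b :: u' then amp i * (-1) ^+ b.2 *+ ((b.1 == t) && marked s u') else 0.

(* branch s (w, t) i lives on the words w (t, c) u with |u| = i; the marker s of the
   first letter of u keeps the words of the two families in different triangles. *)
Definition branch s k i z : R :=
  head_coef s k.2 i (drop (size k.1) z) *+
    ((size z == size k.1 + i.+1)%N && (take (size k.1) z == k.1)).

Lemma wsum_marked s i : wsum i (fun u => (marked s u)%:R : R) = 2 ^+ i / 2 / amp i.
Proof.
case: i => [|i]; first by rewrite wsum0 /= expr0 mul1r divrr // unitfE invr_eq0.
rewrite wsumS (bigD1 s) //= [X in _ + X]big1 ?addr0 => [|t /negPf ne].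
  rewrite big_bool /= !wsum_const !eqxx /amp invrK natrX.
  by rewrite (_ : 4%:R = 2 * 2) ?exprMn -?natrM // exprS; lra.
by rewrite big1 // => c _; apply: wsum_eq0 => z _; rewrite ne.
Qed.

Lemma amp_gt0 i : 0 < amp i.
Proof. by case: i => [|i] /=; rewrite invr_gt0 ?exprn_gt0. Qed.

Lemma wsumZ (A : lmodType R) n (a : R) (F : word -> A) :
  wsum n (fun u => a *: F u) = a *: wsum n F.
Proof. by rewrite /wsum scaler_sumr. Qed.

Lemma head_sum (A : lmodType R) s t i (H : word -> A) :
  wsum i.+1 (fun u => head_coef s t i u *: H u) =
  \sum_(c : bool) (amp i * (-1) ^+ c) *: wsum i (fun u => (marked s u)%:R *: H ((t, c) :: u)).
Proof.
rewrite wsumS (bigD1 t) //= [X in _ + X]big1 ?addr0 => [|t' /negPf ne].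
  by apply: eq_bigr => c _; rewrite -wsumZ; apply: eq_wsum => u _; rewrite eqxx /= -mulr_natr scalerA.
by rewrite big1 // => c _; apply: wsum_eq0 => u _; rewrite ne mulr0n scale0r.
Qed.

Lemma head_sum_const (A : lmodType R) s t i (H : word -> A) (H' : bool -> A) :
  (forall c u, size u = i -> marked s u -> H ((t, c) :: u) = H' c) ->
  wsum i.+1 (fun u => head_coef s t i u *: H u) = (2 ^+ i / 2) *: (H' false - H' true).
Proof.
move=> hH; rewrite head_sum.
have e c : wsum i (fun u => (marked s u)%:R *: H ((t, c) :: u)) = (2 ^+ i / 2 / amp i) *: H' c.
  rewrite -(wsum_marked s) /wsum scaler_suml; apply: eq_bigr => u _.
  by case: (boolP (marked s u)) => h; rewrite ?scale0r // (hH c u) ?size_tuple.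
have a0 := amp_gt0 i.
rewrite big_bool /= !e !scalerA scalerBr expr1 expr0 addrC mulrN1 mulr1 mulNr scaleNr.
by rewrite mulrC divfK ?gt_eqF.
Qed.

Lemma branch_sum (A : lmodType R) L s k i (H : word -> A) :
  \sum_(z : {bseq L of bool * bool}) branch s k i z *: H z =
  wsum i.+1 (fun u => head_coef s k.2 i u *: H (k.1 ++ u)) *+ (size k.1 + i < L)%N.
Proof.
rewrite (big_bseq L (fun z => branch s k i z *: H z)).
have out n : n != (size k.1 + i.+1)%N -> wsum n (fun z => branch s k i z *: H z) = 0.
  by move=> ne; apply: wsum_eq0 => z sz; rewrite /branch sz (negPf ne) mulr0n scale0r.
case: ltnP => h; last first.
  by rewrite mulr0n big1 // => n _; apply: out; have := ltn_ord n; lia.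
have lt : (size k.1 + i.+1 < L.+1)%N by lia.
rewrite (bigD1 (Ordinal lt)) //= [X in _ + X]big1 ?addr0 => [|n ne]; last exact: out.
have le : (size k.1 <= size k.1 + i.+1)%N by lia.
have := wsum_prefix (fun u => head_coef s k.2 i u *: H (k.1 ++ u)) le.
rewrite (_ : size k.1 + i.+1 - size k.1 = i.+1)%N; last lia.
rewrite mulr1n => <-; apply: eq_wsum => z sz; rewrite /branch sz eqxx /=.
case: eqP => [e|_]; last by rewrite mulr0n scale0r.
have zE : z = k.1 ++ drop (size k.1) z by rewrite -{1}e cat_take_drop.
by rewrite !mulr1n -zE.
Qed.

Lemma branch_cat s k i u : branch s k i (k.1 ++ u) = head_coef s k.2 i u *+ (size u == i.+1).
Proof. by rewrite /branch drop_size_cat // take_size_cat // size_cat eqn_add2l eqxx andbT. Qed.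

Lemma branch_norm L s k i : \sum_(z : {bseq L of bool * bool}) branch s k i z ^+ 2 <= 1.
Proof.
under eq_bigr => z _ do rewrite expr2.
rewrite (@branch_sum R^o).
rewrite (@head_sum_const R^o _ _ _ _ (fun c => amp i * (-1) ^+ c)) => [|c u si hu]; last first.
  by rewrite branch_cat /= si !eqxx hu.
rewrite /= expr0 expr1 mulr1 mulrN1 opprK; case: (_ < _)%N; last by rewrite mulr0n ler01.
rewrite mulr1n -[_ *: _]/(2 ^+ i / 2 * (amp i + amp i)).
rewrite (_ : _ * _ = 2 ^+ i * amp i); last by field.
case: i => [|i]; first by rewrite /= expr0; lra.
by rewrite /= divff // expf_neq0.
Qed.

(** Beyond the letter after the base word, only the triangle bit of the next letter is inspected,
    never the bit choosing the vertex. *)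
Lemma branch_flip s k i w t c u : (size k.1 < size w)%N ->
  branch s k i (w ++ (t, ~~ c) :: u) = branch s k i (w ++ (t, c) :: u).
Proof.
move=> lt; rewrite /branch !size_cat /= !drop_cat lt !take_cat lt; congr (_ *+ _).
have : (0 < size (drop (size k.1) w))%N by rewrite size_drop subn_gt0.
by case: (drop _ w) => //= b [|b' d].
Qed.

(** With base words of equal length the supports are disjoint. Otherwise the vector with the longer
    base is odd under swapping the two siblings above its base, and the other one is even by
    [branch_flip]. *)
Lemma branch_orth L s k i k' i' : (k, i) != (k', i') ->
  \sum_(z : {bseq L of bool * bool}) branch s k i z * branch s k' i' z = 0.
Proof.
wlog le : k i k' i' / (size k.1 <= size k'.1)%N => [hw ne|].
  case/orP: (leq_total (size k.1) (size k'.1)) => h; first exact: hw.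
  by under eq_bigr => z _ do rewrite mulrC; apply: hw => //; rewrite eq_sym.
move: le; rewrite leq_eqVlt => /orP[/eqP e ne|lt _].
  apply: big1 => z _; rewrite /branch -e; case: k k' e ne => [w t] [w' t'] /= e ne.
  have [|] := boolP (_ && _); last by rewrite mulr0n mul0r.
  move=> /andP[/eqP s1 /eqP w1]; have [|] := boolP (_ && _); last by rewrite mulr0n mulr0.
  move=> /andP[/eqP s2 /eqP w2]; rewrite !mulr1n /head_coef.
  have ww : w = w' by rewrite -w1 -w2.
  have ii : i = i' by lia.
  case: (drop _ z) => [|b u]; first by rewrite mul0r.
  case: (b.1 =P t) => [t1|_]; last by rewrite mulr0n mul0r.
  case: (b.1 =P t') => [t2|_]; last by rewrite mulr0n mulr0.
  by case/eqP: ne; rewrite ww ii -t1 -t2.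
under eq_bigr => z _ do rewrite mulrC.
rewrite (@branch_sum R^o) (@head_sum R^o) big_bool /= expr0 expr1 mulr1 mulrN1 scaleNr.
case: (_ < _)%N; last exact: mulr0n.
rewrite mulr1n; apply/eqP; rewrite addrC subr_eq0; apply/eqP; congr (_ *: _).
by apply: eq_wsum => u _; rewrite -(branch_flip s i k'.2 true u lt).
Qed.

End TreeVectors.

(** * The pairing on one tree *)

Section TreePairing.
Variable R : realType.
Notation word := (seq (bool * bool)).
Implicit Types (s t c : bool) (i j n L : nat) (w z u v : word).

Definition test_wt w : R := (2 ^+ size w)^-1.
Definition shell K w : R := test_wt w *+ (K <= size w < 2 * K)%N.

Lemma tree_dist_cat w u v : tree_dist (w ++ u) (w ++ v) = tree_dist u v.
Proof. by elim: w => //= b w ih; rewrite tree_dist_cons. Qed.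

(** Different markers keep u and v from sharing a triangle when c = c', so the geodesic always
    passes through the two vertices (t, c) and (t, c'). *)
Lemma tree_dist_marked t c c' u v : marked false u -> marked true v ->
  tree_dist ((t, c) :: u) ((t, c') :: v) = (size u + size v + (c != c'))%N.
Proof.
move=> hu hv; have uv : lcp2 u v = 0%N.
  by case: u v hu hv => [|b u] [|b' v] //= /eqP -> /eqP ->.
by rewrite /tree_dist /= eqxx uv; case: (c == c'); lia.
Qed.

Lemma test_wt_sqsum K (F : word -> R) : (forall z, 0 <= F z <= test_wt z) ->
  \sum_(z : {bseq 3 * K of bool * bool}) F z ^+ 2 <= (3 * K).+1%:R.
Proof.
move=> hF; apply: le_trans (_ : \sum_(z : {bseq 3 * K of bool * bool}) test_wt z ^+ 2 <= _).
  by apply: ler_sum => z _; have /andP[h1 h2] := hF z; rewrite lerXn2r ?nnegrE // (le_trans h1).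
rewrite (big_bseq _ (fun z => test_wt z ^+ 2)).
rewrite (eq_bigr (fun=> 1)) ?sumr_const ?card_ord // => n _.
rewrite (eq_wsum (G := fun=> (4 ^+ n)^-1)) => [|z sz]; last first.
  by rewrite /test_wt sz exprVn exprAC -[2 ^+ 2]natrX.
by rewrite wsum_const -[LHS]mulr_natl natrX divff // expf_neq0.
Qed.

Lemma shell_count K j : (j < K)%N ->
  \sum_(n < (3 * K).+1) ((K <= n + j.+1 < 2 * K)%N%:R : R) = K%:R.
Proof.
move=> jK; rewrite -natr_sum; congr (_%:R).
transitivity (\sum_(K - j.+1 <= n < 2 * K - j.+1) 1)%N; last by rewrite sum_nat_const_nat; lia.
rewrite (@big_nat_widen _ _ _ _ _ (3 * K).+1); last lia.
rewrite (@big_nat_widenl _ _ _ _ 0) // big_mkcond big_mkord.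
by apply: eq_bigr => n _; congr (nat_of_bool _); lia.
Qed.

Lemma tree_pairing K (i j : 'I_K) :
  \sum_(k : {bseq 3 * K of bool * bool} * bool) \sum_(z : {bseq 3 * K of bool * bool})
  \sum_(x : {bseq 3 * K of bool * bool})
    (branch R false (val k.1, k.2) i z * branch R true (val k.1, k.2) j x * (test_wt z * shell K x)) *:
      'X^(tree_dist z x) = (K%:R / 4) *: ((1 - 'X) * 'X^(i + j)) :> {poly R}.
Proof.
have jK := ltn_ord j; have iK := ltn_ord i.
pose D : {poly R} := (1 - 'X) * 'X^(i + j).
(* Per base (w, t): the sums 2^i / 2 and 2^j / 2, the weights 2^-(|w|+i+1) and 2^-(|w|+j+1), and a 2
   from the signs give 4^-|w| / 8. The 4^n words of length n and the two triangles make this 1/4 for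
   each of the K admissible lengths. *)
transitivity (\sum_(w : {bseq 3 * K of bool * bool}) \sum_(t : bool)
    ((K <= size w + j.+1 < 2 * K)%N%:R * (4 ^+ size w)^-1 / 8) *: D); last first.
  under eq_bigr => w _ do rewrite sumr_const card_bool.
  rewrite (big_bseq _ (fun w => ((K <= size w + j.+1 < 2 * K)%N%:R * (4 ^+ size w)^-1 / 8) *: D *+ 2)).
  rewrite -(shell_count jK) mulr_suml scaler_suml; apply: eq_bigr => n _.
  rewrite (eq_wsum (G := fun=> ((K <= n + j.+1 < 2 * K)%N%:R * (4 ^+ n)^-1 / 8) *: D *+ 2)) => [|z -> //].
  rewrite wsum_const -mulrnA -[LHS]scaler_nat !scalerA natrM natrX; congr (_ *: _).
  have n0 : (4 ^+ n : R) != 0 by rewrite expf_neq0.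
  move: n0; set e := (_ && _)%:R; set d := (4 ^+ n : R) => d0.
  by field.
rewrite [RHS]pair_big /=; apply: eq_bigr => -[w t] _ /=.
transitivity (\sum_(z : {bseq 3 * K of bool * bool}) branch R false (val w, t) i z *: (test_wt z *:
   \sum_(x : {bseq 3 * K of bool * bool}) branch R true (val w, t) j x *: (shell K x *: 'X^(tree_dist z x))) : {poly R}).
  apply: eq_bigr => z _; rewrite !scaler_sumr; apply: eq_bigr => x _.
  by rewrite !scalerA; congr (_ *: _); ring.
rewrite (branch_sum _ _ _ _ (fun z => test_wt z *: \sum_(x : {bseq 3 * K of bool * bool})
   branch R true (val w, t) j x *: (shell K x *: 'X^(tree_dist z x)))) /=.
under eq_wsum => u _ do rewrite (branch_sum _ _ _ _ (fun x => shell K x *: 'X^(tree_dist (w ++ u) x))) /=.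
(* All x in the support have length |w| + j + 1, so the shell keeps or kills the branch as a whole.
   If it keeps it, then |w| < 2 K and, as i < K, the other branch lies entirely in the ball. *)
case: (boolP (K <= size w + j.+1 < 2 * K)%N) => hw; last first.
  rewrite !mul0r scale0r wsum_eq0 ?mul0rn // => u su.
  rewrite wsum_eq0 ?mul0rn ?scaler0 // => v sv.
  by rewrite /shell size_cat sv (negPf hw) mulr0n scale0r scaler0.
have -> : (size w + i < 3 * K)%N by lia.
have -> : (size w + j < 3 * K)%N by lia.
rewrite mulr1n mul1r.
pose H' c : {poly R} := ((2 ^+ size w * 2 ^+ i.+1)^-1 * (2 ^+ j / 2) * (2 ^+ size w * 2 ^+ j.+1)^-1) *:
   ('X^(i + j + (c != false)) - 'X^(i + j + (c != true))).
rewrite (head_sum_const (H' := H')) => [|c u su hu]; last first.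
  rewrite mulr1n (head_sum_const (H' := fun c' => (2 ^+ size w * 2 ^+ j.+1)^-1 *: 'X^(i + j + (c != c')))).
    rewrite /test_wt size_cat /= su exprD -scalerBr !scalerA; congr (_ *: _); ring.
  move=> c' v sv hv; rewrite tree_dist_cat tree_dist_marked // su sv; congr (_ *: _).
  by rewrite /shell /test_wt size_cat /= sv hw mulr1n exprD.
(* Over the four choices of c and c' the signs give X^(i+j) twice, for equal siblings, minus
   X^(i+j+1) twice, for distinct ones. *)
rewrite /H' -scalerBr scalerA /= addn0 addn1 (_ : _ - _ = 2 *: D).
  rewrite scalerA; congr (_ *: _).
  have -> : 4 ^+ size w = 2 ^+ size w * 2 ^+ size w :> R by rewrite -exprMn -natrM.
  have n0 n : (2 ^+ n : R) != 0 by rewrite expf_neq0.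
  rewrite !exprS; field; by rewrite !n0.
by rewrite /D exprS scaler_nat mulr2n; ring.
Qed.

End TreePairing.

(** * Schur multiplier implies trace class *)

Section Necessity.
Variables (R : realType) (m : nat) (phi : nat -> R[i]).
Notation N := m.+1.
Notation C := R[i].
Notation dd := (@discrete_derivative R).
Notation tree_power := (fun _ : 'I_N => triangle_tree).

Lemma tree_family : hyperbolic_family R tree_power.
Proof. by move=> i; split; [exact: tree_hyperbolic | exact: tree_bounded]. Qed.

Section Embedding.
Variable L : nat.
Notation Wd := {bseq L of bool * bool}.

Definition tree_embed (z : {ffun 'I_N -> Wd}) : product_vertex tree_power :=
  finfun (fun i => val (z i) : triangle_tree).

Lemma tree_embed_inj : injective tree_embed.
Proof.
move=> z w e; apply/ffunP => i; apply: val_inj.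
by move: (congr1 (fun f : product_vertex tree_power => f i) e); rewrite !ffunE.
Qed.

Lemma tree_embed_dist z w : product_dist (tree_embed z) (tree_embed w) = (\sum_i tree_dist (z i) (w i))%N.
Proof. by apply: eq_bigr => i _; rewrite !ffunE tree_gdist. Qed.
End Embedding.

Lemma necessity : schur_multiplier (@radial_symbol R phi N tree_power) ->
  exists2 T : bounded_operator R nat, has_matrix T (gen_hankel N phi) & trace_class T.
Proof.
move=> [M [hM [K0 hK0]]]; apply: (@hankel_trace_class _ _ _ (`|K0| * 16 ^+ N)) => K g gm g0 hg.
(* For K = 0 there are no multi-indices; for K > 0 one can divide by (K/4)^N, and the ball bound 3 K
   + 1 is at most 4 K. *)
have [K_0|K_gt0] := posnP K.
  rewrite big1 ?Normc.normc0 ?mulr_ge0 ?exprn_ge0 ?(ltW g0) // => a _.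
  by have := ltn_ord (a ord0); lia.
pose Wd := {bseq 3 * K of bool * bool}.
pose av s (k : Wd * bool) (i : 'I_K) (z : Wd) := branch R s (val k.1, k.2) i z.
have orth s k i k' i' : (k, i) != (k', i') -> \sum_z av s k i z * av s k' i' z = 0.
  move=> ne; apply: branch_orth; apply: contraNneq ne => -[e1 e2 e3].
  case: k k' e1 e2 => [w t] [w' t'] /= e1 ->.
  by rewrite (val_inj e1) (val_inj e3).
have unit s k i : \sum_z av s k i z ^+ 2 <= 1 by exact: branch_norm.
have T0 := tensor_kernel_bound (orth false) (unit false) (orth true) (unit true) (ltW g0) hg.
pose u (x : {ffun 'I_N -> Wd}) : C := (\prod_s shell R K (x s))%:C.
pose v (z : {ffun 'I_N -> Wd}) : C := (\prod_s test_wt R (z s))%:C.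
have := schur_finite (@tree_embed_inj _) hM hK0 (ltW g0) T0 u v.
have -> : \sum_z \sum_w radial_symbol phi (tree_embed z) (tree_embed w) *
   tensor_kernel (av false) (av true) gm z w * u w * v z =
   ((K%:R / 4) ^+ N)%:C * \sum_p \sum_q gm p q * iter N dd phi (isum p + isum q)%N.
  have one := @tree_pairing R K.
  rewrite -(@tensor_pairing _ _ _ _ _ (av false) (av true) gm (fun z x => tree_dist z x) _ _ _ one).
  apply: eq_bigr => z _; apply: eq_bigr => w _.
  by rewrite /radial_symbol tree_embed_dist.
have wt0 (z : seq (bool * bool)) : 0 <= test_wt R z by rewrite invr_ge0 exprn_ge0.
have sq (F : seq (bool * bool) -> R) : (forall z, 0 <= F z <= test_wt R z) ->
    \sum_(z : {ffun 'I_N -> Wd}) nc (\prod_s F (z s))%:C ^+ 2 <= (4 * K%:R) ^+ N.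
  move=> hF; under eq_bigr => z _ do rewrite nc_real real_normK ?num_real // -prodrXl.
  rewrite -(bigA_distr_bigA (fun (s : 'I_N) (z : Wd) => F z ^+ 2)) prodr_const card_ord.
  have h0 : 0 <= \sum_(z : Wd) F z ^+ 2 by apply: sumr_ge0 => z _; exact: sqr_ge0.
  rewrite lerXn2r ?nnegrE // ?mulr_ge0 //; apply: le_trans (test_wt_sqsum K hF) _.
  by rewrite -natrM ler_nat; lia.
have hu := sq (shell R K); have hv := sq (test_wt R).
set S := \sum_p _; rewrite -/u -/v.
have Kr0 : 0 < (K%:R : R) by rewrite ltr0n.
rewrite Normc.normcM nc_real ger0_norm ?exprn_ge0 ?divr_ge0 // => h.
have {hu} hu : \sum_w nc (u w) ^+ 2 <= (4 * K%:R) ^+ N.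
  by apply: hu => z; rewrite /shell; case: (K <= size z < 2 * K)%N; rewrite ?mulr1n ?mulr0n ?lexx ?wt0.
have {hv} hv : \sum_w nc (v w) ^+ 2 <= (4 * K%:R) ^+ N by apply: hv => z; rewrite lexx wt0.
have Kg : 0 <= `|K0| * g by rewrite mulr_ge0 // ltW.
have K4 : 0 < (K%:R / 4) ^+ N :> R by rewrite exprn_gt0 // divr_gt0.
rewrite -(ler_pM2l K4) -(ler_pM2l (ltr0n _ 2)).
apply: le_trans h _; apply: le_trans (ler_wpM2l Kg (lerD hu hv)) _.
apply: eq_leW.
(* Squared norms (4 K)^N against the pairing constant (K/4)^N: K cancels and 16^N remains. *)
have -> : (4 * K%:R) ^+ N = (K%:R / 4) ^+ N * 16 ^+ N :> R by rewrite -exprMn; congr (_ ^+ _); field.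
by ring.
Qed.

End Necessity.

(** * Assembling the equivalence and the norm estimate *)

Section Assembly.
Variables (R : realType) (m : nat).
Notation N := m.+1.
Implicit Types (phi : nat -> R[i]) (T : bounded_operator R nat).

Lemma hankel_limit phi M T : (forall n, nc (phi n) <= M) ->
  has_matrix T (gen_hankel N phi) -> trace_class T -> exists c, tends_to phi c.
Proof. by move=> hM hT tT; have [B hB] := hankel_sum hT tT; exact: hankel_cvg hM hB. Qed.

Lemma schur_of_form (V : choiceType) (phi : V -> V -> R[i]) K : 0 <= K ->
  (forall S : bounded_operator R V, form_bound (schur_product phi S) (K * opnorm S)) ->
  schur_multiplier phi.
Proof.
move=> K0 h.
have ex S : exists S', has_matrix S' (schur_product phi S) /\ bounded_by S' (K * opnorm S).
  by apply: op_of_form (h S); rewrite mulr_ge0 ?opnorm_ge0.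
exists (fun S => projT1 (cid (ex S))); split=> [S|]; first by case: (cid _) => S' [].
exists K => S; case: (cid _) => S' [_ hb] /=.
by apply: opnorm_le hb; rewrite mulr_ge0 ?opnorm_ge0.
Qed.

Lemma cb_norm_le (V : choiceType) (phi : V -> V -> R[i]) K : 0 <= K ->
  (forall S : bounded_operator R V, form_bound (schur_product phi S) (K * opnorm S)) ->
  (cb_norm phi <= K%:E)%E.
Proof.
move=> K0 h; apply: ge_ereal_sup => _ [S' [S S1 hS] <-]; rewrite lee_fin.
apply: le_trans (opnorm_form _ hS (h S)) _; first by rewrite mulr_ge0 ?opnorm_ge0.
by rewrite ler_piMr.
Qed.

End Assembly.

Theorem theoremB (R : realType) (N : nat) (hN : (1 <= N)%N) :
  (forall phi : nat -> R[i],
     (exists M : R, forall n, Normc.normc (phi n) <= M) ->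
     ((forall X : 'I_N -> connected_graph, hyperbolic_family R X ->
         schur_multiplier (@radial_symbol R phi N X))
      <->
      (exists2 T : bounded_operator R nat,
         has_matrix T (gen_hankel N phi) & trace_class T))
     /\
     ((exists2 T : bounded_operator R nat,
         has_matrix T (gen_hankel N phi) & trace_class T) ->
      exists c : R[i], phi @ \oo --> (c : R[i]^o)))
  /\
  (forall X : 'I_N -> connected_graph, hyperbolic_family R X ->
   exists2 C : R, 0 < C &
     forall (phi : nat -> R[i]) (T : bounded_operator R nat) (c : R[i]),
       (exists M : R, forall n, Normc.normc (phi n) <= M) ->
       has_matrix T (gen_hankel N phi) -> trace_class T ->
       phi @ \oo --> (c : R[i]^o) ->
       (cb_norm (@radial_symbol R phi N X)
        <= C%:E * trace_norm T + (Normc.normc c)%:E)%E).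
Proof.
case: N hN => [//|m] _.
have t0 (T : bounded_operator R nat) : 0 <= fine (trace_norm T).
  apply: fine_ge0; apply: esum_ge0 => i _; rewrite lee_fin; exact: absop_diag.
split.
  move=> phi [M hM]; split; last first.
    move=> [T hT tT]; have [c hc] := hankel_limit hM hT tT.
    by exists c; apply/tends_toP.
  split=> [h|[T hT tT] X hX]; first by apply: necessity; apply: h; exact: tree_family.
  have [c hc] := hankel_limit hM hT tT.
  have [A A0 hA] := sufficiency hX.
  apply: schur_of_form (hA _ _ _ hT tT hc).
  by rewrite addr_ge0 ?nc_ge0 // mulr_ge0 // ltW.
move=> X hX; have [A A0 hA] := sufficiency hX; exists A => // phi T c _ hT tT /tends_toP hc.
rewrite -(trace_norm_fin tT) -EFinM -EFinD; apply: cb_norm_le (hA _ _ _ hT tT hc).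
by rewrite addr_ge0 ?nc_ge0 // mulr_ge0 // ltW.
Qed.
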